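(* Let $\phi\in\mathcal S_d$ with $\sup_\xi|\widehat\phi(\xi)|=1$ such that every point of $\Omega(\phi)$ is of positive homogeneous or imaginary homogeneous type for $\widehat\phi$; let $\Omega_p(\phi)$, $\Omega_i(\phi)$ be the sets of points of positive, respectively imaginary, homogeneous type, and $\mu_\phi=\min_{\xi\in\Omega(\phi)}\mu_\xi$. If $\Omega_i(\phi)\ne\emptyset$ assume moreover: (i) $\mu_\xi<1$ for all $\xi\in\Omega_i(\phi)$; (ii) $\mu_\xi=\mu_\phi$ for some $\xi\in\Omega_i(\phi)$; (iii) there is $\alpha\in\mathbb{R}^d$ with $\alpha_\xi=\alpha$ for all $\xi\in\Omega_i(\phi)$. Then: Case 1: If $\Omega(\phi)=\Omega_p(\phi)$, let $\xi_1,\dots,\xi_A$ be the points of $\Omega(\phi)$ with $\mu_{\xi_k}=\mu_\phi$, $\alpha_k=\alpha_{\xi_k}$, $P_k=P_{\xi_k}$. Then $\phi^{(n)}(x)=\sum_{k=1}^A\widehat\phi(\xi_k)^ne^{-ix\cdot\xi_k}H^n_{P_k}(x-n\alpha_k)+o(n^{-\mu_\phi})$ uniformly for $x\in\mathbb{Z}^d$. Case 2a: If $\Omega_i(\phi)\neq\emptyset$ and either $\Omega(\phi)=\Omega_i(\phi)$ or $\mu_\xi>\mu_\phi$ for all $\xi\in\Omega_p(\phi)$, let $\xi_1,\dots,\xi_A$ (all in $\Omega_i(\phi)$) be the points with $\mu_{\xi_k}=\mu_\phi$ and $Q_k=Q_{\xi_k}$. Then for each compact $K\subseteq\mathbb{R}^d$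 there is a nested increasing sequence of compact sets $K_n$, each containing $K$, with $\bigcup_nK_n=\mathbb{R}^d$, such that $\phi^{(n)}(x)=\sum_{k=1}^A\widehat\phi(\xi_k)^ne^{-ix\cdot\xi_k}H^n_{iQ_k}(x-n\alpha)+o(n^{-\mu_\phi})$ uniformly for $x\in(n\alpha+K_n)\cap\mathbb{Z}^d$. Case 2b: If both $\Omega_i(\phi)$ and $\Omega_p(\phi)$ contain points of order $\mu_\phi$, let $\xi_1,\dots,\xi_{A_i}$ be those in $\Omega_i(\phi)$ (with $Q_k=Q_{\xi_k}$) and $\zeta_1,\dots,\zeta_{A_p}$ those in $\Omega_p(\phi)$ (with $\alpha_j=\alpha_{\zeta_j}$, $P_j=P_{\zeta_j}$). Then for each compact $K$ there is a nested increasing sequence of compact sets $K_n\supseteq K$ with union $\mathbb{R}^d$ such that $\phi^{(n)}(x)=\sum_{k=1}^{A_i}\widehat\phi(\xi_k)^ne^{-ix\cdot\xi_k}H^n_{iQ_k}(x-n\alpha)+\sum_{j=1}^{A_p}\widehat\phi(\zeta_j)^ne^{-ix\cdot\zeta_j}H^n_{P_j}(x-n\alpha_j)+o(n^{-\mu_\phi})$ uniformly for $x\in(n\alpha+K_n)\cap\mathbb{Z}^d$.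
   Context: Notation: $t^E:=\exp(\log(t)E)$. $P$ homogeneous w.r.t. $E$: $P(t^E\xi)=tP(\xi)$; $\mathrm{Exp}(P)$ = set of such $E$. Positive homogeneous: real, continuous, positive definite ($\ge0$, zero only at $0$), $\mathrm{Exp}(P)\ne\emptyset$, $\{P=1\}$ compact; homogeneous order $\mu_P=\mathrm{tr}E$, $E\in\mathrm{Exp}(P)$. For $E$ with $\|t^E\|\to0$ as $t\to0$: subhomogeneous w.r.t. $E$ means for each $\epsilon>0$, compact $K$ there is $\tau>0$ with $|\widetilde P(t^E\xi)|\le\epsilon t$, $0<t<\tau$, $\xi\in K$; strongly subhomogeneous of order $l$: $C^l$ near $0$ and $|t^k\partial_t^k\widetilde P(t^E\xi)|\le\epsilon t$ for $k\le l$. $\mathcal S_d$ = $\phi:\mathbb{Z}^d\to\mathbb{C}$ with $\sum_x|x^\beta\phi(x)|<\infty$ for all multi-indices $\beta$; $\widehat\phi(\xi)=\sum_x\phi(x)e^{ix\cdot\xi}$; $\phi^{(n)}$ is the $n$-fold convolution power; $\Omega(\phi)=\{\xi\in(-\pi,\pi]^d:|\widehat\phi(\xi)|=1\}$. For $\xi_0\in\Omega(\phi)$, $\Gamma_{\xi_0}(\xi)=\log(\widehat\phi(\xi+\xi_0)/\widehat\phi(\xi_0))$ near $0$, written $i\alpha\cdot\xi-i(Q+\widetilde Q)-(R+\widetilde R)$ ($\alpha\in\mathbb{R}^d$; $Q,R$ real polynomials vanishing at $0$ without linear terms; $\widetilde Q,\widetilde R$ real smooth vanishing at $0$). Positive homogeneous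 type: $R$ positive homogeneous and some $E\in\mathrm{Exp}(R)$ with $Q$ homogeneous w.r.t. $E$, $\widetilde Q,\widetilde R$ subhomogeneous w.r.t. $E$; $P_{\xi_0}=R+iQ$, $\mu_{\xi_0}=\mu_R$. Imaginary homogeneous type: $|Q|,R$ positive homogeneous, some $E\in\mathrm{Exp}(|Q|)$, $k>1$ with $R$ homogeneous w.r.t. $E/k$, $\widetilde Q$ strongly subhomogeneous w.r.t. $E$ of order 2, $\widetilde R$ strongly subhomogeneous w.r.t. $E/k$ of order 1; $Q_{\xi_0}=Q$, $\mu_{\xi_0}=\mu_{|Q|}$. Drift $\alpha_{\xi_0}=\alpha$. Attractors: $H^t_P(x)=(2\pi)^{-d}\int_{\mathbb{R}^d}e^{-tP(\xi)}e^{-ix\cdot\xi}d\xi$; for continuous real $Q$ with $|Q|$ positive homogeneous, $\mu_{|Q|}<1$, $H^t_{iQ}(x)=(2\pi)^{-d}\lim_{\tau\to\infty}\int_{\{|Q|<\tau\}}e^{-itQ(\xi)-ix\cdot\xi}d\xi$. *)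

(* Defs.v *)
From mathcomp Require Import all_boot all_order all_algebra.
From mathcomp Require Import all_classical all_reals all_analysis.
From mathcomp Require Import complex.
Set Implicit Arguments.
Unset Strict Implicit.
Unset Printing Implicit Defensive.
Import Order.TTheory GRing.Theory Num.Theory.
Import numFieldNormedType.Exports.
Local Open Scope ring_scope.
Local Open Scope classical_set_scope.

Section Defs.
Variable R : realType.
Variable d : nat.
Local Notation C := R[i].
Local Notation vec := 'rV[R]_d.
Local Notation zvec := 'rV[int]_d.

Definition cre (z : C) : R := complex.Re z.
Definition cim (z : C) : R := complex.Im z.
Definition cmod (z : C) : R := Num.sqrt (cre z ^+ 2 + cim z ^+ 2).
Definition cexp (z : C) : C :=
  Complex (expR (cre z) * cos (cim z)) (expR (cre z) * sin (cim z)).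
Definition cR (x : R) : C := Complex x 0.

Definition dot (u v : vec) : R := \sum_(i < d) u 0 i * v 0 i.
Definition zR (x : zvec) : vec := map_mx (fun k : int => k%:~R) x.

Definition boxpt (N : nat) (v : 'rV['I_(N.*2).+1]_d) : zvec :=
  map_mx (fun k : 'I_(N.*2).+1 => (k : nat)%:Z - N%:Z) v.
Definition boxsumC (N : nat) (f : zvec -> C) : C :=
  \sum_(v : 'rV['I_(N.*2).+1]_d) f (boxpt v).
Definition boxsumR (N : nat) (f : zvec -> R) : R :=
  \sum_(v : 'rV['I_(N.*2).+1]_d) f (boxpt v).

(* sum over Z^d: limit of the partial sums over the boxes [-N,N]^d
   (used only for absolutely summable families, for which it is the sum) *)
Definition zsum (f : zvec -> C) : C :=
  Complex (lim ((fun N => cre (boxsumC N f)) @ \oo))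
          (lim ((fun N => cim (boxsumC N f)) @ \oo)).

Definition zmono (x : zvec) (b : 'rV[nat]_d) : R :=
  \prod_(i < d) ((x 0 i)%:~R) ^+ (b 0 i).
Definition mono (xi : vec) (b : 'rV[nat]_d) : R :=
  \prod_(i < d) (xi 0 i) ^+ (b 0 i).

Definition in_Sd (phi : zvec -> C) : Prop :=
  forall b : 'rV[nat]_d, exists M : R, forall N,
    boxsumR N (fun x => `|zmono x b| * cmod (phi x)) <= M.

Definition fhat (phi : zvec -> C) (xi : vec) : C :=
  zsum (fun x => phi x * cexp (Complex 0 (dot (zR x) xi))).

Definition conv (f g : zvec -> C) (x : zvec) : C := zsum (fun y => f (x - y) * g y).
Fixpoint cpow (phi : zvec -> C) (n : nat) : zvec -> C :=
  match n with
  | 0 => fun x => if x == 0 then 1 else 0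
  | n.+1 => conv (cpow phi n) phi
  end.

Definition Omega (phi : zvec -> C) : set vec :=
  [set xi : vec | (forall i, - pi < xi 0 i <= pi) /\ cmod (fhat phi xi) = 1].

Definition mpow (A : 'M[R]_d) (k : nat) : 'M[R]_d := iter k (mulmx A) 1%:M.
Definition mexp (A : 'M[R]_d) : 'M[R]_d :=
  \matrix_(i, j) lim ((fun N => (\sum_(k < N) (k`!%:R)^-1 *: mpow A k) i j) @ \oo).
Definition tpow (E : 'M[R]_d) (t : R) : 'M[R]_d := mexp (ln t *: E).
(* the action xi |-> t^E xi (row-vector convention) *)
Definition act (E : 'M[R]_d) (t : R) (xi : vec) : vec := xi *m (tpow E t)^T.

Definition homog (P : vec -> R) (E : 'M[R]_d) : Prop :=
  forall t, 0 < t -> forall xi, P (act E t xi) = t * P xi.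
Definition Exps (P : vec -> R) : set 'M[R]_d := [set E : 'M[R]_d | homog P E].

Definition pos_homog (P : vec -> R) : Prop :=
  continuous P /\ (forall xi, 0 <= P xi) /\ (forall xi, P xi = 0 <-> xi = 0) /\
  Exps P !=set0 /\ compact [set xi : vec | P xi = 1].

(* homogeneous order mu_P = tr E for E in Exp(P) *)
Definition hom_order (E : 'M[R]_d) : R := \tr E.

Definition contracting (E : 'M[R]_d) : Prop :=
  forall i j, (fun t => tpow E t i j) @ 0^'+ --> 0.

Definition subhomog (f : vec -> R) (E : 'M[R]_d) : Prop :=
  contracting E /\
  forall eps, 0 < eps -> forall K : set vec, compact K ->
    exists tau, 0 < tau /\
      forall t, 0 < t < tau -> forall xi, K xi -> `|f (act E t xi)| <= eps * t.

Definition ev (j : 'I_d) : vec := delta_mx 0 j.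
Definition pder (js : seq 'I_d) (f : vec -> R) : vec -> R :=
  foldr (fun j g => fun x => 'D_(ev j) g x) f js.
Definition Ck_on (r : R) (l : nat) (f : vec -> R) : Prop :=
  forall js : seq 'I_d, (size js <= l)%N -> forall x, ball (0 : vec) r x ->
    {for x, continuous (pder js f)} /\
    ((size js < l)%N -> forall j, derivable (pder js f) x (ev j)).
Definition Ck_near0 (l : nat) (f : vec -> R) : Prop :=
  exists r, 0 < r /\ Ck_on r l f.
Definition smooth_near0 (f : vec -> R) : Prop :=
  exists r, 0 < r /\ forall l, Ck_on r l f.

Definition strong_subhomog (f : vec -> R) (E : 'M[R]_d) (l : nat) : Prop :=
  contracting E /\ Ck_near0 l f /\
  forall eps, 0 < eps -> forall K : set vec, compact K ->
    exists tau, 0 < tau /\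
      forall t, 0 < t < tau -> forall xi, K xi -> forall k, (k <= l)%N ->
        `|t ^+ k * derive1n k (fun s => f (act E s xi)) t| <= eps * t.

Definition poly_nolin (Q : vec -> R) : Prop :=
  exists s : seq (R * 'rV[nat]_d),
    (forall p, p \in s -> (2 <= \sum_(i < d) p.2 ord0 i)%N) /\
    forall xi, Q xi = \sum_(p <- s) p.1 * mono xi p.2.

Record tdata := TData {
  td_pos : bool;          (* true: positive homogeneous type; false: imaginary *)
  td_alpha : vec;
  td_Q : vec -> R;
  td_R : vec -> R;
  td_Qt : vec -> R;
  td_Rt : vec -> R;
  td_E : 'M[R]_d;
  td_k : R }.

(* Gamma_{xi0}(xi) = log(hat phi(xi+xi0)/hat phi(xi0))
     = i alpha.xi - i(Q + Qt)(xi) - (R + Rt)(xi)   near 0 *)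
Definition expansion (phi : zvec -> C) (xi0 : vec) (D : tdata) : Prop :=
  poly_nolin (td_Q D) /\ poly_nolin (td_R D) /\
  td_Qt D 0 = 0 /\ td_Rt D 0 = 0 /\
  smooth_near0 (td_Qt D) /\ smooth_near0 (td_Rt D) /\
  exists r, 0 < r /\ forall xi, ball (0 : vec) r xi ->
    fhat phi (xi + xi0) / fhat phi xi0 =
    cexp (Complex (- (td_R D xi + td_Rt D xi))
                  (dot (td_alpha D) xi - (td_Q D xi + td_Qt D xi))).

Definition pos_type (phi : zvec -> C) (xi0 : vec) (D : tdata) : Prop :=
  expansion phi xi0 D /\
  pos_homog (td_R D) /\ homog (td_R D) (td_E D) /\ homog (td_Q D) (td_E D) /\
  subhomog (td_Qt D) (td_E D) /\ subhomog (td_Rt D) (td_E D).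

Definition imag_type (phi : zvec -> C) (xi0 : vec) (D : tdata) : Prop :=
  expansion phi xi0 D /\
  pos_homog (fun xi => `|td_Q D xi|) /\ pos_homog (td_R D) /\
  homog (fun xi => `|td_Q D xi|) (td_E D) /\ 1 < td_k D /\
  homog (td_R D) ((td_k D)^-1 *: td_E D) /\
  strong_subhomog (td_Qt D) (td_E D) 2 /\
  strong_subhomog (td_Rt D) ((td_k D)^-1 *: td_E D) 1.

(* mu_{xi} : for both types, mu = tr E with E in Exp(R) resp. Exp(|Q|) *)
Definition mu_pt (D : tdata) : R := hom_order (td_E D).

Definition vcons (n : nat) (x : R) (y : 'rV[R]_n) : 'rV[R]_n.+1 :=
  \row_(i < n.+1) match unlift ord0 i with None => x | Some j => y 0 j end.

Fixpoint iint (n : nat) : ('rV[R]_n -> R) -> R :=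
  match n with
  | 0 => fun f => f 0
  | n'.+1 => fun f =>
      Rintegral (@lebesgue_measure R) setT (fun x => iint (fun y => f (vcons x y)))
  end.
Definition ciint (f : vec -> C) : C :=
  Complex (iint (fun xi => cre (f xi))) (iint (fun xi => cim (f xi))).

(* H^t_P(x) for P = RP + i QP *)
Definition Hpos (RP QP : vec -> R) (t : R) (x : vec) : C :=
  cR ((2 * pi) ^- d) *
  ciint (fun xi => cexp (Complex (- (t * RP xi)) (- (t * QP xi) - dot x xi))).

Definition Himag (QP : vec -> R) (t : R) (x : vec) : C :=
  let g := fun xi => cexp (Complex 0 (- (t * QP xi) - dot x xi)) in
  cR ((2 * pi) ^- d) *
  Complex (lim ((fun tau => iint (fun xi => if `|QP xi| < tau then cre (g xi) else 0)) @ +oo))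
          (lim ((fun tau => iint (fun xi => if `|QP xi| < tau then cim (g xi) else 0)) @ +oo)).

Definition unif_approx (F G : nat -> zvec -> C) (A : nat -> set zvec) (mu : R) : Prop :=
  forall eps, 0 < eps -> exists N, forall n, (N <= n)%N -> forall x, A n x ->
    cmod (F n x - G n x) <= eps * (n%:R `^ (- mu)).

Definition term_pos (phi : zvec -> C) (D : vec -> tdata) (xi : vec) (n : nat) (x : zvec) : C :=
  fhat phi xi ^+ n * cexp (Complex 0 (- dot (zR x) xi)) *
  Hpos (td_R (D xi)) (td_Q (D xi)) n%:R (zR x - n%:R *: td_alpha (D xi)).
Definition term_imag (phi : zvec -> C) (D : vec -> tdata) (alpha : vec) (xi : vec)
    (n : nat) (x : zvec) : C :=
  fhat phi xi ^+ n * cexp (Complex 0 (- dot (zR x) xi)) *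
  Himag (td_Q (D xi)) n%:R (zR x - n%:R *: alpha).

Definition exhaustion (K : set vec) (Kn : nat -> set vec) : Prop :=
  (forall n, compact (Kn n) /\ K `<=` Kn n /\ Kn n `<=` Kn n.+1) /\
  \bigcup_n Kn n = setT.

End Defs.
Arguments zR {R d} x.

(* Main.v *)
(** Fourier inversion over a period box writes [(2 pi)^d phi^(n)(x)] as the
    integral of [fhat^n e^(-i x.xi)].  The points of Omega are isolated, hence
    finitely many, and away from them [|fhat| <= rho < 1], which contributes
    [O(rho^n)].  Near a point of Omega the integrand is a unimodular constant
    times [exp(-n(R + Rt) - i(n(Q + Qt) + y.xi))] with [y = x - n alpha].

    At a point of positive type, dropping [Rt] and [Qt] costs [o(n^-mu)] on
    [R < M / n] by subhomogeneity, and [R >= M / n] is negligible by the decay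
    of [exp(-n R / 2)].

    At a point of imaginary type there is no absolute convergence.  Along a ray
    [t^E w] with [|Q w| = 1] the phase [n Q] is [n t] up to sign; for bounded [y]
    and [t >= M / n] its derivative dominates that of [n Qt + y.xi], so
    van der Corput's lemma bounds the integral over [a <= |Q| < b] by
    [O(a^(mu - 1) / n)].  At [a = M / n] this is [O(M^(mu - 1) n^-mu)], which is
    small for large [M] since [mu < 1]; the core [|Q| < M / n] is treated as in
    the positive case.  A diagonal choice of slowly growing balls gives [K_n]. *)

From HB Require Import structures.
Require Import Defs.
From mathcomp Require Import all_boot all_order fingroup perm all_algebra.
From mathcomp Require Import all_classical all_reals all_analysis.
From mathcomp Require Import measurable_realfun complex ring lra.
Set Implicit Arguments.
Unset Strict Implicit.
Unset Printing Implicit Defensive.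
Import Order.TTheory GRing.Theory Num.Theory.
Import numFieldNormedType.Exports.
Local Open Scope ring_scope.
Local Open Scope classical_set_scope.

(** * Lebesgue measure on row vectors *)

(** The oscillatory estimate lives on the rays t^E w, yet no polar decomposition of Lebesgue measure
    is constructed: averaging an integrand over the dilations s^E, 1 <= s <= 2, changes its integral
    only by a fixed constant, and Fubini then exposes a one-dimensional integral along each ray,
    with a factor 1 / |Q| that makes dyadic shells summable for mu < 1. The linear phase is harmless
    at large t because |t^E w| = O(t^mu), a bound read off from the adjugate of t^-E; with mu < 1
    its radial derivative is O(|y| (1 + 1 / t)). At an imaginary point [R] is homogeneous for E / k
    with k > 1, hence R = O(|Q|^k) near 0: on the scale |Q| ~ 1 / n the damping disappears, so the
    attractor is purely oscillatory. Further out the damping only enters the amplitude A, with t A'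
    bounded. The definitions use total operations (iterated [Rintegral], [lim], [derive1n]), so
    integrability, convergence or differentiability must back each of them before an estimate means
    anything. Real and imaginary parts are treated at once by a phase shift of 0 or pi / 2 inside a
    cosine. *)

Section VectorMeasurability.
Context {R : realType}.

Section Structure.
Variable n : nat.
Let coor : 'I_n -> 'rV[R]_n -> R := fun i v => v 0 i.

Let sig0 : g_sigma_preimage coor set0.
Proof. exact: sigma_algebra0. Qed.

Let sigC A : g_sigma_preimage coor A -> g_sigma_preimage coor (~` A).
Proof. exact: sigma_algebraC. Qed.

Let sigU (F : (set 'rV[R]_n)^nat) : (forall i, g_sigma_preimage coor (F i)) ->
  g_sigma_preimage coor (\bigcup_i (F i)).
Proof. exact: sigma_algebra_bigcup. Qed.

(** Generated by the coordinates rather than by the open sets: measurability of a map into row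
    vectors is then a coordinatewise matter. That continuous functions are measurable has to be
    proved, in [continuous_measurable_rV]. *)
HB.instance Definition _ := @isMeasurable.Build default_measure_display
  'rV[R]_n (g_sigma_preimage coor) sig0 sigC sigU.

End Structure.

Lemma measurable_coor n (i : 'I_n) :
  measurable_fun [set: 'rV[R]_n] (fun v : 'rV[R]_n => v 0 i).
Proof.
move=> _ Y mY; rewrite setTI; apply: sub_sigma_algebra => /=.
rewrite -bigcup_seq/=; exists i => /=; first by rewrite mem_index_enum.
by exists Y => //; rewrite setTI.
Qed.

Lemma measurable_fun_rVP {d} {T : measurableType d} n (f : T -> 'rV[R]_n) :
  (forall i, measurable_fun [set: T] (fun x => f x 0 i)) ->
  measurable_fun [set: T] f.
Proof.
move=> mf _ A mA; rewrite setTI.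
suff : measurable `<=` [set B : set 'rV[R]_n | measurable (f @^-1` B)].
  by move=> /(_ _ mA).
apply: smallest_sub.
  split => /=.
  - by rewrite preimage_set0.
  - by move=> B mB; rewrite setTD preimage_setC; exact: measurableC.
  - by move=> F mF; rewrite preimage_bigcup; exact: bigcup_measurable.
move=> B; rewrite -bigcup_seq => -[i _ [C mC <-]] /=.
by rewrite setTI -comp_preimage -[X in measurable X]setTI; exact: mf.
Qed.

(** Rounding down to the grid of mesh 1 / (N + 1) takes countably many values, each on a finite
    intersection of coordinate slabs, so [f] itself may be arbitrary. *)
Lemma measurable_grid_step n (f : 'rV[R]_n -> R) (N : nat) :
  measurable_fun setT (fun v : 'rV[R]_n =>
    f (N.+1%:R^-1 *: (zR (map_mx Num.floor (N.+1%:R *: v)) : 'rV[R]_n))).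
Proof.
pose fl (v : 'rV[R]_n) : 'rV[int]_n := map_mx Num.floor (N.+1%:R *: v).
move=> _ A mA; rewrite setTI.
have -> : (fun v : 'rV[R]_n => f (N.+1%:R^-1 *: (zR (fl v)))) @^-1` A =
    \bigcup_(z in [set z : 'rV[int]_n | A (f (N.+1%:R^-1 *: zR z))])
      (fl @^-1` [set z]).
  apply/seteqP; split => [v /= Av|v [z Az /= ->]//].
  by exists (fl v).
rewrite bigcup_mkcond; apply: countable_bigcupT_measurable => [|z].
  exact: countableP.
case: ifPn => // _.
have -> : fl @^-1` [set z] =
    \bigcap_(i in [set: 'I_n]) [set v : 'rV[R]_n |
      (fun v : 'rV[R]_n => Num.floor (N.+1%:R * v 0 i)) v \in [set z 0 i]].
  apply/seteqP; split => [v /= <- i _ /=|v /= H].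
    by rewrite inE /= !mxE.
  apply/rowP => i; have := H i Logic.I; rewrite /= inE => <-.
  by rewrite !mxE.
apply: fin_bigcap_measurable => // i _.
have -> : [set v : 'rV[R]_n | Num.floor (N.+1%:R * v 0 i) \in [set z 0 i]] =
   (fun v : 'rV[R]_n => N.+1%:R * v 0 i) @^-1` `[(z 0 i)%:~R, (z 0 i + 1)%:~R[.
  apply/seteqP; split => v /=.
    by rewrite inE /= => <-; rewrite in_itv /= floor_le floorD1_gt.
  by rewrite in_itv /= => /floor_def => ->; rewrite inE.
rewrite -[X in measurable X]setTI.
have m : measurable_fun setT (fun v : 'rV[R]_n => N.+1%:R * v 0 i).
  by apply: measurable_funM => //; exact: measurable_coor.
exact: m.
Qed.

(** Pointwise limit of the values of [f] at the grid points below [v]. *)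
Lemma continuous_measurable_rV n (f : 'rV[R]_n -> R) :
  continuous f -> measurable_fun setT f.
Proof.
move=> cf.
pose g (N : nat) (v : 'rV[R]_n) : 'rV[R]_n :=
  N.+1%:R^-1 *: (zR (map_mx Num.floor (N.+1%:R *: v)) : 'rV[R]_n).
apply: (@measurable_fun_cvg _ _ _ setT (fun N => f \o g N)).
- by move=> N; exact: measurable_grid_step.
- move=> v _; apply: (cvg_comp (fun N => g N v) f); last exact: cf.
  apply/cvgrPdist_le => e e0.
  near=> N.
  rewrite [leLHS]mx_normrE; apply: bigmax_le; first exact: ltW.
  move=> [i j] _ /=; rewrite !ord1 !mxE.
  have N0 : 0 < (N.+1%:R : R) by [].
  set x := N.+1%:R * v 0 j.
  have -> : v 0 j = N.+1%:R^-1 * x by rewrite mulKf ?gt_eqF.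
  rewrite -mulrBr normrM ger0_norm ?invr_ge0 ?ltW// ger0_norm; last first.
    by rewrite subr_ge0 floor_le.
  apply: (@le_lt_trans _ _ (N.+1%:R^-1 * 1)).
    apply: ler_wpM2l; first by rewrite invr_ge0 ltW.
    rewrite lerBlDr addrC.
    by rewrite ltW// -intrD1 floorD1_gt.
  rewrite mulr1; near: N; exact: (near_infty_natSinv_lt (PosNum e0)).
Unshelve. all: by end_near.
Qed.

End VectorMeasurability.

Section LebesgueVector.
Context {R : realType}.

Definition vtail n (v : 'rV[R]_n.+1) : 'rV[R]_n := \row_j v 0 (lift ord0 j).

Lemma vcons0 n x (y : 'rV[R]_n) : vcons x y 0 ord0 = x.
Proof. by rewrite mxE unlift_none. Qed.

Lemma vconsS n x (y : 'rV[R]_n) j : vcons x y 0 (lift ord0 j) = y 0 j.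
Proof. by rewrite mxE liftK. Qed.

Lemma vtail_cons n x (y : 'rV[R]_n) : vtail (vcons x y) = y.
Proof. by apply/rowP => j; rewrite mxE vconsS. Qed.

Definition vpair n (p : measurableTypeR R * 'rV[R]_n) : 'rV[R]_n.+1 :=
  vcons p.1 p.2.

Lemma measurable_vpair n : measurable_fun setT (@vpair n).
Proof.
apply: measurable_fun_rVP => i; case: (unliftP ord0 i) => [j ->|->].
  under eq_fun do rewrite vconsS.
  exact: (measurableT_comp (measurable_coor j) measurable_snd).
under eq_fun do rewrite vcons0.
exact: measurable_fst.
Qed.

Section Step.
Variables (n : nat) (m : {sigma_finite_measure set 'rV[R]_n -> \bar R}).

Definition leb_step : set 'rV[R]_n.+1 -> \bar R :=
  pushforward (@lebesgue_measure R \x m)%E (@vpair n).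

Let mpre A : measurable A -> measurable (@vpair n @^-1` A).
Proof. by move=> mA; rewrite -[X in measurable X]setTI; exact: measurable_vpair. Qed.

Let step0 : leb_step set0 = 0.
Proof. by rewrite /leb_step /pushforward preimage_set0 measure0. Qed.

Let step_ge0 A : (0 <= leb_step A)%E.
Proof. exact: (measure_ge0 (@lebesgue_measure R \x m)%E). Qed.

Let step_sigma_additive : semi_sigma_additive leb_step.
Proof.
move=> F mF tF mUF; rewrite /leb_step /pushforward preimage_bigcup.
apply: measure_semi_sigma_additive.
- by move=> k; exact: mpre.
- apply/trivIsetP => /= i j _ _ ij; rewrite -preimage_setI.
  by move/trivIsetP : tF => /(_ _ _ _ _ ij) ->//; rewrite preimage_set0.
- by rewrite -preimage_bigcup; exact: mpre.
Qed.

HB.instance Definition _ := isMeasure.Build _ _ _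
  leb_step step0 step_ge0 step_sigma_additive.

Let step_sigma_finite : sigma_finite setT leb_step.
Proof.
have /sigma_finiteP[F [TF ndF Foo]] := sigma_finiteT (@lebesgue_measure R).
have /sigma_finiteP[G [TG ndG Goo]] := sigma_finiteT m.
pose s (v : 'rV[R]_n.+1) : measurableTypeR R * 'rV[R]_n := (v 0 0, vtail v).
have sK p : s (vpair p) = p.
  by case: p => x y; rewrite /s /vpair /= vcons0 vtail_cons.
(* [s] undoes [vpair]; both exhaustions are increasing, so the larger of two indices covers both
   components. *)
exists (fun k => s @^-1` (F k `*` G k)).
  apply/seteqP; split => // v _.
  have : setT (v 0 0) by []; rewrite TF => -[i _ Fi].
  have : setT (vtail v) by []; rewrite TG => -[j _ Gj].
  exists (maxn i j) => //; split => /=.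
  - by move: Fi; exact/subsetPset/ndF/leq_maxl.
  - by move: Gj; exact/subsetPset/ndG/leq_maxr.
move=> k; have [mF Fk] := Foo k; have [mG Gk] := Goo k.
have mX : measurable (F k `*` G k) by exact: measurableX.
split.
  have ms : measurable_fun setT s.
    apply: measurable_fun_pair; first exact: measurable_coor.
    apply: measurable_fun_rVP => i; under eq_fun do rewrite mxE.
    exact: measurable_coor.
  by rewrite -[X in measurable X]setTI; exact: ms.
rewrite /leb_step /pushforward -comp_preimage.
rewrite (_ : s \o _ = id); last by apply/funext => p /=; rewrite sK.
by rewrite preimage_id product_measure1E// lte_mul_pinfty// ge0_fin_numE.
Qed.

HB.instance Definition _ := Measure_isSigmaFinite.Build _ _ _ leb_step
  step_sigma_finite.

End Step.

(** One coordinate at a time and in the order of [iint], so that Fubini identifies the two in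
    [iint_leb]; the base case is the unit mass at the only point of R^0. *)
Fixpoint leb n : {sigma_finite_measure set 'rV[R]_n -> \bar R} :=
  match n with
  | 0 => \d_(0 : 'rV[R]_0)
  | n'.+1 => leb_step (leb n')
  end.

Lemma measurable_vcons n d (T : measurableType d) (f : T -> R)
    (g : T -> 'rV[R]_n) : measurable_fun setT f -> measurable_fun setT g ->
  measurable_fun setT (fun x => vcons (f x) (g x)).
Proof.
move=> mf mg; apply: measurable_fun_rVP => i; case: (unliftP ord0 i) => [j ->|->].
  under eq_fun do rewrite vconsS.
  exact: (measurableT_comp (measurable_coor j) mg).
by under eq_fun do rewrite vcons0.
Qed.

Lemma leb_cons n (f : 'rV[R]_n.+1 -> \bar R) :
  measurable_fun setT f -> (forall v, 0 <= f v)%E ->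
  (\int[leb n.+1]_v f v =
   \int[@lebesgue_measure R]_x \int[leb n]_y f (vcons x y))%E.
Proof.
move=> mf f0; rewrite /= ge0_integral_pushforward//; last exact: measurable_vpair.
rewrite preimage_setT fubini_tonelli1//=.
apply: (measurableT_comp mf); exact: measurable_vpair.
Qed.

Lemma leb_cons_swap n (f : 'rV[R]_n.+1 -> \bar R) :
  measurable_fun setT f -> (forall v, 0 <= f v)%E ->
  (\int[leb n.+1]_v f v =
   \int[leb n]_y \int[@lebesgue_measure R]_x f (vcons x y))%E.
Proof.
move=> mf f0; rewrite /= ge0_integral_pushforward//; last exact: measurable_vpair.
rewrite preimage_setT fubini_tonelli2//=.
apply: (measurableT_comp mf); exact: measurable_vpair.
Qed.

(** Uniqueness of Lebesgue measure: the pushforward scaled by |a| agrees with it on half-open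
    intervals. For a < 0 the preimage is closed on the left instead of the right, with the same
    length. *)
Lemma lebesgue_affine_set (a b : R) (A : set R) : a != 0 -> measurable A ->
  (`|a|%:E * @lebesgue_measure R ((fun x => a * x + b)%R @^-1` A))%E =
  @lebesgue_measure R A.
Proof.
move=> a0 mA.
have mg : measurable_fun setT (fun x : measurableTypeR R => (a * x + b)%R : measurableTypeR R).
  by apply: measurable_funD => //; exact: measurable_funM.
pose p := measure_function_pushforward__canonical__measure_function_Measure
  (@lebesgue_measure R) mg.
have r0 : 0 < `|a| by rewrite normr_gt0.
rewrite (@lebesgue_measure_unique R (mscale (NngNum (normr_ge0 a)) p) _ A)//.
move=> _ [[u v] _ <-] /=.
rewrite /mscale /= /pushforward /=.
have [a_gt0|a_lt0] : 0 < a \/ a < 0 by apply/orP; rewrite lt_total// eq_sym.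
- rewrite (_ : _ @^-1` _ = `](u - b) / a, (v - b) / a]%classic); last first.
    by apply/seteqP; split => x /=; rewrite !in_itv /= ltr_pdivrMr// ler_pdivlMr//
      [_ * a]mulrC ltrBlDr lerBrDr.
  rewrite !lebesgue_measure_itv /= !lte_fin gtr0_norm// ltr_pM2r ?invr_gt0// ltrD2r.
  case: ifPn => // _; last by rewrite mule0.
  by rewrite -!EFinD -EFinM; congr _%:E; field; rewrite gt_eqF.
- rewrite (_ : _ @^-1` _ = `[(v - b) / a, (u - b) / a[%classic); last first.
    by apply/seteqP; split => x /=; rewrite !in_itv /= ltr_ndivlMr// ler_ndivrMr//
      [_ * a]mulrC ltrBlDr lerBrDr andbC.
  rewrite !lebesgue_measure_itv /= !lte_fin ltr0_norm// ltr_nM2r ?invr_lt0// ltrD2r.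
  case: ifPn => // _; last by rewrite mule0.
  by rewrite -!EFinD -EFinM; congr _%:E; field; rewrite lt_eqF.
Qed.

Lemma lebesgue_affine (a b : R) (f : R -> \bar R) : a != 0 ->
  measurable_fun setT f -> (forall x, 0 <= f x)%E ->
  (`|a|%:E * \int[@lebesgue_measure R]_x f (a * x + b)%R =
   \int[@lebesgue_measure R]_x f x)%E.
Proof.
move=> a0 mf f0.
have mg : measurable_fun setT (fun x : measurableTypeR R => (a * x + b)%R : measurableTypeR R).
  by apply: measurable_funD => //; exact: measurable_funM.
pose p := measure_function_pushforward__canonical__measure_function_Measure
  (@lebesgue_measure R) mg.
transitivity (\int[mscale (NngNum (normr_ge0 a)) p]_x f x)%E.
  by rewrite ge0_integral_mscale//= ge0_integral_pushforward.
apply: eq_measure_integral => A mA _; exact: lebesgue_affine_set.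
Qed.

Lemma measurable_funE n (f : 'rV[R]_n -> \bar R) d (T : measurableType d)
    (g : T -> 'rV[R]_n) : measurable_fun setT f ->
  (forall i, measurable_fun setT (fun x => g x 0 i)) ->
  measurable_fun setT (fun x => f (g x)).
Proof. by move=> mf mg; apply: (measurableT_comp mf); exact: measurable_fun_rVP. Qed.

Lemma vconsD n x (y : 'rV[R]_n) c :
  vcons x y + c = vcons (x + c 0 0) (y + vtail c).
Proof.
apply/rowP => i; case: (unliftP ord0 i) => [j ->|->].
  by rewrite mxE !vconsS !mxE.
by rewrite mxE !vcons0.
Qed.

Lemma measurable_consr n x :
  measurable_fun setT (fun y : 'rV[R]_n => vcons x y).
Proof. by apply: measurable_vcons. Qed.

Lemma measurable_consl n (y : 'rV[R]_n) :
  measurable_fun setT (fun x => vcons x y).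
Proof. by apply: measurable_vcons. Qed.

Lemma leb_translate n (c : 'rV[R]_n) (f : 'rV[R]_n -> \bar R) :
  measurable_fun setT f -> (forall v, 0 <= f v)%E ->
  (\int[leb n]_v f (v + c)%R = \int[leb n]_v f v)%E.
Proof.
elim: n c f => [|n IH] c f mf f0.
  by apply: eq_integral => v _; congr f; apply/rowP => -[].
have mfc : measurable_fun setT (fun v : 'rV[R]_n.+1 => f (v + c)).
  apply: (measurable_funE mf) => i; under eq_fun do rewrite mxE.
  by apply: measurable_funD => //; exact: measurable_coor.
rewrite !leb_cons//.
have mF : measurable_fun setT (fun x => \int[leb n]_y f (vcons x y))%E.
  apply: (measurable_fun_fubini_tonelli_F (f \o (@vpair n))).
  2: by move=> p /=; exact: f0.
  exact: (measurableT_comp mf (@measurable_vpair n)).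
rewrite -(@lebesgue_affine 1 (c 0 0) _ _ mF)//; last first.
  by move=> x; exact: integral_ge0.
rewrite normr1 mul1e; apply: eq_integral => x _; rewrite mul1r.
under eq_integral do rewrite vconsD.
rewrite (IH _ (fun y => f (vcons (x + c 0 0) y)))//.
exact: (measurableT_comp mf (measurable_consr _)).
Qed.

(** Isolated as a property of the matrix because it is stable under products ([leb_scalingM]), so
    that only triangular factors have to be treated. *)
Definition leb_scaling n (A : 'M[R]_n) := forall f : 'rV[R]_n -> \bar R,
  measurable_fun setT f -> (forall v, 0 <= f v)%E ->
  (`|\det A|%:E * \int[leb n]_v f (v *m A) = \int[leb n]_v f v)%E.

Lemma measurable_mulmx n (A : 'M[R]_n) (f : 'rV[R]_n -> \bar R) :
  measurable_fun setT f -> measurable_fun setT (fun v : 'rV[R]_n => f (v *m A)).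
Proof.
move=> mf; apply: (measurable_funE mf) => i; under eq_fun do rewrite mxE.
apply: measurable_sum => j; apply: measurable_funM => //; exact: measurable_coor.
Qed.

Lemma leb_scalingM n (A B : 'M[R]_n) :
  leb_scaling A -> leb_scaling B -> leb_scaling (A *m B).
Proof.
move=> gA gB f mf f0; rewrite det_mulmx normrM mulrC EFinM -muleA.
under eq_integral do rewrite mulmxA.
by rewrite (gA (fun v => f (v *m B)))//; [exact: gB|exact: measurable_mulmx].
Qed.

Lemma vconsE n x (y : 'rV[R]_n) : vcons x y = row_mx x%:M y :> 'rV_(1 + n).
Proof.
apply/rowP => i; case: (unliftP ord0 i) => [j ->|->].
  rewrite vconsS; transitivity (row_mx x%:M y 0 (rshift 1 j)).
    by rewrite row_mxEr.
  congr (row_mx _ _ _ _); exact/val_inj.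
rewrite vcons0; transitivity (row_mx x%:M y 0 (lshift n 0)).
  by rewrite row_mxEl mxE.
congr (row_mx _ _ _ _); exact/val_inj.
Qed.

Lemma vcons_block n x (y : 'rV[R]_n) a (b : 'rV[R]_n) (c : 'cV[R]_n) M :
  vcons x y *m (block_mx a%:M b c M : 'M[R]_(1 + n)) =
  vcons (x * a + (y *m c) 0 0) (x *: b + y *m M).
Proof.
rewrite !vconsE; have E := mul_row_block x%:M y a%:M b c M. apply: (eq_trans E).
rewrite -scalar_mxM mul_scalar_mx raddfD/=; congr (row_mx (_ + _) _).
exact: mx11_scalar.
Qed.

(** For fixed x the remaining coordinates undergo [M] followed by a translation along [b], which the
    inner integral absorbs; the first coordinate is merely scaled by [a]. *)
Lemma leb_scaling_upper n a (b : 'rV[R]_n) M : a != 0 -> leb_scaling M ->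
  leb_scaling (block_mx a%:M b 0 M : 'M[R]_(1 + n)).
Proof.
move=> a0 gM f mf f0; rewrite det_ublock det_scalar1 normrM EFinM -muleA.
have mfA := @measurable_mulmx n.+1 (block_mx a%:M b 0 M : 'M[R]_(1 + n)) _ mf.
rewrite [in RHS]leb_cons// leb_cons//.
have mF : measurable_fun setT (fun x => \int[leb n]_y f (vcons x y))%E.
  apply: (measurable_fun_fubini_tonelli_F (f \o (@vpair n))).
  2: by move=> p /=; exact: f0.
  exact: (measurableT_comp mf (@measurable_vpair n)).
rewrite -(@lebesgue_affine a 0 _ a0 mF)//; last first.
  by move=> x; exact: integral_ge0.
congr (_ * _)%E; rewrite -ge0_integralZl//; first last.
- by move=> x _; exact: integral_ge0.
- apply: (measurable_fun_fubini_tonelli_F (fun p => f (vpair p *m (block_mx a%:M b 0 M : 'M[R]_(1 + n))))) => //.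
  exact: (measurableT_comp mfA (@measurable_vpair n)).
apply: eq_integral => x _.
under eq_integral do rewrite vcons_block mulmx0 mxE [x * a]mulrC [_ *: b + _]addrC.
have mx : measurable_fun setT (fun y : 'rV[R]_n => f (vcons (a * x + 0) y)).
  exact: (measurableT_comp mf (measurable_consr _)).
rewrite (gM (fun y => f (vcons (a * x + 0) (y + x *: b)))).
- exact: (leb_translate (x *: b) mx).
- apply: (measurable_funE mx) => i; under eq_fun do rewrite mxE.
  by apply: measurable_funD => //; exact: measurable_coor.
- by [].
Qed.

Lemma leb_scaling1 n : leb_scaling (1%:M : 'M[R]_n).
Proof.
move=> f mf f0; rewrite det1 normr1 mul1e.
by under eq_integral do rewrite mulmx1.
Qed.

(** The shear moves the first coordinate by an amount depending on the others, so that coordinate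
    must be the innermost variable: hence [leb_cons_swap]. *)
Lemma leb_scaling_lower n (c : 'cV[R]_n) :
  leb_scaling (block_mx 1%:M 0 c 1%:M : 'M[R]_(1 + n)).
Proof.
move=> f mf f0; rewrite det_lblock !det1 mulr1 normr1 mul1e.
have mfA := @measurable_mulmx n.+1 (block_mx 1%:M 0 c 1%:M : 'M[R]_(1 + n)) _ mf.
rewrite !leb_cons_swap//; apply: eq_integral => y _.
have my : measurable_fun setT (fun x => f (vcons x y)).
  exact: (measurableT_comp mf (measurable_consl _)).
rewrite -(@lebesgue_affine 1 ((y *m c) 0 0) _ _ my)// normr1 mul1e.
apply: eq_integral => x _.
by rewrite vcons_block scaler0 add0r mulmx1 mulr1 mul1r.
Qed.

(** Gaussian elimination by blocks: with a nonzero pivot the matrix is a lower shear times a block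
    upper triangular matrix whose corner is the Schur complement, to which the induction applies. *)
Lemma leb_scalingP n (A : 'M[R]_n) : \det A != 0 -> leb_scaling A.
Proof.
elim: n A => [|n IH] A dA.
  move=> f mf f0; rewrite det_mx00 normr1 mul1e.
  by apply: eq_integral => v _; congr f; apply/rowP => -[].
have pivot (B : 'M[R]_(1 + n)) : \det B != 0 -> B 0 0 != 0 -> leb_scaling B.
  move=> dB B0; rewrite -(submxK B).
  have ulE : ulsubmx B = (B 0 0)%:M.
    rewrite [LHS]mx11_scalar !mxE; congr (B _ _)%:M; exact/val_inj.
  set a := B 0 0 in B0 ulE; rewrite ulE.
  set b := ursubmx B; set c := dlsubmx B; set M := drsubmx B.
  have BE : block_mx a%:M b c M =
      block_mx 1%:M 0 (a^-1 *: c) 1%:M *m block_mx a%:M b 0 (M - a^-1 *: c *m b).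
    rewrite mulmx_block !mul1mx !mul0mx !addr0 mul_mx_scalar scalerA.
    by rewrite mulfV// scale1r addrC subrK.
  rewrite BE; apply: leb_scalingM; first exact: leb_scaling_lower.
  apply: leb_scaling_upper => //; apply: IH; apply: contra dB => /eqP d0.
  by rewrite -(submxK B) ulE BE det_mulmx det_ublock d0 !mulr0.
have [A0|A0] := eqVneq (A 0 0) 0; last exact: pivot.
have [j Aj] : exists j : 'I_n, A (lift ord0 j) 0 != 0.
  apply/existsP; apply: contraNT dA => /existsPn H.
  rewrite (expand_det_col A ord0) big1// => i _.
  case: (unliftP ord0 i) => [j ->|->]; last by rewrite A0 mul0r.
  by have := H j; rewrite negbK => /eqP ->; rewrite mul0r.
(* Left multiplication by [U 1] adds row j + 1 to row 0 and so creates the pivot; [U (-1)] undoes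
   it. *)
pose U (s : R) : 'M[R]_(1 + n) := block_mx 1%:M (s *: delta_mx 0 j) 0 1%:M.
have UK : U (-1) *m U 1 = 1%:M.
  rewrite mulmx_block !mul1mx !mul0mx !mulmx0 !mulmx1 !addr0 !add0r.
  by rewrite scaleN1r scale1r addrN -scalar_mx_block.
have gU : leb_scaling (U (-1)).
  by apply: leb_scaling_upper; [exact: oner_neq0|exact: leb_scaling1].
rewrite -[A]mul1mx -UK -mulmxA; apply: leb_scalingM => //.
apply: pivot; first by rewrite det_mulmx det_ublock !det1 !mul1r.
have U0 i : U 1 0 (lift ord0 i) = (i == j)%:R.
  transitivity (U 1 (lshift n 0) (rshift 1 i)).
    by congr (U 1 _ _); exact/val_inj.
  by rewrite block_mxEur !mxE eqxx mul1r.
rewrite mxE big_ord_recl A0 mulr0 add0r (bigD1 j)//= big1 ?addr0.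
  by rewrite U0 eqxx mul1r.
by move=> i ij; rewrite U0 (negbTE ij) mul0r.
Qed.

End LebesgueVector.

(** * Iterated integrals of dominated functions *)

Section IteratedIntegral.
Context {R : realType}.

Lemma norm_vcons_ge n x (y : 'rV[R]_n) : `|x| <= `|vcons x y| /\ `|y| <= `|vcons x y|.
Proof.
split.
  rewrite [leRHS]mx_normrE -{1}(vcons0 x y).
  exact: (le_bigmax _ (fun ij : 'I_1 * 'I_n.+1 => `|vcons x y ij.1 ij.2|) (0, ord0)).
rewrite [leLHS]mx_normrE; apply: bigmax_le => // -[i j] _ /=.
rewrite ord1 -(vconsS x y j) [leRHS]mx_normrE.
exact: (le_bigmax _ (fun ij : 'I_1 * 'I_n.+1 => `|vcons x y ij.1 ij.2|) (0, lift ord0 j)).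
Qed.

(* Along a coordinate the weight factors as [(1 + x^2)^-1] times the weight of
   the remaining ones, so slices of a dominated function are again dominated. *)
Definition decay n (v : 'rV[R]_n) : R := ((1 + `|v|) ^+ n.*2)^-1.

Lemma decay_gt0 n (v : 'rV[R]_n) : 0 < decay v.
Proof. by rewrite invr_gt0 exprn_gt0// ltr_pwDl. Qed.

Lemma decay_cons n x (y : 'rV[R]_n) : decay (vcons x y) <= (1 + x ^+ 2)^-1 * decay y.
Proof.
have [hx hy] := norm_vcons_ge x y.
rewrite /decay -invfM lef_pV2 ?posrE; last 2 first.
- by rewrite exprn_gt0// ltr_pwDl.
- rewrite mulr_gt0 ?exprn_gt0 ?ltr_pwDl ?sqr_ge0//.
have -> : (1 + `|vcons x y|) ^+ n.+1.*2 =
    (1 + `|vcons x y|) ^+ 2 * (1 + `|vcons x y|) ^+ n.*2.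
  by rewrite doubleS -[n.*2.+2]add2n exprD.
apply: ler_pM.
- by apply: addr_ge0; rewrite ?sqr_ge0.
- by apply: exprn_ge0; rewrite addr_ge0.
- have : x ^+ 2 = `|x| ^+ 2 by rewrite real_normK// num_real.
  by move=> ->; have := normr_ge0 x; nra.
- by apply: lerXn2r; rewrite ?nnegrE ?addr_ge0 ?lerD2l.
Qed.

Lemma measurable_decay n : measurable_fun setT (@decay n).
Proof.
have c : continuous (fun v : 'rV[R]_n => (1 + `|v|) ^+ n.*2).
  move=> v; apply: (@continuous_comp _ _ _ (fun v : 'rV[R]_n => 1 + `|v|) (fun x => x ^+ n.*2)).
    exact: (cvgD (cvg_cst (1 : R)) (@norm_continuous _ _ v)).
  exact: exprn_continuous.
apply: continuous_measurable_rV => v; apply: (cvgV _ (c v)).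
by apply: lt0r_neq0; rewrite exprn_gt0// ltr_pwDl.
Qed.

Lemma integrable_oneDsqrV :
  (@lebesgue_measure R).-integrable setT (fun x => ((1 + x ^+ 2)^-1)%:E).
Proof.
have mf : measurable_fun setT (fun x : R => ((1 + x ^+ 2)^-1)%:E).
  apply/measurable_EFinP; apply: continuous_measurable_fun.
  exact: continuous_oneDsqrV.
apply/integrableP; split => //.
under eq_integral do rewrite gee0_abs ?lee_fin ?invr_ge0 ?addr_ge0 ?sqr_ge0//.
rewrite (@ge0_symfun_integralT _ (fun x => (1 + x ^+ 2)^-1))//.
- by rewrite -set_itvcy (integral0y_oneDsqr R) -EFinM ltry.
- by move=> x; rewrite invr_ge0 addr_ge0 ?sqr_ge0.
- exact: continuous_oneDsqrV.
- by move=> x /=; rewrite sqrrN.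
Qed.

Lemma integrable_decay n : (leb n).-integrable setT (EFin \o @decay n).
Proof.
have mE k : measurable_fun setT (EFin \o @decay k).
  by apply/measurable_EFinP; exact: measurable_decay.
apply/integrableP; split; first exact: mE.
rewrite (eq_integral (fun v => (decay v)%:E)); last first.
  by move=> v _; rewrite gee0_abs// lee_fin ltW// decay_gt0.
elim: n => [|n IH].
  by rewrite integral_dirac//; [rewrite diracT mul1e ltry|exact: mE].
rewrite leb_cons; [|exact: mE|by move=> v; rewrite lee_fin ltW// decay_gt0].
set V := (\int[leb n]_x _)%E in IH.
have V0 : (0 <= V)%E by apply: integral_ge0 => v _; rewrite lee_fin ltW// decay_gt0.
have Vfin : V \is a fin_num by rewrite ge0_fin_numE.
have [_] := integrableP _ _ _ integrable_oneDsqrV.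
under eq_integral do rewrite gee0_abs ?lee_fin ?invr_ge0 ?addr_ge0 ?sqr_ge0//.
move=> fin1.
apply: (@le_lt_trans _ _ (\int[@lebesgue_measure R]_x (((1 + x ^+ 2)^-1)%:E * V))%E).
  apply: ge0_le_integral => //.
  - by move=> x _; apply: integral_ge0 => v _; rewrite lee_fin ltW// decay_gt0.
  - apply: (measurable_fun_fubini_tonelli_F (EFin \o @decay n.+1 \o @vpair R n)).
    + exact: (measurableT_comp (mE _) (@measurable_vpair R n)).
    + by move=> p; rewrite lee_fin ltW// decay_gt0.
  - apply: emeasurable_funM => //.
    exact: measurable_int integrable_oneDsqrV.
  - move=> x _; rewrite -ge0_integralZl//; last 3 first.
    + exact: mE.
    + by move=> v _; rewrite lee_fin ltW// decay_gt0.
    + by rewrite lee_fin invr_ge0 addr_ge0 ?sqr_ge0.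
    apply: ge0_le_integral => //.
    + by move=> v _; rewrite lee_fin ltW// decay_gt0.
    + exact: (measurableT_comp (mE _) (measurable_consr _)).
    + by apply: emeasurable_funM => //; exact: mE.
    + by move=> y _; rewrite lee_fin decay_cons.
rewrite ge0_integralZr//; last 2 first.
- exact: measurable_int integrable_oneDsqrV.
- by move=> x _; rewrite lee_fin invr_ge0 addr_ge0 ?sqr_ge0.
by rewrite lte_mul_pinfty// ?integral_ge0// ?ge0_fin_numE//;
  move=> *; rewrite ?integral_ge0// => *; rewrite lee_fin invr_ge0 addr_ge0 ?sqr_ge0.
Qed.

Lemma integrable_le n (f g : 'rV[R]_n -> R) : measurable_fun setT f ->
  (forall v, `|f v| <= g v) -> (leb n).-integrable setT (EFin \o g) ->
  (leb n).-integrable setT (EFin \o f).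
Proof.
move=> mf fg ig; apply: (le_integrable measurableT _ _ ig).
  exact/measurable_EFinP.
move=> v _; rewrite lee_fin (le_trans (fg v))//.
by rewrite ler_norm.
Qed.

Lemma integrable_le_decay n (f : 'rV[R]_n -> R) C : measurable_fun setT f ->
  (forall v, `|f v| <= C * decay v) -> (leb n).-integrable setT (EFin \o f).
Proof.
move=> mf fC; apply: (integrable_le mf fC).
exact: (integrableZl measurableT C (integrable_decay n)).
Qed.

(** Every level of [iint] is an [Rintegral], which returns a meaningless value on a non-integrable
    slice; domination by [decay] passes to the slices and makes all of them integrable, so that
    Fubini applies. *)
Lemma iint_leb n (f : 'rV[R]_n -> R) C : measurable_fun setT f ->
  (forall v, `|f v| <= C * decay v) -> iint f = \int[leb n]_v f v.
Proof.
elim: n f C => [|n IH] f C mf fC /=.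
  by rewrite /Rintegral integral_dirac ?diracT ?mul1e//; exact/measurable_EFinP.
have int_f := integrable_le_decay mf fC.
have sec_m x : measurable_fun setT (fun y => f (vcons x y)).
  exact: (measurableT_comp mf (measurable_consr _)).
have C0 : 0 <= C.
  have := le_trans (normr_ge0 _) (fC 0).
  by rewrite pmulr_lge0// decay_gt0.
have sec_le x y : `|f (vcons x y)| <= (C * (1 + x ^+ 2)^-1) * decay y.
  by rewrite -mulrA; apply: (le_trans (fC _)); rewrite ler_wpM2l// decay_cons.
have -> : (fun x => iint (fun y => f (vcons x y))) =
    (fun x => \int[leb n]_y f (vcons x y)).
  by apply/funext => x; exact: (IH _ _ (sec_m x) (sec_le x)).
rewrite /Rintegral; congr fine.
under eq_integral => x _.
  rewrite fineK; last first.
    exact: (integrable_fin_num measurableT (integrable_le_decay (sec_m x) (sec_le x))).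
  over.
have mE : measurable_fun setT (EFin \o f) by exact/measurable_EFinP.
have int_p : (@lebesgue_measure R \x leb n)%E.-integrable setT
    ((EFin \o f) \o @vpair R n).
  apply/integrable12ltyP.
    exact: (measurableT_comp mE (@measurable_vpair R n)).
  have [_] := integrableP _ _ _ int_f.
  by rewrite leb_cons//; apply: measurableT_comp.
rewrite integral_pushforward//; last exact: measurable_vpair.
by rewrite preimage_setT -integral12_prod_meas1.
Qed.

End IteratedIntegral.

(** * One-parameter groups of dilations *)

Section PointwiseDerivatives.
Context {R : realType}.
Implicit Types (f g : R -> R) (x a b : R).

Lemma derM f g x a b : is_derive x 1 f a -> is_derive x 1 g b ->
  is_derive x 1 (fun t => f t * g t) (a * g x + f x * b).
Proof.
move=> fa gb; apply: (is_derive_eq (is_deriveM fa gb)).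
by rewrite addrC [a * _]mulrC.
Qed.

Lemma derD f g x a b : is_derive x 1 f a -> is_derive x 1 g b ->
  is_derive x 1 (fun t => f t + g t) (a + b).
Proof. exact: is_deriveD. Qed.

Lemma derN f x a : is_derive x 1 f a -> is_derive x 1 (fun t => - f t) (- a).
Proof. exact: is_deriveN. Qed.

Lemma derB f g x a b : is_derive x 1 f a -> is_derive x 1 g b ->
  is_derive x 1 (fun t => f t - g t) (a - b).
Proof. by move=> fa gb; apply: derD => //; exact: derN. Qed.

Lemma der_cst x a : is_derive x 1 (fun _ => a) 0.
Proof. exact: is_derive_cst. Qed.

Lemma derZ f x a c : is_derive x 1 f a -> is_derive x 1 (fun t => c * f t) (c * a).
Proof. by move=> fa; apply: is_derive_eq (derM (der_cst x c) fa) _; ring. Qed.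

Lemma der_comp f g x a b : is_derive (g x) 1 f a -> is_derive x 1 g b ->
  is_derive x 1 (fun t => f (g t)) (a * b).
Proof. exact: is_derive1_comp. Qed.

Lemma der_sum n (f : 'I_n -> R -> R) x (a : 'I_n -> R) :
  (forall i, is_derive x 1 (f i) (a i)) ->
  is_derive x 1 (fun t => \sum_(i < n) f i t) (\sum_(i < n) a i).
Proof.
move=> fa; rewrite (_ : (fun t => _) = \sum_(i < n) f i); first exact: is_derive_sum.
by apply/funext => t; rewrite fct_sumE.
Qed.

Lemma der_fsum (I : finType) (f : I -> R -> R) x (a : I -> R) :
  (forall i, is_derive x 1 (f i) (a i)) ->
  is_derive x 1 (fun t => \sum_i f i t) (\sum_i a i).
Proof.
move=> fa; rewrite big_enum_val (_ : (fun t => _) =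
  fun t => \sum_(k < #|I|) f (enum_val k) t); last first.
  by apply/funext => t; rewrite big_enum_val.
by apply: der_sum => k; exact: fa.
Qed.

Lemma der_prod n (f : 'I_n -> R -> R) x (a : 'I_n -> R) :
  (forall i, is_derive x 1 (f i) (a i)) ->
  is_derive x 1 (fun t => \prod_(i < n) f i t)
    (\sum_(i < n) \prod_(j < n) (if j == i then a j else f j x)).
Proof.
elim: n f a => [|n IH] f a fa.
  rewrite big_ord0 (_ : (fun t => _) = fun _ => 1); first exact: der_cst.
  by apply/funext => t; rewrite big_ord0.
rewrite (_ : (fun t => _) = fun t => (\prod_(i < n) f (widen_ord (leqnSn n) i) t)
  * f ord_max t); last by apply/funext => t; rewrite big_ord_recr.
apply: (is_derive_eq (derM (IH (fun i => f (widen_ord (leqnSn n) i)) _ (fun i => fa _)) (fa ord_max))).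
have wE (i : 'I_n) : (widen_ord (leqnSn n) i == ord_max) = false.
  by apply/negbTE; rewrite neq_ltn /= ltn_ord.
rewrite big_ord_recr /= big_ord_recr /= eqxx; congr (_ + _ * _).
  rewrite big_distrl /=; apply: eq_bigr => i _; rewrite big_ord_recr /=.
  by rewrite eq_sym wE.
by apply: eq_bigr => i _; rewrite wE.
Qed.

Lemma der_shift f x a c : is_derive (x + c) 1 f a ->
  is_derive x 1 (fun t => f (t + c)) a.
Proof.
move=> fa; have := @der_comp f (fun t => t + c) x a 1 fa.
rewrite mulr1; apply; apply: is_derive_eq (derD (is_derive_id x 1) (der_cst x c)) _.
exact: addr0.
Qed.

Lemma der_opp f x a : is_derive (- x) 1 f a -> is_derive x 1 (fun t => f (- t)) (- a).
Proof.
move=> fa; have := @der_comp f (fun t => - t) x a (-1) fa.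
by rewrite mulrN1; apply; exact: derN (is_derive_id x 1).
Qed.

End PointwiseDerivatives.

(** * Exponential generating functions and the matrix exponential *)

Section ExponentialSeries.
Context {R : realType}.

(** Exponential generating function of the sequence; every entry of exp(x E) is one, with a_k the
    corresponding entry of E^k. *)
Definition egf (a : nat -> R) (x : R) : R := limn (pseries (fun k => a k / k`!%:R) x).

(** Makes [egf a] converge everywhere; the exponent k + 1 leaves room for a constant factor. *)
Definition geom_bounded (a : nat -> R) := exists B, 0 < B /\ forall k, `|a k| <= B ^+ k.+1.

Lemma cvg_egf a (x : R) : geom_bounded a -> cvgn (pseries (fun k => a k / k`!%:R) x).
Proof.
move=> [B [B0 aB]]; apply: normed_cvg.
have := is_cvgM (is_cvg_cst B) (is_cvg_series_exp_coeff (B * `|x|)).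
rewrite (_ : _ \* _ = series (fun k => B * exp_coeff (B * `|x|) k)); last first.
  by apply/funext => n; rewrite /series/= mulr_sumr.
move=> H.
have {}H := H _ _.
have -> : [normed pseries (fun k => a k / k`!%:R) x] =
    series (fun k => `|a k / k`!%:R * x ^+ k|) by [].
apply: series_le_cvg (H _ _) => n //=.
- by rewrite mulr_ge0 ?(ltW B0)// exp_coeff_ge0// mulr_ge0// ltW.
- rewrite /exp_coeff /= !normrM normrX exprMn mulrA mulrA -exprS.
  rewrite [`|_^-1|]ger0_norm ?invr_ge0// mulrAC; apply: ler_wpM2r.
    by rewrite invr_ge0.
  by apply: ler_wpM2r; rewrite ?exprn_ge0.
Qed.

Lemma geom_bounded_shift a : geom_bounded a -> geom_bounded (fun k => a k.+1).
Proof.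
move=> [B [B0 aB]]; exists (Num.max 1 (B ^+ 2)); split.
  by rewrite lt_max ltr01.
move=> k; apply: (le_trans (aB _)).
have [B1|/ltW B1] := leP B 1.
  apply: (@le_trans _ _ 1); first by apply: exprn_ile1 => //; exact: ltW.
  by apply: exprn_ege1; rewrite le_max lexx.
apply: (@le_trans _ _ ((B ^+ 2) ^+ k.+1)); last first.
  by apply: lerXn2r; rewrite ?nnegrE ?le_max ?exprn_ge0 ?lexx ?orbT ?ler01//; apply: ltW.
by rewrite -exprM ler_weXn2l// mul2n -addnn addSn addnS !ltnS leq_addr.
Qed.

(** Differentiation shifts the sequence, since (k + 1) / (k + 1)! = 1 / k!. *)
Lemma der_egf a (x : R) : geom_bounded a -> is_derive x 1 (egf a) (egf (fun k => a k.+1) x).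
Proof.
move=> ab; have diffsE b : pseries_diffs (fun k => b k / k`!%:R) = fun k => b k.+1 / k`!%:R :> R.
  apply/funext => k; rewrite /pseries_diffs factS natrM invfM mulrCA.
  by congr (_ * _); rewrite mulrA divff ?mul1r ?pnatr_eq0.
have := @pseries_snd_diffs R (fun k => a k / k`!%:R) (`|x| + 1) x.
have a1 := geom_bounded_shift ab; have a2 := geom_bounded_shift a1.
rewrite !diffsE; apply.
- exact: (@cvg_egf a).
- exact: (@cvg_egf (fun k => a k.+1)).
- exact: (@cvg_egf (fun k => a k.+2)).
- by rewrite [ltRHS]ger0_norm ?addr_ge0// ltrDl.
Qed.

Lemma egf_sum n (c : 'I_n -> R) (a : 'I_n -> nat -> R) x :
  (forall i, geom_bounded (a i)) ->
  egf (fun k => \sum_(i < n) c i * a i k) x = \sum_(i < n) c i * egf (a i) x.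
Proof.
move=> ab; apply/cvg_lim => //.
rewrite (_ : pseries _ x =
    fun N => \sum_(i < n) c i * pseries (fun k => a i k / k`!%:R) x N); last first.
  apply/funext => N; rewrite /pseries/= /series/=.
  under [RHS]eq_bigr do rewrite mulr_sumr.
  rewrite exchange_big/=; apply: eq_bigr => k _.
  by rewrite !mulr_suml; apply: eq_bigr => i _; rewrite !mulrA.
apply: cvg_big => [|i _]; first by apply: add_continuous.
by apply: cvgM; [exact: cvg_cst|exact: cvg_egf].
Qed.

End ExponentialSeries.

Section MatrixExponential.
Context {R : realType} {d : nat}.
Implicit Types (E : 'M[R]_d) (x y s t : R) (xi : 'rV[R]_d).

Lemma geom_bounded_mpow E i j : geom_bounded (fun k => mpow E k i j).
Proof.
pose B := 1 + \sum_i \sum_j `|E i j|.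
have S0 : 0 <= \sum_i \sum_j `|E i j| by apply: sumr_ge0 => ? _; apply: sumr_ge0.
have B1 : 1 <= B by rewrite lerDl.
exists B; split; first exact: lt_le_trans B1.
suff H k i' j' : `|mpow E k i' j'| <= B ^+ k.
  by move=> k; apply: (le_trans (H _ _ _)); rewrite ler_weXn2l.
elim: k i' j' => [|k IH] i' j'; first by rewrite mxE; case: eqP; rewrite ?normr1 ?normr0.
rewrite [mpow _ _]/= mxE; apply: le_trans (ler_norm_sum _ _ _) _.
apply: (@le_trans _ _ (\sum_l `|E i' l| * B ^+ k)).
  by apply: ler_sum => l _; rewrite normrM ler_wpM2l// IH.
rewrite -mulr_suml exprS; apply: ler_wpM2r; first by rewrite exprn_ge0// (le_trans ler01).
rewrite /B [X in 1 + X](bigD1 i')//= addrCA lerDl addr_ge0//.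
by apply: sumr_ge0 => ? _; apply: sumr_ge0.
Qed.

Lemma mpowZ E x k : mpow (x *: E) k = x ^+ k *: mpow E k.
Proof.
elim: k => [|k IH]; first by rewrite expr0 scale1r.
by rewrite [LHS]/= -/(mpow _ _) IH -scalemxAl -scalemxAr scalerA -exprS.
Qed.

Lemma mpowSr E k : mpow E k.+1 = mpow E k *m E.
Proof.
elim: k => [|k IH]; first by rewrite /= mul1mx mulmx1.
by rewrite [LHS]/= -/(mpow _ _) [X in E *m X]IH mulmxA.
Qed.

Lemma mexpE E x i j : mexp (x *: E) i j = egf (fun k => mpow E k i j) x.
Proof.
rewrite mxE /egf; congr (lim (_ @ \oo)); apply/funext => N.
rewrite summxE /pseries /series /= big_mkord; apply: eq_bigr => k _.
by rewrite mpowZ !mxE; ring.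
Qed.

Lemma der_mexp_l E x i j : is_derive x 1 (fun t => mexp (t *: E) i j)
  ((E *m mexp (x *: E)) i j).
Proof.
rewrite (_ : (fun t => _) = egf (fun k => mpow E k i j)); last first.
  by apply/funext => t; rewrite mexpE.
apply: (is_derive_eq (der_egf _ (geom_bounded_mpow E i j))).
rewrite mxE; under [RHS]eq_bigr do rewrite mexpE.
rewrite -egf_sum; last by move=> l; exact: geom_bounded_mpow.
by congr egf; apply/funext => k; rewrite mxE.
Qed.

Lemma mexp_comm E x : E *m mexp (x *: E) = mexp (x *: E) *m E.
Proof.
apply/matrixP => i j; rewrite !mxE.
under [LHS]eq_bigr do rewrite mexpE.
under [RHS]eq_bigr do rewrite mexpE mulrC.
rewrite -!egf_sum; try by move=> l; exact: geom_bounded_mpow.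
congr egf; apply/funext => k.
transitivity (mpow E k.+1 i j); first by rewrite mxE.
by rewrite mpowSr mxE; apply: eq_bigr => l _; rewrite mulrC.
Qed.

Lemma mexp0 : mexp (0 : 'M[R]_d) = 1%:M.
Proof.
apply/matrixP => i j; rewrite mxE; apply: cvg_lim => //.
rewrite -cvg_shiftS; apply: cvg_near_cst; near=> N.
rewrite /= big_ord_recl /= big1 ?addr0; first by rewrite fact0 invr1 scale1r.
by move=> k _; rewrite mul0mx scaler0.
Unshelve. all: by end_near.
Qed.

(** For fixed [y] the product M N on the left has derivative -M E N + M E N = 0 in [x], so it keeps
    its value at x = 0. Invertibility and the group law both follow. *)
Lemma mexpN_D E x y : mexp ((- x) *: E) *m mexp ((x + y) *: E) = mexp (y *: E).
Proof.
apply/matrixP => i j.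
pose g x := (mexp ((- x) *: E) *m mexp ((x + y) *: E)) i j.
suff /(is_derive_0_is_cst x 0) : forall t, is_derive t 1 g 0.
  by rewrite /g oppr0 scale0r mexp0 mul1mx add0r.
move=> t; rewrite (_ : g = fun t => \sum_l mexp ((- t) *: E) i l * mexp ((t + y) *: E) l j);
  last by apply/funext => u; rewrite /g mxE.
pose M := mexp ((- t) *: E); pose N := mexp ((t + y) *: E).
apply: (@is_derive_eq _ _ _ _ _ _ _ (\sum_l (- (E *m M) i l * N l j + M i l * (E *m N) l j))).
  apply: der_sum => l; apply: derM.
    exact: (@der_opp _ (fun t => mexp (t *: E) i l)) (der_mexp_l _ _ _ _).
  exact: (@der_shift _ (fun t => mexp (t *: E) l j)) (der_mexp_l _ _ _ _).
rewrite big_split /=; under eq_bigr do rewrite mulNr.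
rewrite sumrN /M mexp_comm -/M.
transitivity (- ((M *m E) *m N) i j + (M *m (E *m N)) i j); first by rewrite !mxE.
by rewrite mulmxA addNr.
Qed.

Lemma mexpD E x y : mexp ((x + y) *: E) = mexp (x *: E) *m mexp (y *: E).
Proof.
rewrite -(mexpN_D E x y) mulmxA.
suff -> : mexp (x *: E) *m mexp ((- x) *: E) = 1%:M by rewrite mul1mx.
by have := mexpN_D E (- x) 0; rewrite opprK addr0 scale0r mexp0.
Qed.

(** In the Leibniz expansion a permutation other than the identity moves at least two indices, so
    after one factor is differentiated an off-diagonal entry of the identity matrix is left. *)
Lemma der_det_mexp0 E : is_derive (0 : R) 1 (fun t : R => \det (mexp (t *: E))) (\tr E).
Proof.
pose v (s : {perm 'I_d}) := (-1) ^+ s * (\sum_(i < d) \prod_(j < d)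
   (if j == i then E j (s j) else (1%:M : 'M[R]_d) j (s j))).
apply: (@is_derive_eq _ _ _ _ _ _ _ (\sum_s v s)).
  apply: der_fsum => s; apply: derZ.
  have := @der_prod R d (fun i t => mexp (t *: E) i (s i)) 0
    (fun i => (E *m mexp (0 *: E)) i (s i)) (fun i => der_mexp_l _ _ _ _).
  by rewrite scale0r mexp0 mulmx1.
rewrite (bigD1 1%g)//= big1 ?addr0.
  rewrite /v odd_perm1 expr0 mul1r; apply: eq_bigr => i _.
  rewrite (bigD1 i)//= eqxx perm1 big1 ?mulr1// => j /negbTE ji.
  by rewrite ji perm1 mxE eqxx.
move=> s s1; rewrite /v big1 ?mulr0// => i _.
have [j ji sj] : exists2 j, j != i & s j != j.
  have [k sk] : exists k, s k != k.
    apply/existsP; apply: contraNT s1 => /existsPn H; apply/eqP/permP => k.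
    by rewrite perm1; apply/eqP; have := H k; rewrite negbK.
  have [ki|] := eqVneq k i; last by exists k.
  exists (s k); first by rewrite -ki.
  by apply: contra sk => /eqP /perm_inj ->.
rewrite (bigD1 j)//= (negbTE ji) mxE eq_sym (negbTE sj) mul0r//.
Qed.

(** The group law turns the derivative at 0 into D' = D tr E, so D(x) exp(-x tr E) is constant. *)
Lemma det_mexp E x : \det (mexp (x *: E)) = expR (x * \tr E).
Proof.
pose D t := \det (mexp (t *: E)).
pose g t := D t * expR (- (t * \tr E)).
have DD t : is_derive t 1 D (D t * \tr E).
  suff : is_derive t 1 (fun u => D t * D (u - t)) (D t * \tr E).
    rewrite (_ : (fun u => _) = D)//; apply/funext => u.
    by rewrite /D -det_mulmx -mexpD addrC subrK.
  apply: derZ; apply: der_shift; rewrite subrr; exact: der_det_mexp0.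
have : g x = g 0.
  apply: is_derive_0_is_cst => t.
  have e : is_derive t 1 (fun t => expR (- (t * \tr E))) (expR (- (t * \tr E)) * (- \tr E)).
    apply: (@der_comp R expR (fun t => - (t * \tr E)) t _ _ (is_derive_expR _)).
    apply: derN; apply: is_derive_eq (derM (is_derive_id t 1) (der_cst t _)) _.
    by rewrite mulr0 addr0 mul1r.
  by apply: is_derive_eq (derM (DD t) e) _; rewrite /=; ring.
rewrite /g /D mul0r oppr0 expR0 mulr1 scale0r mexp0 det1 => H.
by rewrite -[RHS]mul1r -H -mulrA -expRD addNr expR0 mulr1.
Qed.

End MatrixExponential.

Section PowerAction.
Context {R : realType} {d : nat}.
Implicit Types (E : 'M[R]_d) (x y s t : R) (xi u v : 'rV[R]_d).

Lemma coord_le_norm v i : `|v 0 i| <= `|v|.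
Proof.
rewrite [leRHS]mx_normrE.
exact: (le_bigmax _ (fun ij : 'I_1 * 'I_d => `|v ij.1 ij.2|) (0, i)).
Qed.

Lemma norm_rV_le v c : 0 <= c -> (forall i, `|v 0 i| <= c) -> `|v| <= c.
Proof.
move=> c0 H; rewrite [leLHS]mx_normrE; apply: bigmax_le => // -[i j] _ /=.
by rewrite ord1.
Qed.

Lemma norm_mulmx_le v (A : 'M[R]_d) c : 0 <= c -> (forall i j, `|A i j| <= c) ->
  `|v *m A| <= d%:R * c * `|v|.
Proof.
move=> c0 Ac; apply: norm_rV_le => [|i]; first by rewrite !mulr_ge0.
rewrite mxE; apply: le_trans (ler_norm_sum _ _ _) _.
have -> : d%:R * c * `|v| = \sum_(j < d) c * `|v|.
  by rewrite sumr_const card_ord -mulrA mulr_natl.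
by apply: ler_sum => j _; rewrite normrM mulrC ler_pM// coord_le_norm.
Qed.

Lemma tpow1 E : tpow E 1 = 1%:M.
Proof. by rewrite /tpow ln1 scale0r mexp0. Qed.

Lemma tpowM E s t : 0 < s -> 0 < t -> tpow E (s * t) = tpow E s *m tpow E t.
Proof. by move=> s0 t0; rewrite /tpow lnM ?posrE// mexpD. Qed.

Lemma det_tpow E t : 0 < t -> \det (tpow E t) = t `^ \tr E.
Proof. by move=> t0; rewrite /tpow det_mexp /powR gt_eqF// mulrC. Qed.

Lemma act1 E xi : act E 1 xi = xi.
Proof. by rewrite /act tpow1 trmx1 mulmx1. Qed.

Lemma actM E s t xi : 0 < s -> 0 < t -> act E s (act E t xi) = act E (s * t) xi.
Proof. by move=> s0 t0; rewrite /act tpowM// trmx_mul mulmxA. Qed.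

Lemma act0 E t : act E t 0 = 0.
Proof. by rewrite /act mul0mx. Qed.

Lemma actK E t xi : 0 < t -> act E t (act E t^-1 xi) = xi.
Proof. by move=> t0; rewrite actM ?invr_gt0// divff ?gt_eqF// act1. Qed.

Lemma der_tpow E t i j : 0 < t ->
  is_derive t 1 (fun s => tpow E s i j) (t^-1 * (E *m tpow E t) i j).
Proof.
move=> t0; rewrite mulrC.
apply: (@der_comp R (fun x => mexp (x *: E) i j) (@ln R) t _ _ (der_mexp_l _ _ _ _)).
exact: is_derive1_ln.
Qed.

Lemma der_act E t xi i : 0 < t ->
  is_derive t 1 (fun s => act E s xi 0 i) (t^-1 * (act E t xi *m E^T) 0 i).
Proof.
move=> t0; rewrite (_ : (fun s => _) = fun s => \sum_j xi 0 j * tpow E s i j); last first.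
  by apply/funext => s; rewrite mxE; apply: eq_bigr => j _; rewrite mxE.
apply: is_derive_eq (der_sum (fun j => derZ (xi 0 j) (der_tpow E i j t0))) _.
rewrite /act -mulmxA -trmx_mul mxE mulr_sumr; apply: eq_bigr => j _.
by rewrite [_^T j i]mxE; ring.
Qed.

Lemma tpow_near0 E : contracting E -> forall eps, 0 < eps ->
  exists2 tau, 0 < tau & forall t, 0 < t < tau -> forall i j, `|tpow E t i j| <= eps.
Proof.
move=> cE eps e0.
have : \forall t \near 0^'+, forall ij : 'I_d * 'I_d, `|tpow E t ij.1 ij.2| <= eps.
  apply: filter_forall => -[i j] /=.
  have /cvgrPdist_le /(_ _ e0) := cE i j.
  by apply: filterS => t; rewrite sub0r normrN.
move=> [tau /= tau0 H]; exists tau => // t /andP[t0 tt] i j.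
apply: (H t _ _ (i, j)) => //=.
by rewrite sub0r normrN gtr0_norm.
Qed.

Lemma der_continuous (f : R -> R) x a : is_derive x 1 f a -> {for x, continuous f}.
Proof. by move=> [df _]; apply/differentiable_continuous/derivable1_diffP. Qed.

Lemma tpow_bounded E tau : 0 < tau -> tau <= 1 ->
  exists2 C, 0 < C & forall t, tau <= t <= 1 -> forall i j, `|tpow E t i j| <= C.
Proof.
move=> tau0 tau1.
have H (ij : 'I_d * 'I_d) : exists C, forall t, tau <= t <= 1 -> `|tpow E t ij.1 ij.2| <= C.
  have c : {within `[tau, 1], continuous (fun t => `|tpow E t ij.1 ij.2|)}.
    apply: continuous_in_subspaceT => t; rewrite inE /= in_itv /= => /andP[tt _].
    apply: (@continuous_comp _ _ _ (fun t => tpow E t ij.1 ij.2)); last exact: norm_continuous.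
    exact: der_continuous (der_tpow E _ _ (lt_le_trans tau0 tt)).
  have [m _ Hm] := EVT_max tau1 c.
  by exists `|tpow E m ij.1 ij.2| => t tt; apply: Hm; rewrite in_itv.
have [c Hc] := choice H.
exists (1 + \sum_ij `|c ij|); first by rewrite ltr_pwDl ?sumr_ge0.
move=> t tt i j; apply: (le_trans (Hc (i, j) t tt)).
rewrite (bigD1 (i, j))//= addrCA; apply: ler_wpDr.
  by rewrite addr_ge0 ?sumr_ge0.
exact: ler_norm.
Qed.

Lemma det_le n (A : 'M[R]_n) c : (forall i j, `|A i j| <= c) ->
  `|\det A| <= n`!%:R * c ^+ n.
Proof.
move=> Ac; apply: le_trans (ler_norm_sum _ _ _) _.
rewrite mulr_natl -card_Sn -sumr_const; apply: ler_sum => s _.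
rewrite normrM normrX normrN1 expr1n mul1r normr_prod.
have -> : c ^+ n = \prod_(i < n) c by rewrite prodr_const card_ord.
by apply: ler_prod => i _; rewrite normr_ge0 Ac.
Qed.

(** For t >= 1 the matrix t^E is the inverse of t^-E, that is t^(tr E) times its adjugate, and the
    entries of t^-E are bounded. The exponent tr E is what later meets the condition mu < 1. *)
Lemma tpow_le E : contracting E -> exists2 C, 1 <= C &
  (forall t, 0 < t <= 1 -> forall i j, `|tpow E t i j| <= C) /\
  (forall t, 1 <= t -> forall i j, `|tpow E t i j| <= C * t `^ \tr E).
Proof.
move=> cE; have [tau tau0 H0] := tpow_near0 cE ltr01.
have m0 : 0 < Num.min tau 1 by rewrite lt_min tau0 ltr01.
have m1 : Num.min tau 1 <= 1 by rewrite ge_min lexx orbT.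
have [C C0 HC] := tpow_bounded E m0 m1.
pose C1 := Num.max 1 C.
have H1 t : 0 < t <= 1 -> forall i j, `|tpow E t i j| <= C1.
  move=> /andP[t0 t1] i j; have [tt|tt] := ltP t (Num.min tau 1).
    rewrite (@le_trans _ _ 1)// ?le_max ?lexx// H0// t0 (lt_le_trans tt)//.
    by rewrite ge_min lexx.
  by rewrite le_max HC ?orbT// tt t1.
pose C2 := d.-1`!%:R * C1 ^+ d.-1.
have C10 : 1 <= C1 by rewrite le_max lexx.
exists (Num.max C1 C2); first by rewrite le_max C10.
split; first by move=> t tt i j; rewrite le_max H1.
move=> t t1 i j; have t0 := lt_le_trans ltr01 t1.
have ti : 0 < t^-1 <= 1 by rewrite invr_gt0 t0 invf_le1.
have dn0 : \det (tpow E t^-1) != 0.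
  by rewrite det_tpow ?invr_gt0// gt_eqF// powR_gt0 ?invr_gt0.
have -> : tpow E t = t `^ \tr E *: \adj (tpow E t^-1).
  have e1 : tpow E t *m tpow E t^-1 = 1%:M.
    by rewrite -tpowM ?invr_gt0// divff ?gt_eqF// tpow1.
  have : tpow E t *m tpow E t^-1 *m \adj (tpow E t^-1) = \adj (tpow E t^-1).
    by rewrite e1 mul1mx.
  rewrite -mulmxA mul_mx_adj mul_mx_scalar => <-.
  rewrite scalerA det_tpow ?invr_gt0// -powRM ?invr_ge0 ?ltW// divff ?gt_eqF//.
  by rewrite powR1 scale1r.
rewrite mxE mxE normrM ger0_norm ?powR_ge0// mulrC ler_wpM2r ?powR_ge0//.
rewrite le_max /cofactor normrM normrX normrN1 expr1n mul1r.
by rewrite det_le ?orbT// => i' j'; rewrite mxE mxE H1.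
Qed.

End PowerAction.

(** * Homogeneous gauges *)

Section Gauge.
Context {R : realType} {d : nat}.
Implicit Types (t c : R) (xi w v : 'rV[R]_d).

(** Common shape of [R] at a positive point and of both |Q| and [R] at an imaginary one.
    Contraction, taken from the subhomogeneity conditions, gives control of the norm in the polar
    form xi = P(xi)^E w with P w = 1. *)
Record gauge (P : 'rV[R]_d -> R) (E : 'M[R]_d) : Prop := Gauge {
  gauge_cont : continuous P;
  gauge_ge0 : forall xi, 0 <= P xi;
  gauge_eq0 : forall xi, P xi = 0 <-> xi = 0;
  gauge_homog : homog P E;
  gauge_compact : compact [set xi | P xi = 1];
  gauge_contracting : contracting E }.

Variables (P : 'rV[R]_d -> R) (E : 'M[R]_d).
Hypothesis gP : gauge P E.

Lemma gauge_gt0 xi : xi != 0 -> 0 < P xi.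
Proof.
move=> x0; rewrite lt_neqAle (gauge_ge0 gP)// andbT eq_sym; apply: contra x0 => /eqP.
by move/(gauge_eq0 gP) => ->.
Qed.

Lemma gauge_polar xi : 0 < P xi -> P (act E (P xi)^-1 xi) = 1.
Proof. by move=> P0; rewrite (gauge_homog gP) ?invr_gt0// mulVf// gt_eqF. Qed.

Lemma gauge_sphere_bounded : exists2 B, 0 < B & forall w, P w = 1 -> `|w| <= B.
Proof.
have [M [_ HM]] := compact_bounded (gauge_compact gP).
exists (`|M| + 1); first by rewrite ltr_wpDl.
by move=> w Pw; apply: (HM (`|M| + 1)) => //; rewrite ltr_pwDr// ler_norm.
Qed.

(** Polar form: as t -> 0, t^E shrinks the bounded set P w = 1 uniformly. *)
Lemma gauge_small eps : 0 < eps ->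
  exists2 c, 0 < c & forall xi, P xi < c -> `|xi| < eps.
Proof.
move=> e0; have [B B0 HB] := gauge_sphere_bounded.
have k0 : 0 < d%:R * B + 1 by rewrite ltr_pwDr// mulr_ge0// ltW.
have e1 : 0 < eps / (d%:R * B + 1) by rewrite divr_gt0.
have [tau tau0 Ht] := tpow_near0 (gauge_contracting gP) e1.
exists tau => // xi Px; have [->|x0] := eqVneq xi 0; first by rewrite normr0.
have P0 := gauge_gt0 x0.
rewrite -(actK E xi P0) /act.
have h := @norm_mulmx_le R d (act E (P xi)^-1 xi) (tpow E (P xi))^T _ (ltW e1).
apply: (le_lt_trans (h _)).
  by move=> i j; rewrite mxE Ht// P0.
apply: (@le_lt_trans _ _ (d%:R * (eps / (d%:R * B + 1)) * B)).
  by apply: ler_wpM2l; [rewrite mulr_ge0// ltW|rewrite HB// gauge_polar].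
have -> : d%:R * (eps / (d%:R * B + 1)) * B = eps * (d%:R * B) / (d%:R * B + 1).
  by field; rewrite gt_eqF.
by rewrite ltr_pdivrMr// ltr_pM2l// ltrDl.
Qed.

Lemma gauge_norm_le : exists2 C, 0 < C & forall xi,
  (P xi <= 1 -> `|xi| <= C) /\ (1 <= P xi -> `|xi| <= C * P xi `^ \tr E).
Proof.
have [B B0 HB] := gauge_sphere_bounded.
have [T T1 [HT1 HT2]] := tpow_le (gauge_contracting gP).
have T0 := le_trans ler01 T1.
exists (d%:R * T * B + 1); first by rewrite ltr_pwDr// !mulr_ge0// ltW.
have le1 (x y : R) : x <= y -> 0 <= y -> x <= y + 1 by lra.
move=> xi; split => Px.
- have [->|x0] := eqVneq xi 0; first by rewrite normr0 addr_ge0// !mulr_ge0// ltW.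
  have P0 := gauge_gt0 x0.
  rewrite -(actK E xi P0) /act.
  apply: le1; last by rewrite !mulr_ge0// ltW.
  apply: (le_trans (@norm_mulmx_le _ _ _ _ T T0 _)).
    by move=> i j; rewrite mxE HT1// P0.
  by apply: ler_wpM2l; [rewrite mulr_ge0|rewrite HB// gauge_polar].
- have P0 := lt_le_trans ltr01 Px.
  rewrite -{1}(actK E xi P0) /act.
  apply: (le_trans (@norm_mulmx_le _ _ _ _ (T * P xi `^ \tr E) _ _)).
  + by rewrite mulr_ge0// powR_ge0.
  + by move=> i j; rewrite mxE HT2.
  have -> : d%:R * (T * P xi `^ \tr E) * `|act E (P xi)^-1 xi| =
    d%:R * T * `|act E (P xi)^-1 xi| * P xi `^ \tr E by ring.
  apply: ler_wpM2r; first exact: powR_ge0.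
  apply: le1; last by rewrite !mulr_ge0// ltW.
  by apply: ler_wpM2l; [rewrite mulr_ge0|rewrite HB// gauge_polar].
Qed.

Lemma exp_ge_pow (N : nat) (c : R) : 0 < c ->
  exists2 C, 0 < C & forall x, 0 <= x -> (1 + x) ^+ N <= C * expR (c * x).
Proof.
move=> c0; case: N => [|N].
  exists 1 => // x x0; rewrite expr0 mul1r -expR0 ler_expR mulr_ge0// ltW//.
pose k : R := N.+1%:R; have k0 : 0 < k by rewrite ltr0n.
exists ((k / c) ^+ N.+1 * expR c).
  by rewrite mulr_gt0 ?expR_gt0// exprn_gt0// divr_gt0.
move=> x x0.
have -> : 1 + x = k / c * (c * (1 + x) / k) by field; rewrite !gt_eqF.
rewrite exprMn -[leRHS]mulrA; apply: ler_wpM2l.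
  by rewrite exprn_ge0// divr_ge0// ltW.
rewrite -expRD.
have -> : c + c * x = N.+1%:R * (c * (1 + x) / k) by rewrite /k; field; rewrite gt_eqF.
rewrite expRM_natl.
apply: lerXn2r; rewrite ?nnegrE ?expR_ge0//.
  by rewrite divr_ge0 ?mulr_ge0 ?addr_ge0// ltW.
by apply: le_trans (expR_ge1Dx _); rewrite lerDr.
Qed.

(** The norm grows at most like a power of [P], which the exponential beats. *)
Lemma exp_gauge_decay c : 0 < c ->
  exists2 C, 0 < C & forall xi, expR (- (c * P xi)) <= C * decay xi.
Proof.
move=> c0; have [C0 C00 HC] := gauge_norm_le.
pose N := Num.Def.truncn `|\tr E|.
have HN : \tr E <= N.+1%:R.
  by apply: le_trans (ler_norm _) _; rewrite ltW// truncnS_gt.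
have [C1 C10 HC1] := exp_ge_pow (N.+1 * d.*2) c0.
exists ((1 + C0) ^+ d.*2 * C1); first by rewrite mulr_gt0// exprn_gt0// addr_gt0.
move=> xi; rewrite /decay expRN -[leLHS]mul1r ler_pdivrMr ?expR_gt0// mulrAC.
rewrite ler_pdivlMr ?exprn_gt0 ?ltr_pwDl// mul1r -mulrA.
apply: (@le_trans _ _ ((1 + C0) ^+ d.*2 * ((1 + P xi) ^+ N.+1) ^+ d.*2)); last first.
  rewrite ler_pM2l ?exprn_gt0 ?addr_gt0// -exprM.
  exact: HC1 (gauge_ge0 gP _).
rewrite -exprMn; apply: lerXn2r.
- by rewrite nnegrE addr_ge0.
- by rewrite nnegrE mulr_ge0 ?exprn_ge0 ?addr_ge0 ?(ltW C00)// (gauge_ge0 gP).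
have P1 : 1 <= (1 + P xi) ^+ N.+1 by rewrite exprn_ege1// lerDl (gauge_ge0 gP).
have [h1 h2] := HC xi; have Cn0 := ltW C00.
rewrite mulrDl mul1r lerD//.
have [Px|/ltW Px] := leP (P xi) 1.
  by apply: (le_trans (h1 Px)); rewrite ler_peMr.
apply: (le_trans (h2 Px)); rewrite ler_wpM2l//.
apply: (@le_trans _ _ (P xi `^ N.+1%:R)); first by rewrite ler_powR.
rewrite powR_mulrn ?(gauge_ge0 gP)//; apply: lerXn2r; rewrite ?nnegrE ?addr_ge0 ?(gauge_ge0 gP)//.
by rewrite lerDr.
Qed.

End Gauge.

(** * Integrals over the whole space and changes of variable *)

Section VectorIntegrals.
Context {R : realType} {d : nat}.
Implicit Types (f g : 'rV[R]_d -> R) (E : 'M[R]_d).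

Definition vintegrable f := (leb d).-integrable setT (EFin \o f).
Definition vint f : R := \int[leb d]_v f v.

Definition cut (b : 'rV[R]_d -> bool) f v : R := if b v then f v else 0.

Lemma vintegrable_meas f : vintegrable f -> measurable_fun setT f.
Proof. by move=> /integrableP[/measurable_EFinP]. Qed.

Lemma measurable_cut (b : 'rV[R]_d -> bool) f :
  measurable_fun setT b -> measurable_fun setT f -> measurable_fun setT (cut b f).
Proof. by move=> mb mf; apply: measurable_fun_ifT. Qed.

Lemma vintegrable_cut (b : 'rV[R]_d -> bool) f :
  measurable_fun setT b -> vintegrable f -> vintegrable (cut b f).
Proof.
move=> mb fi; have mf := vintegrable_meas fi.
apply: (@le_integrable _ _ _ (leb d) setT measurableT _ (EFin \o f)) => //.
  by apply/measurable_EFinP; exact: measurable_cut.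
by move=> v _; rewrite /cut /=; case: ifP => // _; rewrite !lee_fin normr0.
Qed.

Lemma vintD f g : vintegrable f -> vintegrable g ->
  vint (fun v => f v + g v) = vint f + vint g.
Proof. by move=> fi gi; rewrite /vint RintegralD. Qed.

Lemma vintB f g : vintegrable f -> vintegrable g ->
  vint (fun v => f v - g v) = vint f - vint g.
Proof. by move=> fi gi; rewrite /vint RintegralB. Qed.

Lemma vintZ f c : vintegrable f -> vint (fun v => c * f v) = c * vint f.
Proof. by move=> fi; rewrite /vint RintegralZl. Qed.

Lemma vintegrableD f g : vintegrable f -> vintegrable g ->
  vintegrable (fun v => f v + g v).
Proof. by move=> fi gi; exact: (integrableD measurableT fi gi). Qed.

Lemma vintegrableB f g : vintegrable f -> vintegrable g ->
  vintegrable (fun v => f v - g v).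
Proof. by move=> fi gi; exact: (integrableB measurableT fi gi). Qed.

Lemma vintegrableZ f c : vintegrable f -> vintegrable (fun v => c * f v).
Proof. by move=> fi; exact: (integrableZl measurableT c fi). Qed.

Lemma vint_le f g : vintegrable f -> vintegrable g -> (forall v, f v <= g v) ->
  vint f <= vint g.
Proof. by move=> fi gi fg; apply: le_Rintegral. Qed.

Lemma vint_ge0 f : (forall v, 0 <= f v) -> 0 <= vint f.
Proof. by move=> f0; apply: Rintegral_ge0. Qed.

Lemma vintegrable_le f g : measurable_fun setT f -> vintegrable g ->
  (forall v, `|f v| <= g v) -> vintegrable f.
Proof. by move=> mf gi fg; exact: integrable_le gi. Qed.

Lemma vint_norm_le f g : measurable_fun setT f -> vintegrable g ->
  (forall v, `|f v| <= g v) -> `|vint f| <= vint g.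
Proof.
move=> mf gi fg; have fi := vintegrable_le mf gi fg.
apply: le_trans (le_normr_Rintegral measurableT fi) _.
by apply: vint_le => //; exact: integrable_norm.
Qed.

Lemma eq_vint f g : f =1 g -> vint f = vint g.
Proof. by move=> /funext ->. Qed.

Lemma vint_mulmx (A : 'M[R]_d) f : \det A != 0 -> vintegrable f ->
  vintegrable (fun v => f (v *m A)) /\ `|\det A| * vint (fun v => f (v *m A)) = vint f.
Proof.
move=> dA fi; have mf := vintegrable_meas fi.
have mE : measurable_fun setT (EFin \o f) by exact/measurable_EFinP.
have k0 : 0 < `|\det A| by rewrite normr_gt0.
have iA : vintegrable (fun v => f (v *m A)).
  apply/integrableP; split; first exact: (measurable_mulmx A mE).
  have [_] := integrableP _ _ _ fi.
  rewrite -(leb_scalingP dA)//; last exact: measurableT_comp.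
  set I := (\int[leb d]_x _)%E => H; rewrite ltey; apply: contraTneq H => ->.
  by rewrite gt0_muley ?lte_fin// ltxx.
split => //; apply: EFin_inj; rewrite EFinM /vint /Rintegral.
rewrite !fineK; try exact: integrable_fin_num.
rewrite integralE [RHS]integralE.
rewrite muleBr//; last first.
  by apply: fin_num_adde_defr; apply: integrable_pos_fin_num.
rewrite -(leb_scalingP dA (f := (EFin \o f)^\+%E))//; last exact: measurable_funepos.
rewrite -(leb_scalingP dA (f := (EFin \o f)^\-%E))//; last exact: measurable_funeneg.
by congr (_ * _ - _ * _)%E; apply: eq_integral => v _; rewrite ?funeposE ?funenegE.
Qed.

Lemma vint_act E t f : 0 < t -> vintegrable f ->
  vintegrable (fun v => f (act E t v)) /\
  t `^ \tr E * vint (fun v => f (act E t v)) = vint f.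
Proof.
move=> t0 fi; have dT : \det (tpow E t)^T = t `^ \tr E by rewrite det_tr det_tpow.
have p0 : 0 < t `^ \tr E by rewrite powR_gt0.
have := @vint_mulmx (tpow E t)^T f; rewrite dT gtr0_norm//; apply => //.
by rewrite gt_eqF.
Qed.

Lemma vint_translate f c : vintegrable f ->
  vintegrable (fun v => f (v + c)) /\ vint (fun v => f (v + c)) = vint f.
Proof.
move=> fi; have mf := vintegrable_meas fi.
have mE : measurable_fun setT (EFin \o f) by exact/measurable_EFinP.
have mc : measurable_fun setT (fun v : 'rV[R]_d => f (v + c)).
  apply: (measurableT_comp mf); apply: measurable_fun_rVP => i.
  by under eq_fun do rewrite mxE; apply: measurable_funD => //; exact: measurable_coor.
have ic : vintegrable (fun v => f (v + c)).
  apply/integrableP; split; first exact/measurable_EFinP.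
  have [_] := integrableP _ _ _ fi.
  by rewrite -(leb_translate c)//; exact: measurableT_comp.
split => //; rewrite /vint /Rintegral integralE [in RHS]integralE.
rewrite -(leb_translate c (f := (EFin \o f)^\+%E))//; last exact: measurable_funepos.
rewrite -(leb_translate c (f := (EFin \o f)^\-%E))//; last exact: measurable_funeneg.
by congr (fine (_ - _)%E); apply: eq_integral => v _; rewrite ?funeposE ?funenegE.
Qed.

End VectorIntegrals.

(** * Volumes and weights on the shells of a gauge *)

Section GaugeIntegrals.
Context {R : realType} {d : nat}.
Variables (P : 'rV[R]_d -> R) (E : 'M[R]_d).
Hypothesis gP : gauge P E.
Local Notation mu := (\tr E).

Lemma measurable_gauge : measurable_fun setT P.
Proof. exact: continuous_measurable_rV (gauge_cont gP). Qed.

Lemma measurable_gauge_lt l : measurable_fun setT (fun v => P v < l).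
Proof. by apply: measurable_fun_ltr => //; exact: measurable_gauge. Qed.

Lemma measurable_gauge_ge l : measurable_fun setT (fun v => l <= P v).
Proof. by apply: measurable_fun_ler => //; exact: measurable_gauge. Qed.

Lemma measurable_gauge_shell a b : measurable_fun setT (fun v => a <= P v < b).
Proof. by apply: measurable_and; [exact: measurable_gauge_ge|exact: measurable_gauge_lt]. Qed.

Lemma measurable_exp_gauge c : measurable_fun setT (fun v => expR (- (c * P v))).
Proof.
apply: measurableT_comp => //; apply: measurable_funN.
by apply: measurable_funM => //; exact: measurable_gauge.
Qed.

Lemma vintegrable_exp_gauge c : 0 < c -> vintegrable (fun v => expR (- (c * P v))).
Proof.
move=> c0; have [C C0 HC] := exp_gauge_decay gP c0.
apply: (@integrable_le_decay _ _ _ C); first exact: measurable_exp_gauge.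
by move=> v; rewrite ger0_norm ?expR_ge0.
Qed.

(** Sublevel sets have finite measure because the indicator of P < l is at most exp(l - P). *)
Lemma vintegrable_ball (f : 'rV[R]_d -> R) C l : measurable_fun setT f ->
  (forall v, `|f v| <= if P v < l then C else 0) -> vintegrable f.
Proof.
move=> mf Hf.
have ei := vintegrableZ (`|C| * expR l) (@vintegrable_exp_gauge 1 ltr01).
apply: (vintegrable_le mf ei) => v; apply: (le_trans (Hf v)).
case: ltP => Pv; last by rewrite !mulr_ge0 ?expR_ge0.
rewrite -mulrA -expRD mul1r; apply: (le_trans (ler_norm C)); rewrite ler_peMr//.
by rewrite -expR0 ler_expR subr_ge0 ltW.
Qed.

Definition gauge_vol l := vint (cut (fun v => P v < l) (fun=> 1)).

Lemma vintegrable_ball1 l : vintegrable (cut (fun v => P v < l) (fun=> 1)).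
Proof.
apply: (@vintegrable_ball _ 1 l).
  by apply: measurable_cut => //; exact: measurable_gauge_lt.
by move=> v; rewrite /cut; case: ifP => _; rewrite ?normr1 ?normr0.
Qed.

Lemma gauge_volE l : 0 < l -> gauge_vol l = l `^ mu * gauge_vol 1.
Proof.
move=> l0; have [_ H] := vint_act E l0 (vintegrable_ball1 l).
apply: (eq_trans (esym H)); congr (_ * _); apply: eq_vint => v.
by rewrite /cut (gauge_homog gP)// -[X in _ < X]mulr1 ltr_pM2l.
Qed.

Lemma gauge_vol_ge0 l : 0 <= gauge_vol l.
Proof. by apply: vint_ge0 => v; rewrite /cut; case: ifP. Qed.

(** Majorant left by the ray estimate, which gains a factor 1 / P at each point of the shell. *)
Definition shell_inv a b v := if a <= P v < b then (P v)^-1 else 0.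

Lemma vintegrable_shell_inv a b : 0 < a -> vintegrable (shell_inv a b).
Proof.
move=> a0; apply: (@vintegrable_ball _ a^-1 b).
  have -> : shell_inv a b = fun v => if a <= P v < b then expR (- ln (P v)) else 0.
    apply/funext => v; rewrite /shell_inv; case: ifP => // /andP[aP _].
    by rewrite expRN lnK// posrE (lt_le_trans a0).
  apply: measurable_fun_ifT => //; first exact: measurable_gauge_shell.
  apply: measurableT_comp => //; apply: measurable_funN.
  by apply: measurableT_comp => //; exact: measurable_gauge.
move=> v; rewrite /shell_inv; case: ifP => [/andP[aP Pb]|_].
  have P0 := lt_le_trans a0 aP.
  by rewrite Pb ger0_norm ?invr_ge0 ?(ltW P0)// lef_pV2.
by rewrite normr0; case: ifP => // _; rewrite invr_ge0 ltW.
Qed.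

Lemma shell_inv_ge0 a b v : 0 <= shell_inv a b v.
Proof. by rewrite /shell_inv; case: ifP => // _; rewrite invr_ge0 (gauge_ge0 gP). Qed.

Lemma shell_inv_scale t a b : 0 < t -> 0 < a ->
  vint (shell_inv (t * a) (t * b)) = t `^ (mu - 1) * vint (shell_inv a b).
Proof.
move=> t0 a0; have ta : 0 < t * a by rewrite mulr_gt0.
have [_ <-] := vint_act E t0 (vintegrable_shell_inv (t * b) ta).
have -> : t `^ (mu - 1) = t `^ mu * t^-1.
  by rewrite powRD ?powRN ?powRr1 ?ltW//; apply/implyP => _; rewrite gt_eqF.
rewrite -mulrA -[t^-1 * vint _]vintZ; last by apply: vintegrable_shell_inv.
congr (_ * _); apply: eq_vint => v; rewrite /shell_inv (gauge_homog gP)//.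
by rewrite ler_pM2l// ltr_pM2l//; case: ifP => _; rewrite ?mulr0// invfM.
Qed.

(** Dyadic shells: doubling the radii multiplies the integral by q = 2^(mu - 1) < 1, so the shells
    sum geometrically, uniformly in [b]; scaling restores the power of [a]. *)
Lemma shell_inv_le : mu < 1 -> exists2 C, 0 <= C &
  forall a b, 0 < a -> vint (shell_inv a b) <= C * a `^ (mu - 1).
Proof.
move=> mu1; pose q := (2 : R) `^ (mu - 1); pose K N := vint (shell_inv 1 (2 ^+ N)).
have q0 : 0 < q by rewrite powR_gt0.
have q1 : q < 1.
  rewrite /q /powR gt_eqF// expR_lt1 pmulr_llt0 ?ln_gt0 ?ltr1n//.
  by rewrite subr_lt0.
have KS N : K N.+1 <= K 1%N + q * K N.
  rewrite /K /q -shell_inv_scale// mulr1 -exprS -vintD; try by apply: vintegrable_shell_inv.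
  apply: vint_le; try by do ?apply: vintegrableD; apply: vintegrable_shell_inv.
  move=> v; rewrite [leLHS]/shell_inv; case: ifP => [/andP[P1 PN]|_]; last first.
    by rewrite addr_ge0// shell_inv_ge0.
  have := shell_inv_ge0 1 (2 ^+ 1) v; have := shell_inv_ge0 2 (2 ^+ N.+1) v.
  rewrite /shell_inv P1 PN andbT /= expr1; case: (ltP (P v) 2) => //=; lra.
have K1 : 0 <= K 1%N by apply: vint_ge0 => v; exact: shell_inv_ge0.
have KN N : K N <= K 1%N / (1 - q).
  elim: N => [|N IH].
    rewrite /K (@eq_vint _ _ _ (fun=> 0)); last first.
      by move=> v; rewrite /shell_inv expr0; case: leP => //= P1; rewrite ltNge P1.
    by rewrite /vint Rintegral_cst ?mul0r ?divr_ge0 ?subr_ge0 ?(ltW q1)//.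
  apply: (le_trans (KS N)).
  have -> : K 1%N / (1 - q) = K 1%N + q * (K 1%N / (1 - q)) by field; rewrite subr_eq0 gt_eqF.
  by rewrite lerD2l ler_pM2l.
exists (K 1%N / (1 - q)); first by rewrite divr_ge0 ?subr_ge0 ?(ltW q1).
move=> a b a0; pose N := Num.Def.truncn `|b / a|.
have bN : b <= a * 2 ^+ N.+1.
  rewrite mulrC -ler_pdivrMr//; apply: le_trans (ler_norm _) _.
  rewrite ltW//; apply: (lt_le_trans (truncnS_gt _)).
  by rewrite -natrX ler_nat ltnW// ltn_expl.
apply: (@le_trans _ _ (vint (shell_inv (a * 1) (a * 2 ^+ N.+1)))); last first.
  by rewrite shell_inv_scale// mulrC ler_pM2r ?powR_gt0//; exact: KN.
rewrite mulr1; apply: vint_le; try by apply: vintegrable_shell_inv.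
move=> v; rewrite [leLHS]/shell_inv; case: ifP => [/andP[aP Pb]|_]; last exact: shell_inv_ge0.
by rewrite /shell_inv aP (lt_le_trans Pb bN).
Qed.

End GaugeIntegrals.

(** * Averaging over dilations *)

Section Averaging.
Context {R : realType} {d : nat}.
Variable E : 'M[R]_d.
Local Notation mu := (\tr E).
Local Notation leb1 := (@lebesgue_measure R).

(** The density on 1 <= s <= 2 that appears when the Jacobian s^mu of s^E is divided out. *)
Let w (s : R) : R := if 1 <= s <= 2 then s `^ (- mu) else 0.

Let in12_meas : measurable_fun setT (fun s : R => 1 <= s <= 2).
Proof. by apply: measurable_and; apply: measurable_fun_ler. Qed.

Let w_meas : measurable_fun setT w.
Proof. by apply: measurable_fun_ifT => //; exact: measurable_powR. Qed.

Let pow_bounds s : 1 <= s <= 2 -> 2 `^ (- `|mu|) <= s `^ (- mu) <= 2 `^ `|mu|.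
Proof.
move=> /andP[s1 s2]; have s0 := lt_le_trans ltr01 s1.
have h : s `^ `|mu| <= 2 `^ `|mu| by rewrite ge0_ler_powR// nnegrE ltW.
apply/andP; split.
  apply: (@le_trans _ _ (s `^ (- `|mu|))).
    by rewrite !powRN lef_pV2// posrE powR_gt0.
  by rewrite ler_powR// lerN2 ler_norm.
by apply: le_trans h; rewrite ler_powR// -normrN ler_norm.
Qed.

Let ind_int : leb1.-integrable setT (EFin \o \1_(`[1, 2]%classic : set R)).
Proof. exact: integrable_indic_itv. Qed.

Let indE (s : R) : \1_(`[1, 2]%classic : set R) s = if 1 <= s <= 2 then 1 else 0 :> R.
Proof. by rewrite indicE mem_setE in_itv /=; case: ifP. Qed.

Let w_int : leb1.-integrable setT (EFin \o w).
Proof.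
apply: (le_integrable measurableT _ _ (integrableZl measurableT (2 `^ `|mu|) ind_int)).
  exact/measurable_EFinP.
move=> s _; rewrite lee_fin /= indE /w; case: ifP => [H|_]; last by rewrite mulr0.
have /andP[_ h] := pow_bounds H.
by rewrite mulr1 [leLHS]ger0_norm ?[leRHS]ger0_norm ?powR_ge0.
Qed.

Let c := \int[leb1]_s w s.

Let c_gt0 : 0 < c.
Proof.
apply: (@lt_le_trans _ _ (2 `^ (- `|mu|))); first by rewrite powR_gt0.
have -> : 2 `^ (- `|mu|) = \int[leb1]_s (2 `^ (- `|mu|) * \1_(`[1, 2]%classic : set R) s).
  have e : @lebesgue_measure R `[1, 2]%classic = 1%E.
    by rewrite lebesgue_measure_itv /= lte_fin ltr1n -EFinD; congr _%:E; lra.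
  by rewrite RintegralZl// /Rintegral integral_indic// setIT [X in fine X]e mulr1.
apply: le_Rintegral => //.
  exact: (integrableZl measurableT _ ind_int).
move=> s _; rewrite indE /w; case: ifP => [/pow_bounds/andP[h _]|_]; last by rewrite mulr0.
by rewrite mulr1.
Qed.

Lemma vint_act_div (f : 'rV[R]_d -> R) s : 0 < s -> vintegrable f ->
  vint (fun v => f (act E s v)) = s `^ (- mu) * vint f.
Proof.
move=> s0 fi; have [_ <-] := vint_act E s0 fi.
by rewrite mulrA powRN mulVf ?mul1r// gt_eqF// powR_gt0.
Qed.

Lemma measurable_tpow i j : measurable_fun setT (fun s => tpow E s i j).
Proof.
have -> : (fun s => tpow E s i j) = egf (fun k => mpow E k i j) \o (@ln R).
  by apply/funext => s; rewrite /tpow mexpE.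
apply: (@measurableT_comp _ _ _ _ _ _ (egf (fun k => mpow E k i j))); last exact: measurable_ln.
apply: continuous_measurable_fun => x.
exact: der_continuous (der_egf x (geom_bounded_mpow E i j)).
Qed.

Lemma measurable_act : measurable_fun setT
  (fun p : measurableTypeR R * 'rV[R]_d => act E p.1 p.2).
Proof.
apply: measurable_fun_rVP => i; under eq_fun do rewrite mxE.
apply: measurable_sum => j; under eq_fun do rewrite [_^T j i]mxE.
apply: measurable_funM.
  exact: (measurableT_comp (measurable_coor j) measurable_snd).
exact: (measurableT_comp (measurable_tpow i j) measurable_fst).
Qed.

Let avg (f : 'rV[R]_d -> R) (p : measurableTypeR R * 'rV[R]_d) : \bar R :=
  (if 1 <= p.1 <= 2 then f (act E p.1 p.2) else 0)%:E.

Let avg_meas f : measurable_fun setT f -> measurable_fun setT (avg f).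
Proof.
move=> mf; apply/measurable_EFinP; apply: measurable_fun_ifT => //.
  exact: (measurableT_comp in12_meas measurable_fst).
exact: (measurableT_comp mf measurable_act).
Qed.

Let avg_inner f s : vintegrable f ->
  (\int[leb d]_v avg f (s, v) = (w s * vint f)%:E)%E.
Proof.
move=> fi; rewrite /avg /w /=; case: ifP => [/andP[s1 _]|_]; last first.
  by rewrite integral0 mul0r.
have s0 := lt_le_trans ltr01 s1; have [i _] := vint_act E s0 fi.
by rewrite -vint_act_div// /vint /Rintegral fineK//; exact: integrable_fin_num.
Qed.

(** By Fubini, the integral over v of the ray averages is [vint f] times the integral of s^(-mu)
    over [1, 2], a positive constant depending on [E] alone. The bound [B] makes [f] integrable
    along every ray segment. *)
Lemma averaging : exists2 C, 0 < C & forall (f g : 'rV[R]_d -> R) B,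
  vintegrable f -> (forall v, `|f v| <= B) -> vintegrable g ->
  (forall v, `|\int[leb1]_(s in `[1, 2]) f (act E s v)| <= g v) ->
  `|vint f| <= C * vint g.
Proof.
exists c^-1; first by rewrite invr_gt0.
move=> f g B fi fB gi fg; have mf := vintegrable_meas fi.
have ni : vintegrable (fun v => `|f v|) by exact: integrable_norm.
have Fi : (leb1 \x leb d)%E.-integrable setT (avg f).
  apply/integrable12ltyP; first exact: avg_meas.
  have -> : (fun s => \int[leb d]_v `|avg f (s, v)|)%E =
      (fun s => (w s * vint (fun v => `|f v|))%:E).
    apply/funext => s; rewrite -avg_inner//; apply: eq_integral => v _.
    by rewrite /avg /=; case: ifP => //; rewrite normr0.
  apply: integrable_lty => //.
  apply: eq_integrable (integrableZr measurableT (vint (fun v => `|f v|)) w_int) => //.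
have := Fubini Fi.
under [LHS]eq_integral do rewrite (avg_inner _ fi) EFinM.
rewrite integralZr// => H.
have {}H : (c * vint f)%:E = (\int[leb d]_y \int[leb1]_x avg f (x, y))%E.
  by rewrite -H EFinM /c /Rintegral fineK//; exact: integrable_fin_num.
rewrite ler_pdivlMl// -[X in X * _]gtr0_norm// -normrM -lee_fin.
have -> : (`|c * vint f|)%:E = `|(c * vint f)%:E|%E by [].
rewrite H.
have mG : measurable_fun setT (fun y => \int[leb1]_x avg f (x, y))%E.
  exact: (measurable_fubini_G Fi).
apply: le_trans (le_abse_integral _ measurableT mG) _.
rewrite /vint /Rintegral fineK; last exact: integrable_fin_num.
apply: ge0_le_integral => //.
- exact: measurableT_comp.
- by apply/measurable_EFinP; exact: vintegrable_meas.
move=> v _.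
have ms : measurable_fun (`[1%R, 2%R]%classic : set (measurableTypeR R)) (fun s => f (act E s v)).
  apply: (@measurable_funS _ _ _ _ setT) => //.
  apply: (measurableT_comp mf); apply: measurable_fun_rVP => i.
  under eq_fun do rewrite mxE.
  apply: measurable_sum => j; under eq_fun do rewrite [_^T j i]mxE.
  by apply: measurable_funM => //; exact: measurable_tpow.
have -> : (\int[leb1]_x avg f (x, v) = \int[leb1]_(x in `[1%R, 2%R]) (f (act E x v))%:E)%E.
  rewrite [RHS]integral_mkcond; apply: eq_integral => s _.
  by rewrite /avg patchE mem_setE in_itv /=; case: ifP.
have ii : leb1.-integrable (`[1%R, 2%R]%classic : set (measurableTypeR R)) (fun s => (f (act E s v))%:E).
  apply: measurable_bounded_integrable => //.
    by rewrite /= lebesgue_measure_itv /= lte_fin ltr1n -EFinD ltry.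
  exists B; split; first exact: num_real.
  by move=> x Bx s _; rewrite /= (le_trans (fB _))// ltW.
rewrite -[X in `|X|%E]fineK; last exact: integrable_fin_num.
by rewrite lee_fin fg.
Qed.

End Averaging.

(** * Oscillation along rays *)

Section VanDerCorput.
Context {R : realType}.
Local Notation leb1 := (@lebesgue_measure R).

Lemma norm_cos_le1 (x : R) : `|cos x| <= 1.
Proof. by rewrite ler_norml cos_geN1 cos_le1. Qed.

Lemma norm_sin_le1 (x : R) : `|sin x| <= 1.
Proof. by rewrite ler_norml sin_geN1 sin_le1. Qed.

(* Integrating by parts, A cos th differs from the derivative of
   A sin th / th' by terms of size 1 / lam. *)
Lemma van_der_corput (A dA th dth ddth : R -> R) (u0 u1 lam C : R) :
  u0 <= u1 -> u1 - u0 <= 1 -> 0 < lam -> 0 <= C ->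
  (forall s, u0 <= s <= u1 -> [/\ is_derive s 1 A (dA s),
     is_derive s 1 th (dth s) & is_derive s 1 dth (ddth s)]) ->
  (forall s, u0 <= s <= u1 ->
     [/\ lam <= dth s, `|A s| <= C, `|dA s| <= C & `|ddth s| <= C * lam]) ->
  `|\int[leb1]_(s in `[u0, u1]) (A s * cos (th s))| <= (3 * C + C ^+ 2) / lam.
Proof.
move=> u01 len lam0 C0 Hd Hb.
have K0 : 0 <= (3 * C + C ^+ 2) / lam
  by apply: divr_ge0; [rewrite addr_ge0 ?mulr_ge0 ?sqr_ge0|exact: ltW].
move: u01; rewrite le_eqVlt => /predU1P[<-|u01].
  by rewrite set_itv1 Rintegral_set1 normr0.
pose f s := A s * cos (th s).
pose G x := \int[leb1]_(s in `[u0, x]) f s.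
pose F s := A s * sin (th s) / dth s.
pose e s := dA s * sin (th s) / dth s - A s * sin (th s) * ddth s / dth s ^+ 2.
have dth0 s : u0 <= s <= u1 -> 0 < dth s.
  by move=> /Hb[h _ _ _]; exact: lt_le_trans h.
have dF s : u0 <= s <= u1 -> is_derive s 1 F (f s + e s).
  move=> su; have [d1 d2 d3] := Hd s su; have n0 := dth0 s su.
  have ds := @der_comp R (@sin R) th s _ _ (is_derive_sin _) d2.
  have di := is_deriveV (lt0r_neq0 n0) d3.
  apply: is_derive_eq (derM (derM d1 ds) di) _.
  by rewrite /f /e /GRing.scale /=; field; rewrite gt_eqF.
have cf s : u0 <= s <= u1 -> {for s, continuous f}.
  move=> su; have [d1 d2 _] := Hd s su.
  have dc := @der_comp R (@cos R) th s _ _ (is_derive_cos _) d2.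
  exact: der_continuous (derM d1 dc).
have within (h : R -> R) : (forall s, u0 <= s <= u1 -> {for s, continuous h}) ->
    {within `[u0, u1], continuous h}.
  move=> H; apply: continuous_in_subspaceT => s; rewrite inE /= in_itv /=.
  exact: H.
have intf : leb1.-integrable `[u0, u1] (EFin \o f).
  by apply: continuous_compact_integrable; [exact: segment_compact|exact: within].
have cG : {within `[u0, u1], continuous G} by apply: parameterized_integral_continuous => //; exact: ltW.
have cF : {within `[u0, u1], continuous F}.
  by apply: within => s su; exact: der_continuous (dF s su).
(* The mean value theorem for G - F takes the place of integrating [e], so a pointwise bound on
   [ddth] is all that enters. *)
have dH s : s \in `]u0, u1[%R -> is_derive s 1 (fun s => G s - F s) (- e s).
  rewrite in_itv /= => /andP[h0 h1]; have su : u0 <= s <= u1 by rewrite !ltW.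
  have [g1 g2] := continuous_FTC1_closed h1 intf h0 (cf s su).
  have dG : is_derive s 1 G (f s) := DeriveDef g1 (etrans (esym (derive1E G s)) g2).
  by apply: is_derive_eq (derB dG (dF s su)) _; ring.
have cH : {within `[u0, u1], continuous (fun s => G s - F s)}.
  by move=> x; apply: cvgB; [exact: cG|exact: cF].
have [c cu] := MVT u01 dH cH.
have G0 : G u0 = 0 by rewrite /G set_itv1 Rintegral_set1.
rewrite -/(G u1) G0 => E; move: cu; rewrite in_itv /= => /andP[c0 c1].
have cu : u0 <= c <= u1 by rewrite !ltW.
have -> : G u1 = F u1 - F u0 - e c * (u1 - u0) by move: E; lra.
have u0u : u0 <= u0 <= u1 by rewrite lexx ltW.
have u1u : u0 <= u1 <= u1 by rewrite lexx ltW.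
have bF s : u0 <= s <= u1 -> `|F s| <= C / lam.
  move=> su; have [h1 h2 _ _] := Hb s su; have n0 := dth0 s su.
  have i0 : 0 <= (dth s)^-1 by rewrite invr_ge0 ltW.
  rewrite /F !normrM (ger0_norm i0).
  apply: ler_pM => //; last by rewrite lef_pV2.
  by rewrite -[leRHS]mulr1 ler_pM// norm_sin_le1.
have be : `|e c| <= (C + C ^+ 2) / lam.
  have [h1 h2 h3 h4] := Hb c cu; have n0 := dth0 c cu.
  have i1 : (dth c)^-1 <= lam^-1 by rewrite lef_pV2.
  have i0 : 0 <= (dth c)^-1 by rewrite invr_ge0 ltW.
  rewrite mulrDl; apply: le_trans (ler_normB _ _) _; apply: lerD.
    rewrite !normrM (ger0_norm i0); apply: ler_pM => //.
    by rewrite -[leRHS]mulr1 ler_pM// norm_sin_le1.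
  have -> : C ^+ 2 / lam = (C * 1) * (C * lam) * (lam^-1 * lam^-1) by field; rewrite gt_eqF.
  rewrite !normrM normfV normrX (gtr0_norm n0) -exprVn expr2.
  apply: ler_pM; rewrite ?mulr_ge0//; last exact: ler_pM.
  by apply: ler_pM => //; apply: ler_pM => //; exact: norm_sin_le1.
apply: le_trans (ler_normB _ _) _.
have -> : (3 * C + C ^+ 2) / lam = (C / lam + C / lam) + (C + C ^+ 2) / lam * 1 by ring.
apply: lerD; first by apply: le_trans (ler_normB _ _) _; apply: lerD; exact: bF.
rewrite normrM; apply: ler_pM => //.
by rewrite ger0_norm// subr_ge0 ltW.
Qed.

End VanDerCorput.

Section ShellOscillation.
Context {R : realType} {d : nat}.
Variables (P : 'rV[R]_d -> R) (E : 'M[R]_d).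
Hypothesis gP : gauge P E.
Hypothesis mu1 : \tr E < 1.
Local Notation leb1 := (@lebesgue_measure R).

(** The weights t in front of [dA] and [ddth] make the conditions scale with t, so the segment 1 <=
    s <= 2 of any ray meets the hypotheses of [van_der_corput]. The equation is asked only for t < b
    because shells are half-open, the derivatives up to t = b. *)
Definition ray_phase (f : R -> R) (a b lam C : R) := exists A dA th dth ddth : R -> R,
  forall t, a <= t <= b ->
  [/\ [/\ is_derive t 1 A (dA t), is_derive t 1 th (dth t) & is_derive t 1 dth (ddth t)],
      [/\ lam <= dth t, `|A t| <= C, t * `|dA t| <= C & t * `|ddth t| <= C * lam] &
      t < b -> f t = A t * cos (th t)].

(** With t = s p the phase derivative in s is at least lam p on 1 <= s <= 2, whence the extra 1 /
    p. *)
Lemma ray_integral_le (f : R -> R) a b lam C p : 0 < a -> 0 < lam -> 0 <= C -> 0 < p ->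
  measurable_fun setT (fun s : R => f (s * p)) ->
  ray_phase f a b lam C -> (forall t, ~~ (a <= t < b) -> f t = 0) ->
  `|\int[leb1]_(s in `[1, 2]) f (s * p)| <= (3 * C + C ^+ 2) / lam / p.
Proof.
move=> a0 lam0 C0 p0 mf [A [dA [th [dth [ddth H]]]]] f0.
(* Up to an endpoint, the s in [1, 2] with a <= s p < b fill the interval from [u0] to [u1]. *)
pose u0 := Num.max 1 (a / p); pose u1 := Num.min 2 (b / p).
have K0 : 0 <= (3 * C + C ^+ 2) / lam / p.
  by rewrite !mulr_ge0 ?invr_ge0 ?(ltW lam0) ?(ltW p0)// addr_ge0 ?mulr_ge0 ?sqr_ge0.
have ge_u0 s : (u0 <= s) = (1 <= s) && (a <= s * p) by rewrite /u0 ge_max ler_pdivrMr.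
have lt_u1 s : (s < u1) = (s < 2) && (s * p < b) by rewrite /u1 lt_min ltr_pdivlMr.
have le_u1 s : (s <= u1) = (s <= 2) && (s * p <= b) by rewrite /u1 le_min ler_pdivlMr.
pose g s := A (s * p) * cos (th (s * p)).
have -> : \int[leb1]_(s in `[1, 2]) f (s * p) = \int[leb1]_(s in `[u0, u1[) g s.
  transitivity (\int[leb1]_(s in `[1, 2[) f (s * p)).
    rewrite /Rintegral -integral_itv_bndo_bndc//.
    by apply: measurable_funTS; exact/measurable_EFinP.
  rewrite [LHS]Rintegral_mkcond [RHS]Rintegral_mkcond; apply: eq_Rintegral => s _.
  rewrite !patchE !mem_setE !in_itv /= ge_u0 lt_u1.
  case: (boolP (1 <= s < 2)) => [/andP[-> ->]|] /=.
    case: ifP => [/andP[h1 h2]|/negbT h]; last exact: f0.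
    by have [|_ _ ->] := H (s * p); rewrite ?h1 ?(ltW h2).
  by case: ifP => // /andP[/andP[-> _] /andP[-> _]].
have [u01|u10] := leP u0 u1; last first.
  rewrite set_itv_ge ?Rintegral_set0 ?normr0// bnd_simp -leNgt ltW//.
have Hs s : u0 <= s <= u1 -> 0 < s /\ a <= s * p <= b.
  rewrite ge_u0 le_u1 => /andP[/andP[s1 ->] /andP[_ ->]].
  by split => //; exact: lt_le_trans s1.
have ds (h : R -> R) dh s : is_derive (s * p) 1 h dh -> is_derive s 1 (fun s => h (s * p)) (dh * p).
  move=> dhs; apply: (@der_comp R h (fun s => s * p)) => //.
  by apply: is_derive_eq (derM (is_derive_id s 1) (der_cst s p)) _; rewrite mulr0 addr0 mul1r.
have cg s : u0 <= s <= u1 -> {for s, continuous g}.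
  move=> /Hs[s0 /H[[d1 d2 _] _ _]].
  have dc := @der_comp R (@cos R) (fun s => th (s * p)) s _ _ (is_derive_cos _) (ds _ _ _ d2).
  exact: der_continuous (derM (ds _ _ _ d1) dc).
rewrite /Rintegral integral_itv_bndo_bndc; last first.
  apply/measurable_EFinP.
  apply: (@measurable_funS _ _ _ _ `[u0, u1]) => //; first exact: subset_itv_co_cc.
  apply: subspace_continuous_measurable_fun => //.
  apply: continuous_in_subspaceT => s; rewrite inE /= in_itv /=; exact: cg.
rewrite -/(Rintegral _ _ _).
have -> : (3 * C + C ^+ 2) / lam / p = (3 * C + C ^+ 2) / (p * lam).
  by rewrite invfM mulrA mulrAC.
apply: (@van_der_corput R (fun s => A (s * p)) (fun s => dA (s * p) * p)
  (fun s => th (s * p)) (fun s => dth (s * p) * p) (fun s => ddth (s * p) * p * p)) => //.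
- by rewrite /u1 /u0; apply: (@le_trans _ _ (2 - 1)); [rewrite lerB// ?ge_min ?le_max lexx|lra].
- exact: mulr_gt0.
- move=> s /Hs[s0 /H[[d1 d2 d3] _ _]]; split; try exact: ds.
  by apply: is_derive_eq (derM (ds _ _ _ d3) (der_cst s p)) _; rewrite mulr0 addr0.
move=> s su; have [s0 /H[_ [h1 h2 h3 h4] _]] := Hs s su.
have s1 : 1 <= s by move: su; rewrite ge_u0 => /andP[/andP[]].
have sp (x M : R) : s * p * `|x| <= M -> `|x * p| <= M.
  move=> h; rewrite normrM (gtr0_norm p0); apply: le_trans h.
  by rewrite mulrC -mulrA ler_peMl// mulr_ge0// ltW.
split => //.
- by rewrite mulrC ler_pM2r.
- exact: sp.
- rewrite normrM (gtr0_norm p0) mulrCA [leRHS]mulrC ler_pM2r//; exact: sp.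
Qed.

(* Averaging over the dilations [s^E], [1 <= s <= 2], turns the shell integral
   into one-dimensional oscillatory integrals along the rays [t^E w]. *)
Lemma shell_osc C : 0 <= C -> exists2 K, 0 <= K & forall (f : 'rV[R]_d -> R) a b lam,
  0 < a -> 0 < lam -> measurable_fun setT f -> (forall v, `|f v| <= C) ->
  (forall v, ~~ (a <= P v < b) -> f v = 0) ->
  (forall w, P w = 1 -> ray_phase (fun t => f (act E t w)) a b lam C) ->
  `|vint f| <= K / lam * a `^ (\tr E - 1).
Proof.
move=> C0; have [Ca Ca0 Havg] := averaging E.
have [Cs Cs0 Hsh] := shell_inv_le gP mu1.
pose K0 := 3 * C + C ^+ 2; have K00 : 0 <= K0 by rewrite addr_ge0 ?mulr_ge0 ?sqr_ge0.
exists (Ca * K0 * Cs * 2^-1 `^ (\tr E - 1)).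
  by rewrite !mulr_ge0 ?powR_ge0// ltW.
move=> f a b lam a0 lam0 mf fC fout fray.
(* For 1 <= s <= 2 the point s^E v reaches P >= a only if P v >= a / 2, so the majorant starts at a
   / 2; this costs the factor (1/2)^(mu - 1) in the constant. *)
have a20 : 0 < 2^-1 * a by rewrite mulr_gt0.
have fi : vintegrable f.
  apply: (vintegrable_ball gP mf (C := C) (l := b)) => v; case: ltP => Pv; first exact: fC.
  by rewrite fout ?normr0// negb_and -leNgt Pv orbT.
have gi := vintegrableZ (K0 / lam) (vintegrable_shell_inv gP b a20).
apply: (le_trans (Havg f _ C fi fC gi _)).
  move=> v; have [->|v0] := eqVneq v 0.
    under eq_Rintegral do rewrite act0 fout ?(gauge_eq0 gP 0).2// ?leNgt ?a0//.
    rewrite Rintegral_cst// mul0r normr0; apply: mulr_ge0.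
      by rewrite divr_ge0// ltW.
    exact: shell_inv_ge0 gP _ _ _.
  have p0 := gauge_gt0 gP v0; set p := P v in p0.
  pose w := act E p^-1 v; have Pw : P w = 1 by exact: gauge_polar gP _ p0.
  have vE s : 0 < s -> act E s v = act E (s * p) w.
    move=> s0; have pV : 0 < p^-1 by rewrite invr_gt0.
    have e : s * p * p^-1 = s by apply: mulfK; rewrite gt_eqF.
    by rewrite /w (actM E v (mulr_gt0 s0 p0) pV) e.
  have -> : \int[leb1]_(s in `[1, 2]) f (act E s v) =
     \int[leb1]_(s in `[1, 2]) (fun t => if a <= t < b then f (act E t w) else 0) (s * p).
    apply: eq_Rintegral => s; rewrite inE /= in_itv /= => /andP[s1 _].
    have s0 := lt_le_trans ltr01 s1; rewrite vE//; case: ifP => // /negbT h.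
    by rewrite fout// (gauge_homog gP) ?mulr_gt0// Pw mulr1.
  rewrite /shell_inv; case: ifP => [_|/negbT h]; last first.
    rewrite mulr0; under eq_Rintegral.
      move=> s; rewrite inE /= in_itv /= => /andP[s1 s2].
      rewrite ifF; last first.
        apply/negbTE; apply: contra h => /andP[h1 h2]; apply/andP; split.
          rewrite mulrC ler_pdivrMr// mulrC; apply: (le_trans h1).
          by rewrite ler_pM2r.
        by apply: le_lt_trans h2; rewrite ler_peMl// ltW.
      over.
    by rewrite Rintegral_cst// mul0r normr0.
  apply: (@ray_integral_le (fun t => if a <= t < b then f (act E t w) else 0) a b) => //.
  - apply: measurable_fun_ifT => //.
      by apply: measurable_and; [apply: measurable_fun_ler|apply: measurable_fun_ltr] => //;
        exact: measurable_funM.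
    apply: (measurableT_comp mf); apply: measurable_fun_rVP => i.
    under eq_fun do rewrite mxE.
    apply: measurable_sum => j; under eq_fun do rewrite [_^T j i]mxE.
    apply: measurable_funM => //.
    apply: (measurableT_comp (measurable_tpow E i j)); exact: measurable_funM.
  - have [A [dA [th [dth [ddth H]]]]] := fray w Pw.
    exists A, dA, th, dth, ddth => t tab; have [h1 h2 h3] := H t tab; split => // tb.
    by rewrite tb; move/andP: (tab) => [-> _]; exact: h3.
  - by move=> t /negbTE ->.
rewrite vintZ; last exact: (vintegrable_shell_inv gP b a20).
have := Hsh (2^-1 * a) b a20; rewrite powRM ?invr_ge0 ?(ltW a0)// => h.
have -> : Ca * K0 * Cs * 2^-1 `^ (\tr E - 1) / lam * a `^ (\tr E - 1) =
  Ca * (K0 / lam * (Cs * (2^-1 `^ (\tr E - 1) * a `^ (\tr E - 1)))) by ring.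
rewrite ler_pM2l//; apply: ler_wpM2l => //.
by rewrite divr_ge0// ltW.
Qed.

End ShellOscillation.

(** * Chain rule from continuous partial derivatives *)

Section ChainRule.
Context {R : realType} {d : nat}.
Implicit Types (g : 'rV[R]_d -> R) (x y h : 'rV[R]_d).

Lemma der_line g x (j : 'I_d) s : derivable g (x + s *: ev R j) (ev R j) ->
  is_derive s 1 (fun s => g (x + s *: ev R j)) ('D_(ev R j) g (x + s *: ev R j)).
Proof.
have E : (fun u => u^-1 *: (((fun s => g (x + s *: ev R j)) \o shift s) (u *: 1) - g (x + s *: ev R j))) =
  (fun u => u^-1 *: ((g \o shift (x + s *: ev R j)) (u *: ev R j) - g (x + s *: ev R j))).
  apply/funext => u /=; congr (_ *: (g _ - _)).
  by rewrite (_ : u *: 1 = u) ?scalerDl 1?addrCA//; exact: mulr1.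
by move=> dg; split; rewrite /derivable /derive E.
Qed.

Lemma mean_value_line g x (j : 'I_d) (s : R) :
  (forall u : R, `|u| <= `|s| -> derivable g (x + u *: ev R j) (ev R j)) ->
  exists2 u, `|u| <= `|s| &
    g (x + s *: ev R j) - g x = s * 'D_(ev R j) g (x + u *: ev R j).
Proof.
move=> H; pose f (u : R) := g (x + u *: ev R j).
have dH (u : R) : `|u| <= `|s| -> is_derive u 1 f ('D_(ev R j) g (x + u *: ev R j)).
  by move=> /H; exact: der_line.
have f0 : f 0 = g x by rewrite /f scale0r addr0.
have wc a b : (forall u, u \in `[a, b]%R -> `|u| <= `|s|) -> {within `[a, b], continuous f}.
  move=> Hab; apply: continuous_in_subspaceT => u; rewrite inE => /Hab us.
  exact: der_continuous (dH u us).
have [s0|s0] := leP 0 s.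
  have b u : u \in `[0, s]%R -> `|u| <= `|s|.
    by rewrite in_itv /= => /andP[u0 us]; rewrite !ger0_norm.
  have [c /b cs E] := MVT_segment s0 (fun u us => dH u (b u (subset_itv_oo_cc us))) (wc _ _ b).
  by exists c => //; rewrite -f0 -/(f s) E subr0 mulrC.
have b u : u \in `[s, 0]%R -> `|u| <= `|s|.
  by rewrite in_itv /= => /andP[us u0]; rewrite !ler0_norm ?lerN2// ltW.
have [c /b cs E] := MVT_segment (ltW s0) (fun u us => dH u (b u (subset_itv_oo_cc us))) (wc _ _ b).
by exists c => //; rewrite -f0 -/(f s) -opprB E sub0r mulrN opprK mulrC.
Qed.

(** Corners of the path from x to x + h that changes one coordinate at a time. *)
Definition vtrunc (k : nat) h : 'rV[R]_d := \row_j (if (j < k)%N then h 0 j else 0).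

(** The mean value theorem on each leg of the coordinate path, all partial derivatives being close
    to their values at [x]. *)
Lemma partials_approx g x r : ball x r x ->
  (forall y, ball x r y -> forall j, derivable g y (ev R j)) ->
  (forall j, {for x, continuous (fun y => 'D_(ev R j) g y)}) ->
  forall eps, 0 < eps -> \forall h \near (0 : 'rV[R]_d),
  `|g (x + h) - g x - \sum_j h 0 j * 'D_(ev R j) g x| <= eps * \sum_j `|h 0 j|.
Proof.
move=> xr dg cg eps e0.
have r0 : 0 < r by move: xr; rewrite -ball_normE /= subrr normr0.
have : \forall y \near x, forall j : 'I_d, `|'D_(ev R j) g x - 'D_(ev R j) g y| <= eps.
  apply: (@filter_forall _ _ (fun (j : 'I_d) y => `|'D_(ev R j) g x - 'D_(ev R j) g y| <= eps)
    (nbhs x) _) => j.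
  by have /cvgrPdist_le /(_ _ e0) := cg j.
move=> /nbhs_ballP[del /= del0 Hdel].
have m0 : 0 < Num.min r del by rewrite lt_min r0 del0.
apply/nbhs_ballP; exists (Num.min r del) => // h /=; rewrite -ball_normE /= sub0r normrN lt_min => /andP[hr hd].
have tn k (j : 'I_d) u : (k <= j)%N -> `|u| <= `|h 0 j| -> `|vtrunc k h + u *: ev R j| <= `|h|.
  move=> kj uh; apply: norm_rV_le => // i; rewrite !mxE eqxx /=.
  have [->|ij] := eqVneq i j.
    by rewrite ltnNge kj /= add0r mulr1 (le_trans uh)// coord_le_norm.
  by rewrite mulr0 addr0; case: ifP => _; rewrite ?normr0// coord_le_norm.
have step (j : 'I_d) : `|g (x + vtrunc j.+1 h) - g (x + vtrunc j h) - h 0 j * 'D_(ev R j) g x|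
    <= eps * `|h 0 j|.
  have E : x + vtrunc j.+1 h = x + vtrunc j h + h 0 j *: ev R j.
    rewrite -addrA; congr (_ + _); apply/rowP => i; rewrite !mxE eqxx /= ltnS leq_eqVlt.
    have [->|ij] := eqVneq i j; first by rewrite eqxx ltnn /= add0r mulr1.
    by rewrite (negbTE (_ : val i != val j)) //= mulr0 addr0.
  have inb (u : R) : `|u| <= `|h 0 j| -> forall e, `|h| < e -> ball x e (x + vtrunc j h + u *: ev R j).
    move=> us e he; rewrite -ball_normE /= -addrA opprD addNKr normrN.
    exact: le_lt_trans (tn _ _ _ (leqnn _) us) he.
  have [u us] := @mean_value_line g (x + vtrunc j h) j (h 0 j)
    (fun u us => dg _ (inb u us r hr) j).
  rewrite E => ->; rewrite -mulrBr normrM mulrC ler_wpM2r// distrC.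
  by apply: (Hdel _ (inb u us _ hd)).
have -> : g (x + h) - g x = \sum_(j < d) (g (x + vtrunc j.+1 h) - g (x + vtrunc j h)).
  rewrite -(big_mkord predT (fun k => g (x + vtrunc k.+1 h) - g (x + vtrunc k h))).
  rewrite (@telescope_sumr _ 0 d (fun k => g (x + vtrunc k h)))//; congr (g _ - g _).
    by congr (_ + _); apply/rowP => i; rewrite mxE ltn_ord.
  by rewrite -[LHS]addr0; congr (_ + _); apply/rowP => i; rewrite !mxE.
rewrite -sumrB mulr_sumr; apply: le_trans (ler_norm_sum _ _ _) _.
by apply: ler_sum => j _; exact: step.
Qed.

(** Asks for partial derivatives that exist near the point and are continuous at it, which is what
    [Ck_on] provides. *)
Lemma der_chain g (gam : R -> 'rV[R]_d) (dgam : 'I_d -> R) (t r : R) : 0 < r ->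
  (forall y, ball (gam t) r y -> forall j, derivable g y (ev R j)) ->
  (forall j, {for gam t, continuous (fun y => 'D_(ev R j) g y)}) ->
  (forall j, is_derive t 1 (fun s => gam s 0 j) (dgam j)) ->
  is_derive t 1 (fun s => g (gam s)) (\sum_j dgam j * 'D_(ev R j) g (gam t)).
Proof.
move=> r0 dg cg dgamH.
pose D j := 'D_(ev R j) g (gam t).
pose q j (s : R) := s^-1 * (gam (s + t) 0 j - gam t 0 j).
have qE j : q j @ 0^' --> dgam j.
  have [dj <-] := dgamH j.
  suff -> : q j = (fun u : R => u^-1 *: (((fun s => gam s 0 j) \o shift t) (u *: (1 : R)) - gam t 0 j)).
    exact: dj.
  by apply/funext => u; rewrite /q /= /GRing.scale /= mulr1.
suff H : (fun u : R => u^-1 *: (((fun s => g (gam s)) \o shift t) (u *: (1 : R)) - g (gam t))) @ 0^' -->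
    \sum_j dgam j * D j.
  by split; [apply/cvg_ex; exists (\sum_j dgam j * D j)|apply/cvg_lim].
have lin : (fun u => \sum_j q j u * D j) @ 0^' --> \sum_j dgam j * D j.
  apply: cvg_big => [|j _]; first by apply: add_continuous.
  by apply: cvgM; [exact: qE|exact: cvg_cst].
apply/cvgrPdist_le => e e0.
(* Near 0 the difference quotients q_j are at most |dgam j| + 1, so [S] dominates their sum and the
   precision e / 2 / S of the linear approximation costs at most e / 2. *)
pose S := \sum_j (`|dgam j| + 1) + 1.
have S0 : 0 < S by rewrite ltr_pwDr// sumr_ge0// => j _; rewrite addr_ge0.
have e2 : 0 < e / 2 by rewrite divr_gt0.
have eS : 0 < e / 2 / S by rewrite divr_gt0.
have /nbhs_ballP[del /= del0 Hdel] := partials_approx (ballxx (gam t) r0) dg cg eS.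
have near1 : \forall u \near (0 : R)^', forall j, `|dgam j - q j u| <= 1.
  apply: (@filter_forall _ _ (fun j u => `|dgam j - q j u| <= 1)) => j.
  by have /cvgrPdist_le /(_ _ ltr01) := qE j.
have near2 : \forall u \near (0 : R)^', forall j, `|gam (u + t) 0 j - gam t 0 j| <= del / 2.
  apply: (@filter_forall _ _ (fun j u => `|gam (u + t) 0 j - gam t 0 j| <= del / 2)) => j.
  apply: nbhs_dnbhs.
  have c := der_continuous (dgamH j).
  have /cvgrPdist_le /(_ (del / 2)) : (fun u => gam (u + t) 0 j) @ (0 : R) --> gam t 0 j.
    rewrite -[X in _ --> X](_ : (fun s => gam s 0 j) (0 + t) = _); last by rewrite add0r.
    apply: (@continuous_comp _ _ _ (fun u : R => u + t) (fun s => gam s 0 j)).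
      by apply: cvgD; [exact: cvg_id|exact: cvg_cst].
    by rewrite add0r.
  rewrite divr_gt0// => /(_ isT); apply: filterS => u; by rewrite distrC.
have /cvgrPdist_le /(_ _ e2) near3 := lin.
near=> u.
have u0 : u != 0 by near: u; exact: nbhs_dnbhs_neq.
pose h := gam (u + t) - gam t.
have hj j : h 0 j = u * q j u by rewrite /q mulrA mulfV// mul1r !mxE.
have hdel : ball (0 : 'rV[R]_d) del h.
  rewrite -ball_normE /= sub0r normrN; apply: (@le_lt_trans _ _ (del / 2)); last by lra.
  apply: norm_rV_le => [|j]; first by rewrite divr_ge0// ltW.
  by rewrite !mxE; move: j; near: u; exact: near2.
have := Hdel h hdel; rewrite /= /GRing.scale /= mulr1.
rewrite (_ : gam t + h = gam (u + t)); last by rewrite addrC subrK.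
under eq_bigr do rewrite hj; under [X in _ <= _ * X]eq_bigr do rewrite hj normrM.
rewrite -mulr_sumr => A.
have qb j : `|q j u| <= `|dgam j| + 1.
  have : `|dgam j - q j u| <= 1 by move: j; near: u; exact: near1.
  by have := ler_normB (dgam j) (dgam j - q j u); rewrite subKr; lra.
have B : `|u^-1 * (g (gam (u + t)) - g (gam t)) - \sum_j q j u * D j| <= e / 2.
  have -> : u^-1 * (g (gam (u + t)) - g (gam t)) - \sum_j q j u * D j =
      u^-1 * (g (gam (u + t)) - g (gam t) - \sum_j (u * q j u) * D j).
    rewrite [RHS]mulrBr mulr_sumr; congr (_ - _); apply: eq_bigr => j _.
    by rewrite !mulrA mulVf// mul1r.
  rewrite normrM normfV mulrC ler_pdivrMr ?normr_gt0//.
  apply: (le_trans A); rewrite mulrCA [leRHS]mulrC ler_wpM2l//.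
  rewrite -[leRHS](divfK (lt0r_neq0 S0)) ler_wpM2l ?(ltW eS)//.
  rewrite /S ler_wpDr//; apply: ler_sum => j _; exact: qb.
have C : `|\sum_j dgam j * D j - \sum_j q j u * D j| <= e / 2 by near: u; exact: near3.
apply: le_trans (ler_distD (\sum_j q j u * D j) _ _) _.
by rewrite [X in _ + X]distrC; lra.
Unshelve. all: by end_near. Qed.


Lemma ball0P (r : R) x : ball (0 : 'rV[R]_d) r x <-> `|x| < r.
Proof. by rewrite -ball_normE /ball_ /= sub0r normrN. Qed.

Lemma derive1_val (f : R -> R) (t a : R) : is_derive t 1 f a -> f^`() t = a.
Proof. by move=> [_ <-]; rewrite derive1E. Qed.

Lemma coordB x y j : (x - y) 0 j = x 0 j - y 0 j.
Proof. by rewrite !mxE. Qed.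

Lemma near_ball_act E (w : 'rV[R]_d) (t r : R) : 0 < t -> ball (0 : 'rV[R]_d) r (act E t w) ->
  \forall s \near t, 0 < s /\ ball (0 : 'rV[R]_d) r (act E s w).
Proof.
move=> t0 /ball0P tr; pose e := r - `|act E t w|.
have e0 : 0 < e by rewrite subr_gt0.
have H : \forall s \near t, forall j, `|act E t w 0 j - act E s w 0 j| <= e / 2.
  apply: (@filter_forall _ _ (fun (j : 'I_d) s => `|act E t w 0 j - act E s w 0 j| <= e / 2)
    (nbhs t) _) => j.
  have /cvgrPdist_le := der_continuous (der_act E w j t0); apply; exact: divr_gt0.
near=> s; split; first by near: s; exact: lt_nbhsr.
apply: (ball0P _ _).2; rewrite -[act E s w](subrK (act E t w)) (le_lt_trans (ler_normD _ _))//.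
apply: (@le_lt_trans _ _ (e / 2 + `|act E t w|)); last by rewrite /e; lra.
rewrite lerD2r; apply: norm_rV_le => [|j]; first by rewrite divr_ge0// ltW.
by rewrite coordB distrC; move: j; near: s; exact: H.
Unshelve. all: by end_near. Qed.

Lemma der_ray1 f E (w : 'rV[R]_d) (t r : R) l : 0 < t -> (0 < l)%N -> Ck_on r l f ->
  ball (0 : 'rV[R]_d) r (act E t w) ->
  is_derive t 1 (fun s => f (act E s w))
    (\sum_j (t^-1 * (act E t w *m E^T) 0 j) * 'D_(ev R j) f (act E t w)).
Proof.
move=> t0 l0 Hf tr.
have r0 : 0 < r - `|act E t w| by move: tr => /ball0P; rewrite subr_gt0.
apply: (der_chain r0) => [y yr j|j|j].
- have yb : ball (0 : 'rV[R]_d) r y.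
    have yr' : `|act E t w - y| < r - `|act E t w| by move: yr; rewrite -ball_normE.
    apply/ball0P; rewrite -(subrK (act E t w) y); apply: (le_lt_trans (ler_normD _ _)).
    by rewrite -ltrBrDr distrC.
  by have [_ /(_ l0 j)] := Hf [::] (leq0n l) y yb.
- by have [] := Hf [:: j] l0 _ tr.
- exact: der_act.
Qed.

(** [derive1n] is total, so the bounds in [strong_subhomog] control the function only once its
    values are shown to be true derivatives; C^2 regularity and the smoothness of t^E w give
    that. *)
Lemma der_ray2 f E (w : 'rV[R]_d) (t r : R) : 0 < t -> Ck_on r 2 f ->
  ball (0 : 'rV[R]_d) r (act E t w) ->
  let phi s := f (act E s w) in
  is_derive t 1 phi (derive1n 1 phi t) /\
  is_derive t 1 (derive1n 1 phi) (derive1n 2 phi t).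
Proof.
move=> t0 Hf tr phi.
have d1 s : 0 < s -> ball (0 : 'rV[R]_d) r (act E s w) ->
    is_derive s 1 phi (\sum_j (s^-1 * (act E s w *m E^T) 0 j) * 'D_(ev R j) f (act E s w)).
  by move=> s0 sr; exact: (der_ray1 s0 _ Hf sr).
have h1 := d1 t t0 tr.
have e1 : derive1n 1 phi t = _ := derive1_val h1.
split; first by rewrite e1.
suff exdd : exists dd, is_derive t 1 (derive1n 1 phi) dd.
  case: exdd => dd Hdd; have e2 : derive1n 2 phi t = dd := derive1_val Hdd.
  rewrite e2; exact: Hdd.
have Hj j : Ck_on r 1 (fun x => 'D_(ev R j) f x).
  move=> js sj x xr; have := Hf (rcons js j); rewrite size_rcons => /(_ sj x xr).
  rewrite /pder foldr_rcons -/(pder js (fun x => 'D_(ev R j) f x)) => -[c dc]; split => //.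
have r0 : 0 < r - `|act E t w| by move: tr => /ball0P; rewrite subr_gt0.
have da j : is_derive t 1 (fun s => (act E s w *m E^T) 0 j)
    (\sum_i E j i * (t^-1 * (act E t w *m E^T) 0 i)).
  rewrite (_ : (fun s => _) = fun s => \sum_i E j i * act E s w 0 i); last first.
    by apply/funext => s; rewrite mxE; apply: eq_bigr => i _; rewrite mulrC; congr (_ * _); rewrite mxE.
  by apply: der_sum => i; apply: derZ; exact: der_act.
have di : is_derive t 1 (fun s : R => s^-1) (- t ^- 2 *: (1 : R)).
  by apply: (@is_deriveV _ id t 1 1); rewrite gt_eqF.
eexists; apply: (near_eq_is_derive _ (der_sum (fun j => derM (derM di (da j))
   (der_ray1 t0 (ltn0Sn 0) (Hj j) tr)))).
near=> s; have [s0 sr] : 0 < s /\ ball (0 : 'rV[R]_d) r (act E s w).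
  by near: s; exact: near_ball_act.
exact/esym/derive1_val/d1.
Unshelve. all: by end_near. Qed.

End ChainRule.

(** * Points of positive type *)

Section LocalPositive.
Context {R : realType} {d : nat}.

Lemma expR_lip (a b : R) : 0 <= a -> 0 <= b -> `|expR (- a) - expR (- b)| <= `|a - b|.
Proof.
wlog ab : a b / a <= b => [H a0 b0|a0 b0].
  by have [h|/ltW h] := leP a b; [exact: H|rewrite distrC (distrC a); exact: H].
rewrite ger0_norm ?subr_ge0 ?ler_expR ?lerN2// (distrC a) ger0_norm ?subr_ge0//.
have -> : expR (- a) - expR (- b) = expR (- a) * (1 - expR (- (b - a))).
  by rewrite mulrBr mulr1 -expRD; congr (_ - expR _); ring.
have h : 1 - expR (- (b - a)) <= b - a by have := expR_ge1Dx (- (b - a)); lra.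
have h0 : 0 <= 1 - expR (- (b - a)) by rewrite subr_ge0 -expR0 ler_expR; lra.
apply: le_trans h; rewrite ler_piMl// -expR0 ler_expR; lra.
Qed.

Lemma cos_lip (a b : R) : `|cos a - cos b| <= `|a - b|.
Proof.
wlog ab : a b / a <= b => [H|].
  by have [h|/ltW h] := leP a b; [exact: H|rewrite distrC (distrC a); exact: H].
have cw : {within `[a, b], continuous (@cos R)}.
  by apply: continuous_in_subspaceT => x _; exact: continuous_cos.
have [c _ E] := MVT_segment ab (fun x _ => is_derive_cos x) cw.
rewrite distrC E normrM normrN (distrC a) -[leRHS]mul1r.
by rewrite ler_wpM2r// norm_sin_le1.
Qed.

Lemma damped_cos_lip (a b u v : R) : 0 <= a -> 0 <= b ->
  `|expR (- a) * cos u - expR (- b) * cos v| <= `|a - b| + `|u - v|.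
Proof.
move=> a0 b0.
have -> : expR (- a) * cos u - expR (- b) * cos v =
  (expR (- a) - expR (- b)) * cos u + expR (- b) * (cos u - cos v) by ring.
apply: le_trans (ler_normD _ _) _; rewrite !normrM; apply: lerD.
  by rewrite -[leRHS]mulr1 ler_pM// ?expR_lip// norm_cos_le1.
rewrite -[leRHS]mul1r ler_pM// ?cos_lip// ger0_norm ?expR_ge0//.
by rewrite -expR0 ler_expR oppr_le0.
Qed.

(** Subhomogeneity on the compact set P = 1, with t = P xi. *)
Lemma subhomog_small (P f : 'rV[R]_d -> R) (E : 'M[R]_d) eps : gauge P E ->
  f 0 = 0 -> subhomog f E -> 0 < eps ->
  exists2 tau, 0 < tau & forall xi, P xi < tau -> `|f xi| <= eps * P xi.
Proof.
move=> gP f0 [_ H] e0; have [tau [tau0 Ht]] := H eps e0 _ (gauge_compact gP).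
exists tau => // xi Px; have [->|x0] := eqVneq xi 0.
  by rewrite f0 normr0 mulr_ge0 ?(ltW e0)// (gauge_ge0 gP).
have P0 := gauge_gt0 gP x0.
rewrite -{1}(actK E xi P0) Ht ?P0//; exact: gauge_polar gP _ P0.
Qed.

Lemma natr_powN (n : nat) (x y : R) : (0 < n)%N -> 0 <= y ->
  (y / n%:R) `^ x = y `^ x * n%:R `^ (- x).
Proof.
move=> n0 y0; rewrite powRM ?invr_ge0//; congr (_ * _).
by rewrite /powR invr_eq0 pnatr_eq0 gtn_eqF// lnV ?posrE ?ltr0n// mulrN mulNr.
Qed.

Lemma vint_exp_gauge (P : 'rV[R]_d -> R) E c (n : nat) : gauge P E -> 0 < c -> (0 < n)%N ->
  vint (fun v => expR (- (n%:R * c * P v))) = n%:R `^ (- \tr E) * vint (fun v => expR (- (c * P v))).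
Proof.
move=> gP c0 n0; have nR : 0 < n%:R :> R by rewrite ltr0n.
rewrite -(vint_act_div E nR (vintegrable_exp_gauge gP c0)); apply: eq_vint => v.
by rewrite (gauge_homog gP)// mulrA [c * _]mulrC.
Qed.

Lemma measurable_dot (y : 'rV[R]_d) : measurable_fun setT (fun xi => dot y xi).
Proof.
apply: measurable_sum => i; apply: measurable_funM => //; exact: measurable_coor.
Qed.

Variables (P Q Rt Qt : 'rV[R]_d -> R) (E : 'M[R]_d).

(* Local integrand and its homogeneous model; [c = 0] and [c = pi / 2] give
   real and imaginary parts, and [y] is the displacement [x - n alpha]. *)
Definition loc (n : nat) (y : 'rV[R]_d) (c : R) xi :=
  expR (- (n%:R * (P xi + Rt xi))) * cos (n%:R * (Q xi + Qt xi) + dot y xi + c).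

Definition hom (n : nat) (y : 'rV[R]_d) (c : R) xi :=
  expR (- (n%:R * P xi)) * cos (n%:R * Q xi + dot y xi + c).

Hypothesis gP : gauge P E.
Hypothesis mQ : measurable_fun setT Q.
Hypotheses (Rt0 : Rt 0 = 0) (Qt0 : Qt 0 = 0).
Hypotheses (sR : subhomog Rt E) (sQ : subhomog Qt E).
Local Notation mu := (\tr E).

Lemma measurable_hom n y c : measurable_fun setT (hom n y c).
Proof.
apply: measurable_funM; first exact: measurable_exp_gauge gP _.
have m : measurable_fun setT (fun xi => n%:R * Q xi + dot y xi + c).
  apply: measurable_funD; last exact: measurable_cst.
  apply: measurable_funD; last exact: measurable_dot.
  by apply: measurable_funM => //; exact: measurable_cst.
exact: measurableT_comp (continuous_measurable_fun (@continuous_cos R)) m.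
Qed.

Lemma hom_le n y c xi : `|hom n y c xi| <= expR (- (n%:R * P xi)).
Proof. by rewrite normrM ger0_norm ?expR_ge0// ler_piMr ?expR_ge0// norm_cos_le1. Qed.

Lemma vintegrable_hom n y c : (0 < n)%N -> vintegrable (hom n y c).
Proof.
move=> n0; have nR : 0 < n%:R :> R by rewrite ltr0n.
exact: vintegrable_le (measurable_hom n y c) (vintegrable_exp_gauge gP nR) (hom_le n y c).
Qed.

(** There P + Rt >= P / 2, so the local integrand is dominated by exp(-n P / 2). *)
Definition pos_radius del := forall xi, P xi < del -> `|Rt xi| <= 2^-1 * P xi.

Lemma pos_radius_ex : exists2 del, 0 < del & pos_radius del.
Proof. by apply: (subhomog_small gP Rt0 sR); rewrite invr_gt0. Qed.

Variable del : R.
Hypotheses (del0 : 0 < del) (delP : pos_radius del).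
(** Nothing in this section makes [Rt] and [Qt] measurable; the assumption is discharged by
    [measurable_loc], where the integrand is recognised as coming from a power of [fhat]. *)
Hypothesis mloc : forall n y c, measurable_fun setT (cut (fun xi => P xi < del) (loc n y c)).

Lemma loc_le n y c xi :
  `|cut (fun xi => P xi < del) (loc n y c) xi| <= expR (- (n%:R * 2^-1 * P xi)).
Proof.
rewrite /cut; case: ifP => [h|_]; last by rewrite normr0 expR_ge0.
rewrite normrM ger0_norm ?expR_ge0// -[leRHS]mulr1 ler_pM ?norm_cos_le1// ler_expR lerN2.
rewrite -mulrA ler_wpM2l//; have := delP h; rewrite ler_norml => /andP[h1 _]; lra.
Qed.

Lemma vintegrable_loc n y c : (0 < n)%N ->
  vintegrable (cut (fun xi => P xi < del) (loc n y c)).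
Proof.
move=> n0; have nR : 0 < n%:R * 2^-1 :> R by rewrite mulr_gt0 ?ltr0n// invr_gt0.
exact: vintegrable_le (mloc n y c) (vintegrable_exp_gauge gP nR) (loc_le n y c).
Qed.

(** Uniform in the displacement; it disposes of the positive points whose order exceeds the
    minimum. *)
Lemma local_pos_bound : exists2 C, 0 <= C & forall n y c, (0 < n)%N ->
  `|vint (cut (fun xi => P xi < del) (loc n y c))| <= C * n%:R `^ (- mu).
Proof.
exists (vint (fun v => expR (- (2^-1 * P v)))); first by apply: vint_ge0 => v; exact: expR_ge0.
move=> n y c n0; have nR : 0 < n%:R * 2^-1 :> R by rewrite mulr_gt0 ?ltr0n// invr_gt0.
apply: (le_trans (vint_norm_le (mloc n y c) (vintegrable_exp_gauge gP nR) (loc_le n y c))).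
by rewrite (vint_exp_gauge gP)// ?invr_gt0// mulrC.
Qed.

Lemma local_pos eps : 0 < eps -> exists N, forall n y c, (N <= n)%N ->
  `|vint (cut (fun xi => P xi < del) (loc n y c)) - vint (hom n y c)| <= eps * n%:R `^ (- mu).
Proof.
move=> e0; pose W := vint (fun v => expR (- (4^-1 * P v))).
have W0 : 0 <= W by apply: vint_ge0 => v; exact: expR_ge0.
pose V := gauge_vol P 1; have V0 : 0 <= V by exact: gauge_vol_ge0.
(* On P >= M / n one half of the damping exp(-n P / 2) gives exp(-M / 4), and the other half, exp(-n
   P / 4), integrates to W n^-mu; e^x >= x provides such an [M]. *)
have [M M1 HM] : exists2 M, 1 <= M & 2 * expR (- (M / 4)) * W <= eps / 2.
  pose M := 1 + 16 * (W + 1) / eps.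
  have M1 : 1 <= M by rewrite lerDl divr_ge0 ?mulr_ge0 ?addr_ge0// ltW.
  exists M => //; have M0 := lt_le_trans ltr01 M1.
  have eM : M / 4 <= expR (M / 4) by have := expR_ge1Dx (M / 4); lra.
  rewrite expRN mulrAC ler_pdivrMr ?expR_gt0//.
  apply: (@le_trans _ _ (eps / 2 * (M / 4))); last by rewrite ler_wpM2l// ltW// divr_gt0.
  have : eps * M = eps + 16 * (W + 1) by rewrite /M; field; rewrite gt_eqF.
  lra.
have M0 := lt_le_trans ltr01 M1.
(* The core P < M / n has volume V M^mu n^-mu and the integrands differ there by at most 2 e1 M; V +
   1 avoids a division by zero. *)
pose e1 := eps / (4 * M * M `^ mu * (V + 1)).
have den0 : 0 < 4 * M * M `^ mu * (V + 1).
  by rewrite !mulr_gt0 ?powR_gt0// ltr_wpDl.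
have e10 : 0 < e1 by rewrite divr_gt0.
have [tR tR0 HR] := subhomog_small gP Rt0 sR e10.
have [tQ tQ0 HQ] := subhomog_small gP Qt0 sQ e10.
pose tau := Num.min del (Num.min tR tQ).
have tau0 : 0 < tau by rewrite !lt_min del0 tR0 tQ0.
exists (Num.Def.truncn (M / tau)).+1 => n y c Nn.
have n0 : (0 < n)%N by exact: leq_trans Nn.
have nR : 0 < n%:R :> R by rewrite ltr0n.
have Mn : M / n%:R < tau.
  rewrite ltr_pdivrMr// mulrC -ltr_pdivrMr//.
  apply: (lt_le_trans (truncnS_gt _)); by rewrite ler_nat.
rewrite -vintB; [|exact: vintegrable_loc|exact: vintegrable_hom].
pose G v := 2 * e1 * M * cut (fun xi => P xi < M / n%:R) (fun=> 1) v +
  2 * expR (- (M / 4)) * expR (- (n%:R * 4^-1 * P v)).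
have i1 := vintegrableZ (2 * e1 * M) (vintegrable_ball1 gP (M / n%:R)).
have n4 : 0 < n%:R * 4^-1 :> R by rewrite mulr_gt0// invr_gt0.
have i2 := vintegrableZ (2 * expR (- (M / 4))) (vintegrable_exp_gauge gP n4).
have dG v : `|cut (fun xi => P xi < del) (loc n y c) v - hom n y c v| <= G v.
  have Pv := gauge_ge0 gP v.
  have [nP|nP] := ltP (P v) (M / n%:R).
    have Pt : P v < tau by exact: lt_trans nP Mn.
    have [Pd PR PQ] : [/\ P v < del, P v < tR & P v < tQ].
      by move: Pt; rewrite !lt_min => /andP[-> /andP[-> ->]].
    rewrite /G /cut Pd nP mulr1 /loc /hom.
    apply: (@le_trans _ _ (2 * e1 * M)); last first.
      by rewrite lerDl !mulr_ge0 ?expR_ge0.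
    apply: (le_trans (damped_cos_lip _ _ _ _)).
    - rewrite mulr_ge0//; have := delP Pd; rewrite ler_norml => /andP[h1 _]; lra.
    - by rewrite mulr_ge0.
    have -> : n%:R * (P v + Rt v) - n%:R * P v = n%:R * Rt v by ring.
    have -> : n%:R * (Q v + Qt v) + dot y v + c - (n%:R * Q v + dot y v + c) = n%:R * Qt v by ring.
    rewrite !normrM (ger0_norm (ltW nR)).
    have nPM : n%:R * P v <= M by move: nP; rewrite ltr_pdivlMr// mulrC => /ltW.
    have hb (x : R) : `|x| <= e1 * P v -> n%:R * `|x| <= e1 * M.
      move=> hx; apply: (@le_trans _ _ (n%:R * (e1 * P v))); first by rewrite ler_pM2l.
      by rewrite mulrCA ler_pM2l.
    have := hb _ (HR v PR); have := hb _ (HQ v PQ); lra.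
  have h4 : expR (- (n%:R * 2^-1 * P v)) <= expR (- (M / 4)) * expR (- (n%:R * 4^-1 * P v)).
    rewrite -expRD ler_expR; move: nP; rewrite ler_pdivrMr// => nP.
    rewrite [P v * _]mulrC in nP; lra.
  have h5 : expR (- (n%:R * P v)) <= expR (- (n%:R * 2^-1 * P v)).
    by rewrite ler_expR lerN2 ler_wpM2r// ler_piMr// ?invf_le1 ?ler1n// ltW.
  rewrite /G [in leRHS]/cut ltNge nP /= mulr0 add0r.
  apply: le_trans (ler_normB _ _) _.
  have := loc_le n y c v; have := hom_le n y c v; lra.
have mD : measurable_fun setT (fun v => cut (fun xi => P xi < del) (loc n y c) v - hom n y c v).
  by apply: measurable_funB; [exact: mloc|exact: measurable_hom].
apply: (le_trans (vint_norm_le mD (vintegrableD i1 i2) dG)).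
rewrite vintD// (vintZ _ (vintegrable_ball1 gP (M / n%:R))) (vintZ _ (vintegrable_exp_gauge gP n4)).
rewrite (vint_exp_gauge gP)// ?invr_gt0// -/W -/(gauge_vol P _) (gauge_volE gP) ?divr_gt0//.
rewrite natr_powN// ?(ltW M0)// -/V.
have p0 : 0 <= n%:R `^ (- mu) by exact: powR_ge0.
have A : 2 * e1 * M * (M `^ mu * V) <= eps / 2.
  have -> : 2 * e1 * M * (M `^ mu * V) = eps / 2 * (V / (V + 1)).
    by rewrite /e1; field; rewrite !gt_eqF ?powR_gt0 ?ltr_wpDl.
  apply: ler_piMr; first by rewrite divr_ge0// ltW.
  by rewrite ler_pdivrMr ?ltr_wpDl// mul1r lerDl.
have -> : 2 * e1 * M * (M `^ mu * n%:R `^ (- mu) * V) +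
  2 * expR (- (M / 4)) * (n%:R `^ (- mu) * W) =
  (2 * e1 * M * (M `^ mu * V) + 2 * expR (- (M / 4)) * W) * n%:R `^ (- mu) by ring.
by rewrite ler_wpM2r//; lra.
Qed.

End LocalPositive.

(** * Points of imaginary type *)

Section ImaginaryRays.
Context {R : realType} {d : nat}.
Implicit Types (w y z v : 'rV[R]_d).

Lemma dot_norm_le y v : `|dot y v| <= d%:R * (`|y| * `|v|).
Proof.
apply: le_trans (ler_norm_sum _ _ _) _.
have -> : d%:R * (`|y| * `|v|) = \sum_(i < d) `|y| * `|v|.
  by rewrite sumr_const card_ord mulr_natl.
by apply: ler_sum => i _; rewrite normrM ler_pM// coord_le_norm.
Qed.

Lemma dot_mulmx_tr y v (E : 'M[R]_d) : dot y (v *m E^T) = dot (y *m E) v.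
Proof.
rewrite /dot; under eq_bigr do rewrite mxE mulr_sumr.
rewrite exchange_big /=; apply: eq_bigr => j _.
by rewrite mxE mulr_suml; apply: eq_bigr => i _; rewrite mxE; ring.
Qed.

Lemma der_dot_act (E : 'M[R]_d) z w (t : R) : 0 < t ->
  is_derive t 1 (fun s => dot z (act E s w)) (t^-1 * dot (z *m E) (act E t w)).
Proof.
move=> t0; apply: is_derive_eq (der_sum (fun i => derZ (z 0 i) (der_act E w i t0))) _.
rewrite -dot_mulmx_tr mulr_sumr; apply: eq_bigr => i _; ring.
Qed.

Lemma cont_act (E : 'M[R]_d) w (t : R) : 0 < t -> {for t, continuous (fun s => act E s w)}.
Proof.
move=> t0; apply/cvgrPdist_le => e e0.
have H : \forall s \near t, forall j, `|act E t w 0 j - act E s w 0 j| <= e.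
  apply: (@filter_forall _ _ (fun (j : 'I_d) s => `|act E t w 0 j - act E s w 0 j| <= e)
    (nbhs t) _) => j.
  by have /cvgrPdist_le := der_continuous (der_act E w j t0); apply.
near=> s; apply: norm_rV_le => [|j]; first exact: ltW.
by rewrite coordB; move: j; near: s; exact: H.
Unshelve. all: by end_near. Qed.

(** Lower bound: a small Q w forces w near 0, where P < 1. Upper bound: compactness of the set P =
    1. *)
Lemma sphere_bounds (P Q : 'rV[R]_d -> R) (E E' : 'M[R]_d) : gauge P E -> gauge Q E' ->
  exists m M, [/\ 0 < m, 0 < M & forall w, P w = 1 -> m <= Q w <= M].
Proof.
move=> gP gQ.
have [del /= del0 Hdel] : exists2 del, 0 < del & forall x : 'rV[R]_d, `|x| < del -> P x < 1.
  have P0 : P 0 = 0 by apply/(gauge_eq0 gP).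
  have /cvgrPdist_lt /(_ _ ltr01) /nbhs_ballP[del /= del0 H] := gauge_cont gP (x := 0).
  exists del => // x /ball0P /H /=; rewrite P0 sub0r normrN.
  exact: le_lt_trans (ler_norm _).
have [m m0 Hm] := gauge_small gQ del0.
have cK : compact (Q @` [set xi | P xi = 1]).
  apply: continuous_compact; last exact: gauge_compact gP.
  by apply: continuous_subspaceT; exact: gauge_cont gQ.
have [M [_ HM]] := compact_bounded cK.
have M1 : 0 < `|M| + 1 by rewrite ltr_wpDl.
exists m, (`|M| + 1); split => //.
move=> w Pw; apply/andP; split.
  by rewrite leNgt; apply/negP => /Hm /Hdel; rewrite Pw ltxx.
apply: le_trans (ler_norm _) _; apply: (HM (`|M| + 1)).
  by rewrite ltr_pwDr// ler_norm.
by exists w.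
Qed.

Lemma expR_inv_bound (x : R) : 0 <= x -> x * expR (- (x / 2)) <= 2.
Proof.
move=> x0; rewrite expRN ler_pdivrMr ?expR_gt0//.
by have := expR_ge1Dx (x / 2); lra.
Qed.

(** [expR (k * ln t)] stands for t^k; since [ln] undoes [expR] everywhere, no sign condition on [t]
    arises. *)
Lemma act_rescale (E : 'M[R]_d) (k t : R) w : k != 0 ->
  act E t w = act (k^-1 *: E) (expR (k * ln t)) w.
Proof. by move=> k0; rewrite /act /tpow expRK scalerA mulrAC mulfV// mul1r. Qed.

Lemma strong_subhomog_sub (f : 'rV[R]_d -> R) (E : 'M[R]_d) l :
  strong_subhomog f E l -> subhomog f E.
Proof.
move=> [cE [_ H]]; split => // eps e0 K cK; have [tau [tau0 Ht]] := H eps e0 K cK.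
exists tau; split => // t tt xi Kxi.
by have := Ht t tt xi Kxi 0%N (leq0n l); rewrite expr0 mul1r.
Qed.

Variables (Q Qt Rq Rt : 'rV[R]_d -> R) (E : 'M[R]_d) (k : R).
Local Notation P := (fun xi => `|Q xi|).
Hypothesis gP : gauge P E.
Hypothesis cQ : continuous Q.
Hypothesis k1 : 1 < k.
Hypothesis gR : gauge Rq (k^-1 *: E).
Hypotheses (Rt0 : Rt 0 = 0) (Qt0 : Qt 0 = 0).
Hypothesis sQ : strong_subhomog Qt E 2.
Hypothesis sR : strong_subhomog Rt (k^-1 *: E) 1.
Local Notation mu := (\tr E).
Hypothesis mu1 : mu < 1.

Let k0 : 0 < k. Proof. exact: lt_trans k1. Qed.

(** Only |Q| is assumed homogeneous. Along the ray |Q| = t > 0, so by the intermediate value theorem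
    [Q] cannot change sign there. *)
Lemma phase_ray w t : P w = 1 -> 0 < t -> Q (act E t w) = t * Q w.
Proof.
move=> Pw t0.
have Qa s : 0 < s -> `|Q (act E s w)| = s.
  by move=> s0; rewrite (gauge_homog gP)// Pw mulr1.
have cc a b : 0 < a -> {within `[a, b], continuous (fun s => Q (act E s w))}.
  move=> a0; apply: continuous_in_subspaceT => s; rewrite inE /= in_itv /= => /andP[as_ _].
  apply: (@continuous_comp _ _ _ (fun s => act E s w) Q); last exact: cQ.
  by apply: cont_act; exact: lt_le_trans as_.
have nz a b : 0 < a -> a <= b ->
    ~ (Num.min (Q (act E a w)) (Q (act E b w)) <= 0 <= Num.max (Q (act E a w)) (Q (act E b w))).
  move=> a0 ab h; have [s] := IVT ab (cc a b a0) h.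
  rewrite in_itv /= => /andP[as_ _] Qs; have s0 := lt_le_trans a0 as_.
  by have := Qa s s0; rewrite Qs normr0 => s00; rewrite -s00 ltxx in s0.
have same a b : 0 < a -> a <= b -> (0 <= Q (act E a w)) = (0 <= Q (act E b w)).
  move=> a0 ab; have H := nz a b a0 ab; rewrite ge_min le_max in H.
  by apply/idP/idP => h; rewrite leNgt; apply/negP => h'; apply: H;
    rewrite (ltW h') h ?orbT.
have sgn : (0 <= Q w) = (0 <= Q (act E t w)).
  have [t1|/ltW t1] := leP 1 t; first by rewrite -{1}(act1 E w); exact: same.
  by rewrite -{1}(act1 E w); apply/esym; exact: same.
have := Qa t t0; have := Pw; case: (leP 0 (Q w)) sgn => Qw /esym.
  by move=> h; rewrite !ger0_norm// => -> ->; rewrite mulr1.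
move=> /negbT; rewrite -ltNge => h; rewrite !ltr0_norm//; nra.
Qed.

Lemma gauge_ray w t : P w = 1 -> 0 < t -> Rq (act E t w) = expR (k * ln t) * Rq w.
Proof. by move=> Pw t0; rewrite (act_rescale _ _ _ (lt0r_neq0 k0)) (gauge_homog gR)// expR_gt0. Qed.

(** For t <= 1 the ray is bounded and a factor 1 / t remains; for t >= 1, |t^E w| <= C t^mu <= C t,
    and here mu < 1 enters. Away from t = 0 the linear phase thus has slope O(|y|), to be compared
    with n. *)
Lemma linear_ray : exists2 G, 0 <= G & forall w y (t : R), P w = 1 -> 0 < t ->
  let l1 s := s^-1 * dot (y *m E) (act E s w) in
  let l2 := - t ^- 2 * dot (y *m E) (act E t w) + t^-1 * (t^-1 * dot (y *m E *m E) (act E t w)) in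
  [/\ is_derive t 1 l1 l2, `|l1 t| <= G * `|y| * (1 + t^-1) &
      t * `|l2| <= G * `|y| * (1 + t^-1)].
Proof.
have [C C0 HC] := gauge_norm_le gP.
pose T := \sum_i \sum_j `|E i j|.
have T0 : 0 <= T by apply: sumr_ge0 => i _; apply: sumr_ge0.
have ET i j : `|E i j| <= T.
  rewrite /T (bigD1 i)//= (bigD1 j)//= -addrA lerDl.
  by rewrite addr_ge0// sumr_ge0// => ? _; apply: sumr_ge0.
pose D := d%:R * T; have D0 : 0 <= D by rewrite mulr_ge0.
have yE y : `|y *m E| <= D * `|y| by exact: norm_mulmx_le.
pose G1 := d%:R * D * C; have G10 : 0 <= G1 by rewrite !mulr_ge0// ltW.
exists (G1 + D * G1); first by rewrite addr_ge0// mulr_ge0.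
move=> w y t Pw t0 l1 l2.
have ti : 0 < t^-1 by rewrite invr_gt0.
have gam : t^-1 * `|act E t w| <= C * (1 + t^-1).
  have Pt : P (act E t w) = t by rewrite (gauge_homog gP)// Pw mulr1.
  have [h1 h2] := HC (act E t w); rewrite Pt in h1 h2.
  have [t1|/ltW t1] := leP t 1.
    rewrite mulrC; apply: ler_pM; rewrite ?h1 ?lerDr// ltW//.
  apply: (@le_trans _ _ (t^-1 * (C * t `^ mu))); first by rewrite ler_pM2l// h2.
  rewrite mulrCA ler_pM2l//; apply: (@le_trans _ _ 1); last by rewrite lerDl ltW.
  rewrite ler_pdivrMl// mulr1 -[leRHS]powRr1 ?(ltW t0)//.
  by apply: ler_powR => //; exact: ltW.
have b1 z : t^-1 * `|dot (z *m E) (act E t w)| <= G1 * `|z| * (1 + t^-1).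
  apply: (@le_trans _ _ (t^-1 * (d%:R * (D * `|z| * `|act E t w|)))).
    rewrite ler_pM2l//; apply: le_trans (dot_norm_le _ _) _.
    by rewrite ler_wpM2l// ler_wpM2r.
  have -> : t^-1 * (d%:R * (D * `|z| * `|act E t w|)) =
    d%:R * D * `|z| * (t^-1 * `|act E t w|) by ring.
  have -> : G1 * `|z| * (1 + t^-1) = d%:R * D * `|z| * (C * (1 + t^-1)) by rewrite /G1; ring.
  by rewrite ler_wpM2l// !mulr_ge0.
have b2 : t^-1 * `|dot (y *m E *m E) (act E t w)| <= D * G1 * `|y| * (1 + t^-1).
  apply: (le_trans (b1 _)); apply: ler_wpM2r; first by rewrite addr_ge0 ?(ltW ti).
  have -> : D * G1 * `|y| = G1 * (D * `|y|) by ring.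
  by apply: ler_wpM2l => //; exact: yE.
have s0 : 0 <= D * G1 * `|y| * (1 + t^-1).
  apply: mulr_ge0; last by rewrite addr_ge0// ltW.
  by apply: mulr_ge0 => //; exact: mulr_ge0.
split.
- have di : is_derive t 1 (fun s : R => s^-1) (- t ^- 2 *: (1 : R)).
    by apply: (@is_deriveV _ id t 1 1); rewrite gt_eqF.
  apply: is_derive_eq (derM di (der_dot_act E (y *m E) w t0)) _.
  by rewrite /l2; congr (_ * _ + _); exact: mulr1.
- rewrite /l1 normrM (gtr0_norm ti); apply: (le_trans (b1 y)); lra.
- have -> : l2 = t^-1 * (t^-1 * dot (y *m E *m E) (act E t w) - t^-1 * dot (y *m E) (act E t w)).
    by rewrite /l2; field; rewrite gt_eqF.
  rewrite normrM (gtr0_norm ti) mulrA mulfV ?gt_eqF// mul1r.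
  apply: le_trans (ler_normB _ _) _; rewrite !normrM (gtr0_norm ti).
  have := b1 y; have := b2; lra.
Qed.

End ImaginaryRays.

Section ImaginaryPhases.
Context {R : realType} {d : nat}.
Variables (Q Qt Rq Rt : 'rV[R]_d -> R) (E : 'M[R]_d) (k : R).
Local Notation P := (fun xi => `|Q xi|).
Hypothesis gP : gauge P E.
Hypothesis cQ : continuous Q.
Hypothesis k1 : 1 < k.
Hypothesis gR : gauge Rq (k^-1 *: E).
Hypotheses (Rt0 : Rt 0 = 0) (Qt0 : Qt 0 = 0).
Hypothesis sQ : strong_subhomog Qt E 2.
Hypothesis sR : strong_subhomog Rt (k^-1 *: E) 1.
Local Notation mu := (\tr E).
Hypothesis mu1 : mu < 1.

Let k0 : 0 < k. Proof. exact: lt_trans k1. Qed.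

(* [q1], [q2] and [r1] are radial derivatives of [Qt] (first and second) and [Rt]. *)
Definition imag_radius del :=
  (forall xi, P xi < del -> `|Rt xi| <= 2^-1 * Rq xi) /\
  (forall w, P w = 1 -> exists q1 q2 r1 : R -> R, forall t, 0 < t < del ->
     [/\ [/\ is_derive t 1 (fun s => Qt (act E s w)) (q1 t), is_derive t 1 q1 (q2 t) &
             is_derive t 1 (fun s => Rt (act E s w)) (r1 t)],
         `|q1 t| <= 4^-1, t * `|q2 t| <= 4^-1 &
         t * `|r1 t| <= k * Rq (act E t w)]).

Lemma Rq_small eps : 0 < eps -> exists2 del, 0 < del & forall xi, P xi < del -> Rq xi < eps.
Proof.
move=> e0.
have R0 : Rq 0 = 0 by apply/(gauge_eq0 gR).
have /cvgrPdist_lt /(_ _ e0) /nbhs_ballP[r /= r0 H] := gauge_cont gR (x := 0).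
have [del del0 Hd] := gauge_small gP r0.
exists del => // xi /Hd /ball0P /H /=; rewrite R0 sub0r normrN.
exact: le_lt_trans (ler_norm _).
Qed.

Lemma sphere_ball r : 0 < r -> exists2 del, 0 < del &
  forall w t, P w = 1 -> 0 < t < del -> ball (0 : 'rV[R]_d) r (act E t w).
Proof.
move=> r0; have [del del0 Hd] := gauge_small gP r0.
exists del => // w t Pw /andP[t0 td]; apply/ball0P; apply: Hd.
by rewrite (gauge_homog gP)// Pw mulr1.
Qed.

Lemma imag_radius_ex : exists2 del, 0 < del & imag_radius del.
Proof.
have [m [M [m0 M0 HmM]]] := sphere_bounds gP gR.
have h0 : 0 < 2^-1 :> R by rewrite invr_gt0.
have [d1 d10 H1] := subhomog_small gR Rt0 (strong_subhomog_sub sR) h0.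
have [d2 d20 H2] := Rq_small d10.
have [_ [[rQ [rQ0 CQ]] SQ]] := sQ; have [_ [[rR [rR0 CR]] SR]] := sR.
(* A quarter of the slope of |Q|; another quarter goes to the linear phase in [imag_ray_gen], so
   half survives. *)
have h4 : 0 < 4^-1 :> R by rewrite invr_gt0.
have [tq [tq0 Hq]] := SQ _ h4 _ (gauge_compact gP).
(* The tolerance is the lower bound [m] of [Rq] on |Q| = 1, so that m u <= u Rq w, which is the
   value of [Rq] at the point of the ray. *)
have [tr [tr0 Hr]] := SR _ m0 _ (gauge_compact gP).
have [d3 d30 H3] := sphere_ball rQ0; have [d4 d40 H4] := sphere_ball rR0.
pose del := Num.min 1 (Num.min (Num.min d2 tq) (Num.min tr (Num.min d3 d4))).
exists del; first by rewrite !lt_min ltr01 d20 tq0 tr0 d30 d40.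
split=> [xi|w Pw].
  by rewrite !lt_min => /andP[_ /andP[/andP[/H2 /H1 + _] _]].
pose q1 := derive1n 1 (fun s => Qt (act E s w)).
pose q2 := derive1n 2 (fun s => Qt (act E s w)).
pose g s := Rt (act (k^-1 *: E) s w).
(* [Rt] is controlled along the dilations of E / k, whose parameter on the same ray is u = t^k; by
   the chain rule t r1(t) = k u g'(u). *)
pose u t := expR (k * ln t).
exists q1, q2, (fun t => derive1n 1 g (u t) * (u t * (k * t^-1))) => t /andP[t0].
rewrite !lt_min => /andP[t1 /andP[/andP[_ ttq] /andP[ttr /andP[td3 td4]]]].
have bQ : ball (0 : 'rV[R]_d) rQ (act E t w) by apply: H3 => //; rewrite t0.
have bR : ball (0 : 'rV[R]_d) rR (act (k^-1 *: E) (u t) w).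
  by rewrite -act_rescale ?lt0r_neq0//; apply: H4 => //; rewrite t0.
have u0 : 0 < u t by exact: expR_gt0.
have ut : u t <= t.
  rewrite -[leRHS]lnK ?posrE// ler_expR -[leRHS]mul1r.
  have l0 : ln t < 0 by rewrite ln_lt0// t0.
  by rewrite ler_wnM2r// ltW.
have [h1 h2] := der_ray2 t0 CQ bQ.
have hg := der_ray1 u0 (ltn0Sn 0) CR bR.
have eg : derive1n 1 g (u t) = _ := derive1_val hg.
have du : is_derive t 1 u (u t * (k * t^-1)).
  apply: (@der_comp R expR (fun s => k * ln s) t _ _ (is_derive_expR _)).
  apply: derZ; exact: is_derive1_ln.
split; first split => //.
- have -> : (fun s => Rt (act E s w)) = (fun s => g (u s)).
    by apply/funext => s; rewrite /g -act_rescale ?lt0r_neq0.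
  by rewrite eg; exact: (der_comp hg du).
- have := Hq t; rewrite t0 ttq => /(_ isT w Pw 1%N isT); rewrite expr1 normrM (gtr0_norm t0).
  by rewrite mulrC ler_pM2r.
- have := Hq t; rewrite t0 ttq => /(_ isT w Pw 2%N isT); rewrite normrM normrX (gtr0_norm t0).
  by rewrite expr2 -mulrA mulrC -ler_pdivlMr// mulfK ?gt_eqF.
- have := Hr (u t); rewrite u0 (le_lt_trans ut ttr) => /(_ isT w Pw 1%N isT).
  rewrite expr1 => h; rewrite (gauge_ray (Q := Q) k1 gR Pw t0) -/(u t).
  have -> : t * `|derive1n 1 g (u t) * (u t * (k * t^-1))| = k * `|u t * derive1n 1 g (u t)|.
    rewrite !normrM (gtr0_norm k0) (gtr0_norm u0) normfV (gtr0_norm t0).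
    by field; rewrite gt_eqF.
  rewrite ler_pM2l//; apply: (le_trans h); rewrite mulrC ler_pM2l//.
  by have /andP[] := HmM w Pw.
Qed.

(** Counterpart of [hom] without damping: [Rq] is negligible against |Q| near 0, see
    [Rq_small_o]. *)
Definition ihom (n : nat) y c xi := cos (n%:R * Q xi + dot y xi + c).

(** Serves both the model (A = 1, q = 0) and the true integrand. The phase is multiplied by Q w = 1
    or -1, harmless under a cosine, to make its slope positive: n from [Q], less n / 4 for [q] and n
    / 4 for the linear phase, leaves n / 2. *)
Lemma imag_ray_gen (G : R) (A dA q q1 q2 : R -> R) (n : nat) (y w : 'rV[R]_d) (a b c C : R) f :
  0 < a -> (0 < n)%N -> 1 <= C -> P w = 1 ->
  (forall t : R, 0 < t ->
    let l1 s := s^-1 * dot (y *m E) (act E s w) in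
    let l2 := - t ^- 2 * dot (y *m E) (act E t w) + t^-1 * (t^-1 * dot (y *m E *m E) (act E t w)) in
    [/\ is_derive t 1 l1 l2, `|l1 t| <= G * (1 + t^-1) & t * `|l2| <= G * (1 + t^-1)]) ->
  0 <= G -> G * (1 + a^-1) <= n%:R / 4 ->
  (forall t, a <= t <= b -> [/\ [/\ is_derive t 1 A (dA t), is_derive t 1 q (q1 t) &
     is_derive t 1 q1 (q2 t)],
     [/\ `|A t| <= C, t * `|dA t| <= C, `|q1 t| <= 4^-1 & t * `|q2 t| <= 4^-1] &
     t < b -> f t = A t * cos (n%:R * (Q (act E t w) + q t) + dot y (act E t w) + c)]) ->
  ray_phase f a b (n%:R / 2) C.
Proof.
move=> a0 n0 C1 Pw HL G0 Ga H.
have nR : 0 < n%:R :> R by rewrite ltr0n.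
have [s [s1 sw]] : exists s : R, (s = 1 \/ s = -1) /\ Q w = s.
  exists (Q w); split => //; have := Pw; case: (leP 0 (Q w)) => h.
    by rewrite ger0_norm// => ->; left.
  by rewrite ler0_norm ?(ltW h)// => E1; right; rewrite -E1 opprK.
have ss : s * s = 1 by case: s1 => ->; rewrite ?mulr1// mulrNN mulr1.
have sn (x : R) : `|s * x| = `|x| by case: s1 => ->; rewrite ?mul1r// mulN1r normrN.
exists A, dA, (fun t => s * (n%:R * (t * s + q t) + dot y (act E t w) + c)),
  (fun t => s * (n%:R * (s + q1 t) + t^-1 * dot (y *m E) (act E t w))),
  (fun t => s * (n%:R * q2 t + (- t ^- 2 * dot (y *m E) (act E t w) +
       t^-1 * (t^-1 * dot (y *m E *m E) (act E t w))))) => t tab.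
have [[d1 d2 d3] [b1 b2 b3 b4] ft] := H t tab.
have /andP[at_ tb] := tab; have t0 := lt_le_trans a0 at_.
have [l1 l2 l3] := HL t t0.
have Gt : G * (1 + t^-1) <= n%:R / 4.
  by apply: le_trans Ga; rewrite ler_wpM2l// lerD2l lef_pV2.
split.
- split => //.
  + apply: is_derive_eq (derZ s (derD (derD (derZ n%:R
      (derD (derM (is_derive_id t (1 : R)) (der_cst t s)) d2)) (der_dot_act E y w t0))
      (der_cst t c))) _.
    by rewrite /=; ring.
  + apply: is_derive_eq (derZ s (derD (derZ n%:R (derD (der_cst t s) d3)) l1)) _.
    by rewrite /=; ring.
- have h1 : `|s * (n%:R * q1 t)| <= n%:R / 4.
    by rewrite sn normrM (gtr0_norm nR) ler_pM2l.
  have h2 := le_trans l2 Gt; rewrite /= -(sn (_ * _)) in h2.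
  split => //.
  + have -> : s * (n%:R * (s + q1 t) + t^-1 * dot (y *m E) (act E t w)) =
      n%:R * (s * s) + s * (n%:R * q1 t) + s * (t^-1 * dot (y *m E) (act E t w)) by ring.
    move: h1 h2; rewrite ss !ler_norml => /andP[h1 _] /andP[h2 _]; lra.
  + rewrite sn; apply: (@le_trans _ _ (t * (n%:R * `|q2 t| + `|- t ^- 2 * dot (y *m E) (act E t w) +
       t^-1 * (t^-1 * dot (y *m E *m E) (act E t w))|))).
      rewrite ler_pM2l//; apply: le_trans (ler_normD _ _) _.
      by rewrite lerD2r normrM (gtr0_norm nR).
    rewrite mulrDr mulrCA; have := le_trans l3 Gt.
    have : n%:R * (t * `|q2 t|) <= n%:R * 4^-1 by rewrite ler_pM2l.
    have : n%:R / 2 <= C * (n%:R / 2) by rewrite ler_peMl// divr_ge0.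
    move=> /=; lra.
- move=> /ft ->; congr (_ * _); rewrite (phase_ray gP cQ)// sw.
  case: s1 => ->; first by rewrite mul1r.
  by rewrite mulN1r cosN.
Qed.

End ImaginaryPhases.

Section LocalImaginary.
Context {R : realType} {d : nat}.
Variables (Q Qt Rq Rt : 'rV[R]_d -> R) (E : 'M[R]_d) (k : R).
Local Notation P := (fun xi => `|Q xi|).
Hypothesis gP : gauge P E.
Hypothesis cQ : continuous Q.
Hypothesis k1 : 1 < k.
Hypothesis gR : gauge Rq (k^-1 *: E).
Hypotheses (Rt0 : Rt 0 = 0) (Qt0 : Qt 0 = 0).
Hypothesis sQ : strong_subhomog Qt E 2.
Hypothesis sR : strong_subhomog Rt (k^-1 *: E) 1.
Local Notation mu := (\tr E).
Hypothesis mu1 : mu < 1.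
Variables (del b : R).
Hypotheses (b0 : 0 < b) (bdel : b < del).
Hypothesis delP : imag_radius Q Qt Rq Rt E k del.
Local Notation iloc := (loc Rq Q Rt Qt).
Hypothesis mloc : forall n y c, measurable_fun setT (cut (fun xi => P xi < b) (iloc n y c)).

Let k0 : 0 < k. Proof. exact: lt_trans k1. Qed.

Lemma powRN_small (p e : R) : 0 < p -> 0 < e ->
  exists2 T, 1 <= T & forall t, T <= t -> t `^ (- p) <= e.
Proof.
move=> p0 e0; exists (Num.max 1 (e^-1 `^ p^-1)); first by rewrite le_max lexx.
move=> t; rewrite ge_max => /andP[t1 te]; have t0 := lt_le_trans ltr01 t1.
rewrite powRN -[leRHS]invrK lef_pV2 ?posrE ?invr_gt0 ?powR_gt0//.
have -> : e^-1 = (e^-1 `^ p^-1) `^ p by rewrite -powRrM mulVf ?gt_eqF// powRr1// invr_ge0 ltW.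
by rewrite ge0_ler_powR// ?nnegrE ?powR_ge0// ltW.
Qed.

(** On a ray Rq = t^k Rq w with k > 1, so Rq / |Q| = O(t^(k - 1)). *)
Lemma Rq_small_o e : 0 < e -> exists2 tau, 0 < tau & forall xi, P xi < tau -> Rq xi <= e * P xi.
Proof.
move=> e0; have [m [M [m0 M0 HmM]]] := sphere_bounds gP gR.
have k10 : 0 < k - 1 by rewrite subr_gt0.
(* The solution of M tau^(k - 1) = e. *)
exists (expR (ln (e / M) / (k - 1))); first exact: expR_gt0.
move=> xi Px; have [->|x0] := eqVneq xi 0.
  by rewrite (gauge_eq0 gR _).2// mulr_ge0// ltW.
have P0 := gauge_gt0 gP x0; rewrite /= in P0.
have Pw := gauge_polar gP P0; rewrite /= in Pw.
rewrite -{1}(actK E xi P0) (gauge_ray (Q := Q) k1 gR Pw P0).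
have -> : expR (k * ln `|Q xi|) = expR ((k - 1) * ln `|Q xi|) * `|Q xi|.
  by rewrite -{3}[`|Q xi|]lnK ?posrE// -expRD; congr expR; ring.
rewrite mulrAC; apply: ler_wpM2r => //.
apply: (@le_trans _ _ (e / M * M)); last by rewrite divfK// gt_eqF.
have eM0 : 0 < e / M by rewrite divr_gt0.
have /andP[h1 h2] := HmM _ Pw.
apply: ler_pM => //; rewrite ?expR_ge0 ?(le_trans (ltW m0) h1)//.
rewrite -[leRHS]lnK ?posrE// ler_expR mulrC -ler_pdivlMr//.
by rewrite -[leRHS]expRK ler_ln ?posrE ?expR_gt0// ltW.
Qed.

(** Amplitude bound: t |A'| <= 2 k n Rq exp(-n Rq / 2) <= 4 k, because x exp(-x / 2) <= 2. *)
Let Cb := 4 * k + 2.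
Let Cb1 : 1 <= Cb. Proof. by rewrite /Cb; have := k0; lra. Qed.

Lemma iloc_le1 n y c xi : P xi < del -> `|iloc n y c xi| <= 1.
Proof.
move=> Px; rewrite normrM ger0_norm ?expR_ge0// -[leRHS]mulr1 ler_pM ?norm_cos_le1//.
rewrite -expR0 ler_expR oppr_le0 mulr_ge0//.
have := (delP.1 _ Px); have := gauge_ge0 gR xi; rewrite ler_norml => ? /andP[? _]; lra.
Qed.

Lemma vintegrable_iloc n y c : vintegrable (cut (fun xi => P xi < b) (iloc n y c)).
Proof.
apply: (vintegrable_ball gP (mloc n y c) (C := 1) (l := b)) => v; rewrite /cut.
by case: ifP => [h|_]; [apply: iloc_le1; exact: lt_trans bdel|rewrite normr0].
Qed.

Lemma measurable_ihom n y c : measurable_fun setT (ihom Q n y c).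
Proof.
have m : measurable_fun setT (fun xi => n%:R * Q xi + dot y xi + c).
  apply: measurable_funD; last exact: measurable_cst.
  apply: measurable_funD; last exact: measurable_dot.
  by apply: measurable_funM; [exact: measurable_cst|exact: continuous_measurable_rV].
exact: measurableT_comp (continuous_measurable_fun (@continuous_cos R)) m.
Qed.

Lemma vintegrable_ihom n y c l : vintegrable (cut (fun xi => P xi < l) (ihom Q n y c)).
Proof.
have m : measurable_fun setT (cut (fun xi => P xi < l) (ihom Q n y c)).
  by apply: measurable_cut; [exact: measurable_gauge_lt gP _|exact: measurable_ihom].
apply: (vintegrable_ball gP m (C := 1) (l := l)) => v; rewrite /cut.
by case: ifP => _; [exact: norm_cos_le1|rewrite normr0].
Qed.

(** [K] does not depend on [r], only the thresholds do; and the bound for the model is uniform in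
    the outer cut [l], which later gives convergence of the truncated integrals. *)
Lemma imag_tail : exists2 K, 0 <= K & forall r, exists M0 N0, 1 <= M0 /\
  forall (n : nat) y c a, (N0 <= n)%N -> M0 / n%:R <= a -> `|y| <= r ->
  (forall l, `|vint (cut (fun xi => a <= P xi < l) (ihom Q n y c))| <= K / n%:R * a `^ (mu - 1)) /\
  `|vint (cut (fun xi => a <= P xi < b) (iloc n y c))| <= K / n%:R * a `^ (mu - 1).
Proof.
have [G G0 HG] := linear_ray gP mu1.
have [K K0 HK] := shell_osc gP mu1 (le_trans ler01 Cb1).
exists (2 * K); first exact: mulr_ge0.
(* With n >= 8 G r' and a >= (1 + 8 G r') / n, both G r' and G r' / a are at most n / 8, so the
   linear slope stays below n / 4. *)
move=> r; pose r' := `|r|; exists (1 + 8 * (G * r')), (Num.Def.truncn (8 * (G * r'))).+1.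
have Gr0 : 0 <= G * r' by apply: mulr_ge0 => //; exact: normr_ge0.
have M1 : 1 <= 1 + 8 * (G * r') by lra.
split => // n y c a Nn Ma yr.
have n0 : (0 < n)%N by exact: leq_trans Nn.
have nR : 0 < n%:R :> R by rewrite ltr0n.
have nG : 8 * (G * r') <= n%:R.
  by rewrite ltW//; apply: (lt_le_trans (truncnS_gt _)); rewrite ler_nat.
have a0 : 0 < a by apply: lt_le_trans Ma; rewrite divr_gt0// (lt_le_trans ltr01).
have Gy : G * `|y| <= G * r' by rewrite ler_wpM2l// (le_trans yr)// ler_norm.
have Ga : G * `|y| * (1 + a^-1) <= n%:R / 4.
  apply: (@le_trans _ _ (G * r' * (1 + a^-1))).
    by apply: ler_wpM2r => //; apply: addr_ge0 => //; rewrite invr_ge0 ltW.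
  have ia : a^-1 * (1 + 8 * (G * r')) <= n%:R.
    by rewrite mulrC ler_pdivrMr// [leRHS]mulrC -ler_pdivrMr.
  have := invr_ge0 a; rewrite (ltW a0) => ia0; nra.
have Gy0 : 0 <= G * `|y| by apply: mulr_ge0 => //; exact: normr_ge0.
have lam0 : 0 < n%:R / 2 :> R by rewrite divr_gt0.
have KE : K / (n%:R / 2) = 2 * K / n%:R by field; rewrite gt_eqF.
have ray (f : R -> R) A dA q q1 q2 l w : P w = 1 -> _ := fun Pw =>
  @imag_ray_gen R d Q E gP cQ (G * `|y|) A dA q q1 q2 n y w a l c Cb f a0 n0 Cb1 Pw
   (fun t t0 => HG w y t Pw t0) Gy0 Ga.
have Pact w t : P w = 1 -> 0 < t -> P (act E t w) = t.
  by move=> Pw t0; rewrite (gauge_homog gP)// Pw mulr1.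
split=> [l|]; rewrite -KE.
- apply: (HK _ a l) => //.
  + by apply: measurable_cut; [exact: measurable_gauge_shell gP _ _|exact: measurable_ihom].
  + move=> v; rewrite /cut; case: ifP => _; last by rewrite normr0 (le_trans ler01).
    exact: le_trans (norm_cos_le1 _) Cb1.
  + by move=> v /negbTE h; rewrite /cut h.
  + move=> w Pw; apply: (ray _ (fun=> 1) (fun=> 0) (fun=> 0) (fun=> 0) (fun=> 0) _ w Pw) => t /andP[at_ tl].
    have t0 := lt_le_trans a0 at_; split.
    * by split; exact: der_cst.
    * by rewrite normr1 normr0 !mulr0; split => //; rewrite ?invr_ge0 ?(le_trans ler01).
    * by move=> tl'; rewrite /cut Pact// at_ tl' mul1r addr0.
- have cutE : cut (fun xi => a <= P xi < b) (iloc n y c) =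
     cut (fun xi => a <= P xi) (cut (fun xi => P xi < b) (iloc n y c)).
    by apply/funext => v; rewrite /cut; case: (a <= P v).
  apply: (HK _ a b) => //.
  + by rewrite cutE; apply: measurable_cut => //; exact: measurable_gauge_ge gP _.
  + move=> v; rewrite /cut; case: ifP => [/andP[_ vb]|_]; last by rewrite normr0 (le_trans ler01).
    apply: le_trans Cb1; apply: iloc_le1; exact: lt_trans bdel.
  + by move=> v /negbTE h; rewrite /cut h.
  + move=> w Pw; have [q1 [q2 [r1 Hw]]] := delP.2 w Pw.
    (* The damping goes into the amplitude exp(-S); |Rt| <= Rq / 2 keeps S >= n Rq / 2. *)
    pose S t := n%:R * (Rq (act E t w) + Rt (act E t w)).
    apply: (ray _ (fun t => expR (- S t))
      (fun t => expR (- S t) * - (n%:R * (k * t^-1 * Rq (act E t w) + r1 t)))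
      (fun t => Qt (act E t w)) q1 q2 _ w Pw) => t /andP[at_ tb].
    have t0 := lt_le_trans a0 at_; have td := le_lt_trans tb bdel.
    have [|[d1 d2 d3] b1 b2 b3] := Hw t; first by rewrite t0 td.
    have dRq : is_derive t 1 (fun s => Rq (act E s w)) (k * t^-1 * Rq (act E t w)).
      have du : is_derive t 1 (fun s => expR (k * ln s)) (expR (k * ln t) * (k * t^-1)).
        apply: (@der_comp R expR (fun s => k * ln s) t _ _ (is_derive_expR _)).
        apply: derZ; exact: is_derive1_ln.
      have dd := derM du (der_cst t (Rq w)).
      rewrite (gauge_ray (Q := Q) k1 gR Pw t0).
      apply: (near_eq_is_derive _ (is_derive_eq dd _)); last by ring.
      near=> s; rewrite (gauge_ray (Q := Q) k1 gR Pw)//.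
      by near: s; exact: lt_nbhsr.
    have Pt : P (act E t w) < del by rewrite Pact.
    have Rg0 := gauge_ge0 gR (act E t w).
    have Sge : n%:R * Rq (act E t w) / 2 <= S t.
      rewrite /S -mulrA ler_pM2l//.
      by have := delP.1 _ Pt; rewrite ler_norml => /andP[h _]; lra.
    have S0 : 0 <= S t by apply: le_trans Sge; rewrite divr_ge0// mulr_ge0.
    split; first split => //.
    * exact: (@der_comp R expR (fun s => - S s) t _ _ (is_derive_expR _)
        (derN (derZ n%:R (derD dRq d3)))).
    * have e1 : expR (- S t) <= 1 by rewrite -expR0 ler_expR oppr_le0.
      split => //; first by rewrite ger0_norm ?expR_ge0// (le_trans e1).
      rewrite normrM (ger0_norm (expR_ge0 _)) normrN normrM (gtr0_norm nR).
      have h : t * `|k * t^-1 * Rq (act E t w) + r1 t| <= 2 * k * Rq (act E t w).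
        apply: (@le_trans _ _ (t * (k * t^-1 * Rq (act E t w) + `|r1 t|))).
          rewrite ler_pM2l//; apply: le_trans (ler_normD _ _) _; rewrite lerD2r ger0_norm//.
          by rewrite !mulr_ge0// ?invr_ge0 ltW.
        have -> : t * (k * t^-1 * Rq (act E t w) + `|r1 t|) =
          k * Rq (act E t w) + t * `|r1 t| by field; rewrite gt_eqF.
        lra.
      move: h Sge Rg0; generalize (Rq (act E t w)) => Y h Sge Rg0.
      rewrite mulrCA [t * _]mulrCA mulrA.
      apply: (@le_trans _ _ (expR (- (n%:R * Y / 2)) * n%:R * (2 * k * Y))).
        apply: ler_pM => //; rewrite ?mulr_ge0 ?expR_ge0 ?(ltW t0)//.
        by rewrite ler_pM2r// ler_expR lerN2.
      have := expR_inv_bound (mulr_ge0 (ltW nR) Rg0) => hb.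
      have -> : expR (- (n%:R * Y / 2)) * n%:R * (2 * k * Y) =
        2 * k * (n%:R * Y * expR (- (n%:R * Y / 2))) by ring.
      apply: (@le_trans _ _ (2 * k * 2)); first by rewrite ler_wpM2l// mulr_ge0// ltW.
      by rewrite /Cb; have := k0; lra.
    * by move=> tb'; rewrite /cut Pact// at_ tb' /loc -/(S t).
Unshelve. all: by end_near. Qed.

End LocalImaginary.

Section LocalImaginaryLimit.
Context {R : realType} {d : nat}.
Variables (Q Qt Rq Rt : 'rV[R]_d -> R) (E : 'M[R]_d) (k : R).
Local Notation P := (fun xi => `|Q xi|).
Hypothesis gP : gauge P E.
Hypothesis cQ : continuous Q.
Hypothesis k1 : 1 < k.
Hypothesis gR : gauge Rq (k^-1 *: E).
Hypotheses (Rt0 : Rt 0 = 0) (Qt0 : Qt 0 = 0).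
Hypothesis sQ : strong_subhomog Qt E 2.
Hypothesis sR : strong_subhomog Rt (k^-1 *: E) 1.
Local Notation mu := (\tr E).
Hypothesis mu1 : mu < 1.
Variables (del b : R).
Hypotheses (b0 : 0 < b) (bdel : b < del).
Hypothesis delP : imag_radius Q Qt Rq Rt E k del.
Local Notation iloc := (loc Rq Q Rt Qt).
Hypothesis mloc : forall n y c, measurable_fun setT (cut (fun xi => P xi < b) (iloc n y c)).

Let tail := imag_tail gP cQ k1 gR mu1 bdel delP mloc.
Let iI n y c l : vintegrable (cut (fun xi => P xi < l) (ihom Q n y c)) :=
  vintegrable_ihom gP cQ n y c l.
Let iL n y c : vintegrable (cut (fun xi => P xi < b) (iloc n y c)) :=
  vintegrable_iloc gP gR bdel delP mloc n y c.

Lemma cut_split (f : 'rV[R]_d -> R) a l : a <= l ->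
  cut (fun xi => P xi < l) f =
  (fun v => cut (fun xi => P xi < a) f v + cut (fun xi => a <= P xi < l) f v).
Proof.
move=> al; apply/funext => v; rewrite /cut; case: (ltP (P v) a) => /= h.
  by rewrite (lt_le_trans h al) addr0.
by rewrite add0r.
Qed.

Lemma vintegrable_cut_sub (f : 'rV[R]_d -> R) a l : vintegrable (cut (fun xi => P xi < l) f) ->
  a <= l -> vintegrable (cut (fun xi => P xi < a) f) /\
  vintegrable (cut (fun xi => a <= P xi < l) f).
Proof.
move=> fi al; split.
  have -> : cut (fun xi => P xi < a) f = cut (fun xi => P xi < a) (cut (fun xi => P xi < l) f).
    apply/funext => v; rewrite /cut; case: ltP => // h.
    by rewrite (lt_le_trans h al).
  by apply: vintegrable_cut => //; exact: measurable_gauge_lt gP _.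
have -> : cut (fun xi => a <= P xi < l) f = cut (fun xi => a <= P xi) (cut (fun xi => P xi < l) f).
  by apply/funext => v; rewrite /cut; case: (a <= P v).
by apply: vintegrable_cut => //; exact: measurable_gauge_ge gP _.
Qed.

Lemma vint_cut_split f a l : vintegrable (cut (fun xi => P xi < l) f) -> a <= l ->
  vint (cut (fun xi => P xi < l) f) =
  vint (cut (fun xi => P xi < a) f) + vint (cut (fun xi => a <= P xi < l) f).
Proof.
by move=> fi al; have [i1 i2] := vintegrable_cut_sub fi al; rewrite {1}(cut_split f al) vintD.
Qed.

Lemma tail_scale K (n : nat) M : (0 < n)%N -> 0 <= M ->
  K / n%:R * (M / n%:R) `^ (mu - 1) = K * M `^ (mu - 1) * n%:R `^ (- mu).
Proof.
move=> n0 M0; have nR : 0 < n%:R :> R by rewrite ltr0n.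
rewrite natr_powN//.
have -> : n%:R `^ (- (mu - 1)) = n%:R * n%:R `^ (- mu) :> R.
  rewrite -{2}[n%:R](@powRr1 _ n%:R) ?ler0n// -powRD; last by apply/implyP => _; rewrite gt_eqF.
  by congr (_ `^ _); ring.
by field; rewrite gt_eqF.
Qed.

(** Volume estimate on |Q| < M / n plus the oscillatory tail; meant for imaginary points whose order
    exceeds the minimum. *)
Lemma local_imag_bound r : exists C N, 0 <= C /\ forall n y c, (N <= n)%N -> `|y| <= r ->
  `|vint (cut (fun xi => P xi < b) (iloc n y c))| <= C * n%:R `^ (- mu).
Proof.
have [K K0 /(_ r)[M [N0 [M1 H]]]] := tail.
have M0 := lt_le_trans ltr01 M1.
pose V := gauge_vol P 1; have V0 : 0 <= V by exact: gauge_vol_ge0.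
exists (M `^ mu * V + K * M `^ (mu - 1)), (maxn N0 (Num.Def.truncn (M / b)).+1).
split; first by rewrite addr_ge0// mulr_ge0// powR_ge0.
move=> n y c; rewrite geq_max => /andP[Nn Mn] yr.
have n0 : (0 < n)%N by exact: leq_trans Mn.
have nR : 0 < n%:R :> R by rewrite ltr0n.
have Mnb : M / n%:R <= b.
  rewrite ler_pdivrMr// mulrC -ler_pdivrMr// ltW//.
  apply: (lt_le_trans (truncnS_gt _)); by rewrite ler_nat.
rewrite (vint_cut_split (iL n y c) Mnb) mulrDl.
have [i1 i2] := vintegrable_cut_sub (iL n y c) Mnb.
apply: le_trans (ler_normD _ _) _; apply: lerD.
  apply: (@le_trans _ _ (gauge_vol P (M / n%:R))).
    apply: vint_norm_le; [exact: vintegrable_meas i1|exact: vintegrable_ball1 gP _|].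
    move=> v; rewrite /cut; case: ifP => [h|_]; last by rewrite normr0.
    apply: (iloc_le1 gR delP); exact: lt_trans (lt_le_trans h Mnb) bdel.
  by rewrite (gauge_volE gP) ?divr_gt0// natr_powN ?(ltW M0)// mulrAC.
have [_ h] := H n y c (M / n%:R) Nn (lexx _) yr.
by apply: (le_trans h); rewrite tail_scale ?(ltW M0).
Qed.

(* On the core [|Q| < M / n] the two integrands are uniformly close; outside it
   both integrals are [O(M^(mu - 1) n^-mu)], which is small for large [M]
   because [mu < 1]. *)
Lemma local_imag r eps : 0 < eps -> exists N, forall n y c, (N <= n)%N -> `|y| <= r ->
  exists2 L, (fun tau => vint (cut (fun xi => P xi < tau) (ihom Q n y c))) @ +oo --> L &
    `|vint (cut (fun xi => P xi < b) (iloc n y c)) - L| <= eps * n%:R `^ (- mu).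
Proof.
move=> e0; have [K K0 /(_ r)[M0 [N0 [M1 H]]]] := tail.
pose V := gauge_vol P 1; have V0 : 0 <= V by exact: gauge_vol_ge0.
have p0 : 0 < 1 - mu by rewrite subr_gt0.
have KK0 : 0 < 8 * (K + 1) by rewrite mulr_gt0// ltr_wpDl.
have [T T1 HT] := powRN_small p0 (divr_gt0 e0 KK0).
(* [M0] opens the range of the tail estimate, [T] makes K M^(mu - 1) <= eps / 8. *)
pose M := Num.max M0 T.
have MM0 : M0 <= M by rewrite le_max lexx.
have Mp : 0 < M by apply: lt_le_trans MM0; exact: lt_le_trans M1.
have KM : K * M `^ (mu - 1) <= eps / 8.
  have := HT M; rewrite le_max lexx orbT => /(_ isT); rewrite opprB => h.
  apply: (@le_trans _ _ (K * (eps / (8 * (K + 1))))); first by rewrite ler_wpM2l.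
  have -> : K * (eps / (8 * (K + 1))) = eps / 8 * (K / (K + 1)).
    by field; rewrite gt_eqF// ltr_wpDl.
  apply: ler_piMr; first by rewrite divr_ge0// ltW.
  by rewrite ler_pdivrMr ?ltr_wpDl// mul1r lerDl.
(* Closeness asked of the integrands on the core, of volume V M^mu n^-mu. Dividing by 4 M turns it
   into a tolerance for [Rq] and [Qt] relative to |Q|, since n |Q| <= M there. *)
pose e2 := eps / (2 * (V + 1) * M `^ mu).
have Mmu : 0 < M `^ mu by rewrite powR_gt0.
have den : 0 < 2 * (V + 1) * M `^ mu by rewrite !mulr_gt0// ltr_wpDl.
have e20 : 0 < e2 by rewrite divr_gt0.
have e30 : 0 < e2 / (4 * M) by rewrite divr_gt0// mulr_gt0.
have [tR tR0 HR] := Rq_small_o gP k1 gR e30.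
have [tQ tQ0 HQ] := subhomog_small gP Qt0 (strong_subhomog_sub sQ) e30.
pose tau := Num.min b (Num.min tR tQ).
have tau0 : 0 < tau by rewrite !lt_min b0 tR0 tQ0.
exists (maxn N0 (Num.Def.truncn (M / tau)).+1) => n y c.
rewrite geq_max => /andP[Nn Mn] yr.
have n0 : (0 < n)%N by exact: leq_trans Mn.
have nR : 0 < n%:R :> R by rewrite ltr0n.
have nmu : 0 < n%:R `^ (- mu) :> R by rewrite powR_gt0.
pose a := M / n%:R; have a0 : 0 < a by rewrite divr_gt0.
have atau : a < tau.
  rewrite /a ltr_pdivrMr// mulrC -ltr_pdivrMr//.
  apply: (lt_le_trans (truncnS_gt _)); by rewrite ler_nat.
have [ab aR aQ] : [/\ a < b, a < tR & a < tQ].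
  by move: atau; rewrite !lt_min => /andP[-> /andP[-> ->]].
pose F l := vint (cut (fun xi => P xi < l) (ihom Q n y c)).
have Mna : M0 / n%:R <= a by rewrite ler_pM2r ?invr_gt0.
have Fdiff a' l : a <= a' -> a' <= l -> `|F l - F a'| <= K / n%:R * a' `^ (mu - 1).
  move=> aa' a'l; rewrite /F (vint_cut_split (iI n y c l) a'l) addrC addKr.
  exact: (H n y c a' Nn (le_trans Mna aa') yr).1.
(* Without absolute convergence the limit comes from the Cauchy criterion: the tail bound tends to 0
   as its inner radius grows. *)
have /cauchy_cvgP Fcvg : cauchy (F @ +oo).
  apply: cauchy_exP => e ee0.
  have Kn1 : 0 < K / n%:R + 1 by rewrite ltr_wpDl// divr_ge0// ltW.
  have [T' T'1 HT'] := powRN_small p0 (divr_gt0 ee0 Kn1).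
  pose a' := Num.max a T'; exists (F a').
  suff : \forall l \near +oo, ball (F a') e (F l) by [].
  near=> l.
  have aa' : a <= a' by rewrite le_max lexx.
  have a'l : a' <= l by near: l; (apply: nbhs_pinfty_ge; exact: num_real).
  have hh := Fdiff a' l aa' a'l.
  suff : `|F a' - F l| < e by [].
  rewrite distrC; apply: (le_lt_trans hh).
  have := HT' (Num.max a T'); rewrite le_max lexx orbT opprB => /(_ isT) h.
  apply: (@le_lt_trans _ _ (K / n%:R * (e / (K / n%:R + 1)))).
    by rewrite ler_wpM2l// divr_ge0// ltW.
  by rewrite mulrCA gtr_pMr// ltr_pdivrMr// mul1r ltrDl.
have [L FL] := (cvg_ex _).1 Fcvg.
exists L => //.
have FaL : `|F a - L| <= 2 * (K / n%:R * a `^ (mu - 1)).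
  have Ka0 : 0 <= K / n%:R * a `^ (mu - 1) by rewrite !mulr_ge0 ?powR_ge0// invr_ge0 ltW.
  apply/ler_addgt0Pr => e ee0.
  have /cvgrPdist_le /(_ e ee0) near1 := FL.
  near (@pinfty_nbhs R) => l.
  have h1 : `|L - F l| <= e by near: l; exact: near1.
  have h2 : `|F l - F a| <= K / n%:R * a `^ (mu - 1).
    by apply: Fdiff => //; near: l; (apply: nbhs_pinfty_ge; exact: num_real).
  have := ler_distD (F l) (F a) L; rewrite [`|F a - F l|]distrC [`|F l - L|]distrC; lra.
rewrite (vint_cut_split (iL n y c) (ltW ab)).
have [i1 i2] := vintegrable_cut_sub (iL n y c) (ltW ab).
have [_ h] := H n y c a Nn Mna yr.
rewrite tail_scale ?(ltW Mp)// in h FaL.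
have core : `|vint (cut (fun xi => P xi < a) (iloc n y c)) - F a| <= eps / 2 * n%:R `^ (- mu).
  rewrite /F -vintB//.
  apply: (@le_trans _ _ (vint (fun v => e2 * cut (fun xi => P xi < a) (fun=> 1) v))).
    apply: vint_norm_le.
    - by apply: measurable_funB; [exact: vintegrable_meas i1|exact: vintegrable_meas (iI _ _ _ _)].
    - by apply: vintegrableZ; exact: vintegrable_ball1 gP _.
    move=> v; rewrite /cut; case: ifP => [va|_]; last by rewrite subrr normr0 mulr0.
    rewrite mulr1 /loc /ihom.
    have hR := HR v (lt_trans va aR); have hQ := HQ v (lt_trans va aQ).
    have hT := delP.1 v (lt_trans (lt_trans va ab) bdel).
    have Rv := gauge_ge0 gR v.
    have nP : n%:R * `|Q v| <= M by move: va; rewrite /a ltr_pdivlMr// mulrC => /ltW.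
    have -> : cos (n%:R * Q v + dot y v + c) =
      expR (- 0) * cos (n%:R * Q v + dot y v + c) by rewrite oppr0 expR0 mul1r.
    apply: (le_trans (damped_cos_lip _ _ _ _)) => //.
      by rewrite mulr_ge0//; move: hT; rewrite ler_norml => /andP[? _]; lra.
    rewrite subr0.
    have -> : n%:R * (Q v + Qt v) + dot y v + c - (n%:R * Q v + dot y v + c) = n%:R * Qt v by ring.
    rewrite !normrM (gtr0_norm nR).
    have A1 : `|Rq v + Rt v| <= 2 * Rq v.
      by apply: le_trans (ler_normD _ _) _; rewrite ger0_norm//; lra.
    apply: (@le_trans _ _ (n%:R * (3 * (e2 / (4 * M) * `|Q v|)))).
      by rewrite -mulrDr ler_pM2l//; move: hR => /=; lra.
    have -> : n%:R * (3 * (e2 / (4 * M) * `|Q v|)) = 3 / 4 * e2 * (n%:R * `|Q v| / M).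
      by field; rewrite gt_eqF.
    have q1 : n%:R * `|Q v| / M <= 1 by rewrite ler_pdivrMr// mul1r.
    apply: (@le_trans _ _ (3 / 4 * e2 * 1)); first by rewrite ler_wpM2l// mulr_ge0// ltW.
    lra.
  rewrite vintZ; last exact: vintegrable_ball1 gP _.
  rewrite -/(gauge_vol P a) (gauge_volE gP a0) /a natr_powN// ?(ltW Mp)// -/V.
  have -> : e2 * (M `^ mu * n%:R `^ (- mu) * V) = (eps / 2 * (V / (V + 1))) * n%:R `^ (- mu).
    by rewrite /e2; field; rewrite !gt_eqF ?ltr_wpDl.
  rewrite ler_pM2r//; apply: ler_piMr; first by rewrite divr_ge0// ltW.
  by rewrite ler_pdivrMr ?ltr_wpDl// mul1r lerDl.
have KMn : K * M `^ (mu - 1) * n%:R `^ (- mu) <= eps / 8 * n%:R `^ (- mu) by rewrite ler_pM2r.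
set X := vint _ in core *; set Y := vint _ in h *.
(* Error budget: eps / 2 on the core, eps / 8 for the tail of [iloc], 2 eps / 8 from [F a] to its
   limit. *)
have -> : X + Y - L = (X - F a) + Y + (F a - L) by ring.
apply: le_trans (ler_normD _ _) _; have := ler_normD (X - F a) Y.
have : 0 <= eps * n%:R `^ (- mu) by rewrite mulr_ge0// ltW.
lra.
Unshelve. all: by end_near. Qed.

End LocalImaginaryLimit.

(** * Fourier inversion *)

Section ComplexFacts.
Context {R : realType}.
Implicit Types z w : R[i].

Lemma creD z w : cre (z + w) = cre z + cre w. Proof. by case: z; case: w. Qed.
Lemma cimD z w : cim (z + w) = cim z + cim w. Proof. by case: z; case: w. Qed.
Lemma creN z : cre (- z) = - cre z. Proof. by case: z. Qed.
Lemma cimN z : cim (- z) = - cim z. Proof. by case: z. Qed.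
Lemma creM z w : cre (z * w) = cre z * cre w - cim z * cim w.
Proof. by case: z; case: w. Qed.
Lemma cimM z w : cim (z * w) = cre z * cim w + cim z * cre w.
Proof. by case: z; case: w. Qed.

Lemma complex_eq z w : cre z = cre w -> cim z = cim w -> z = w.
Proof. by case: z => a b; case: w => c e /= -> ->. Qed.

Lemma cre_sum (I : finType) (F : I -> R[i]) : cre (\sum_i F i) = \sum_i cre (F i).
Proof. by apply: (big_morph (@cre R)) => // x y; exact: creD. Qed.
Lemma cim_sum (I : finType) (F : I -> R[i]) : cim (\sum_i F i) = \sum_i cim (F i).
Proof. by apply: (big_morph (@cim R)) => // x y; exact: cimD. Qed.

Lemma cmod_normc z : cmod z = Normc.normc z. Proof. by case: z. Qed.
Lemma cmod_ge0 z : 0 <= cmod z. Proof. exact: sqrtr_ge0. Qed.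
Lemma cmodM z w : cmod (z * w) = cmod z * cmod w.
Proof. by rewrite !cmod_normc Normc.normcM. Qed.
Lemma cmodV z : cmod z^-1 = (cmod z)^-1.
Proof. by rewrite !cmod_normc Normc.normcV. Qed.
Lemma cmodD z w : cmod (z + w) <= cmod z + cmod w.
Proof. by rewrite !cmod_normc le_normcD. Qed.
Lemma cmodN z : cmod (- z) = cmod z.
Proof. by rewrite !cmod_normc normcN. Qed.
Lemma cmod1 : cmod (1 : R[i]) = 1.
Proof. by rewrite cmod_normc Normc.normc1. Qed.
Lemma cmod0 : cmod (0 : R[i]) = 0.
Proof. by rewrite cmod_normc Normc.normc0. Qed.
Lemma cmodX z n : cmod (z ^+ n) = cmod z ^+ n.
Proof. by elim: n => [|n IH]; rewrite ?expr0 ?cmod1// !exprS cmodM IH. Qed.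

Lemma cre_le_cmod z : `|cre z| <= cmod z.
Proof. by rewrite -sqrtr_sqr ler_wsqrtr// lerDl sqr_ge0. Qed.
Lemma cim_le_cmod z : `|cim z| <= cmod z.
Proof. by rewrite -sqrtr_sqr ler_wsqrtr// lerDr sqr_ge0. Qed.

Lemma cmod_le z : cmod z <= `|cre z| + `|cim z|.
Proof.
have s0 : 0 <= `|cre z| + `|cim z| by exact: addr_ge0.
rewrite -[leRHS]ger0_norm// -sqrtr_sqr ler_wsqrtr// sqrrD.
rewrite !real_normK ?num_real// lerD2r lerDl mulrn_wge0//; exact: mulr_ge0.
Qed.

Lemma cmod_eq0 z : cmod z = 0 -> z = 0.
Proof. by rewrite cmod_normc; exact: Normc.eq0_normc. Qed.

Lemma cexpD z w : cexp (z + w) = cexp z * cexp w.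
Proof.
by apply: complex_eq; rewrite ?creM ?cimM /cexp /= ?creD ?cimD expRD ?cosD ?sinD /=; ring.
Qed.

Lemma cexp0 : cexp (0 : R[i]) = 1.
Proof. by apply: complex_eq; rewrite /cexp /= expR0 ?cos0 ?sin0 mul1r. Qed.

Lemma cexpX z n : cexp z ^+ n = cexp (z *+ n).
Proof. by elim: n => [|n IH]; rewrite ?mulr0n ?cexp0// exprS mulrS cexpD IH. Qed.

Lemma cmod_cexp z : cmod (cexp z) = expR (cre z).
Proof.
rewrite /cmod /cexp /= !exprMn -mulrDr cos2Dsin2 mulr1 sqrtr_sqr ger0_norm//.
Qed.

End ComplexFacts.

(** * Sums over boxes of the lattice *)

Section BoxSums.
Context {R : realType} {d : nat}.
Local Notation zvec := 'rV[int]_d.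

(** Box indices are offset by N, so the embedding shifts by N' - N. [A] is chosen before [f]: a
    function and its majorant are compared on the same complement. *)
Lemma boxsum_extend (N N' : nat) : (N <= N')%N -> exists A : pred 'rV['I_(N'.*2).+1]_d,
  forall (V : nmodType) (f : zvec -> V),
  \sum_v f (boxpt (N := N') v) = \sum_v f (boxpt (N := N) v) + \sum_(v | A v) f (boxpt v).
Proof.
move=> NN'.
have bd (i : 'I_(N.*2).+1) : (i + (N' - N) < (N'.*2).+1)%N.
  rewrite ltnS; have := ltn_ord i; rewrite ltnS => h.
  apply: (leq_trans (leq_add h (leqnn _))).
  by rewrite -!addnn -addnA subnKC// leq_add2r.
pose io (v : 'rV['I_(N.*2).+1]_d) : 'rV['I_(N'.*2).+1]_d := map_mx (fun i => Ordinal (bd i)) v.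
have io_inj : injective io.
  move=> u v /rowP H; apply/rowP => i; have := H i; rewrite !mxE => /(congr1 val) /= /eqP.
  by rewrite eqn_add2r => /eqP /val_inj.
have ioE v : boxpt (N := N') (io v) = boxpt v.
  by apply/rowP => i; rewrite !mxE /= PoszD -subzn//; ring.
exists (fun v => v \notin [set io u | u in [set: 'rV['I_(N.*2).+1]_d]]%SET) => V f.
rewrite (bigID (mem [set io u | u in [set: 'rV['I_(N.*2).+1]_d]]%SET)) /=; congr (_ + _).
rewrite big_imset /=; last by move=> u v _ _; exact: io_inj.
by apply: eq_big => [v|v _]; rewrite ?inE// ioE.
Qed.

Variable g : zvec -> R.
Hypothesis g0 : forall x, 0 <= g x.
Hypothesis gM : exists M, forall N, boxsumR N g <= M.

Lemma boxsum_dom (f : zvec -> R) N N' : (forall x, `|f x| <= g x) -> (N <= N')%N ->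
  `|boxsumR N' f - boxsumR N f| <= boxsumR N' g - boxsumR N g.
Proof.
move=> fg /boxsum_extend[A H].
rewrite /boxsumR !(H R) [X in `|X|]addrC addKr [leRHS]addrC addKr.
by apply: le_trans (ler_norm_sum _ _ _) _; apply: ler_sum => v _; exact: fg.
Qed.

(** The rate [del] depends on the majorant alone; used at all frequencies at once, it makes the
    Fourier partial sums converge uniformly. *)
Lemma boxsum_tail : exists2 del : nat -> R, del @ \oo --> 0 &
  forall f : zvec -> R, (forall x, `|f x| <= g x) ->
    exists2 l, (fun N => boxsumR N f) @ \oo --> l & forall N, `|l - boxsumR N f| <= del N.
Proof.
have gg x : `|g x| <= g x by rewrite ger0_norm.
have mono : nondecreasing_seq (fun N => boxsumR N g).
  move=> N N' NN'; have := boxsum_dom gg NN'; move=> /(le_trans (normr_ge0 _)).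
  by rewrite subr_ge0.
have [M HM] := gM.
have cg : cvgn (fun N => boxsumR N g).
  by apply: nondecreasing_is_cvgn => //; exists M => _ [N _ <-].
pose T := limn (fun N => boxsumR N g).
have TN N : boxsumR N g <= T by exact: nondecreasing_cvgn_le.
exists (fun N => T - boxsumR N g).
  by rewrite -(subrr T); apply: cvgB; [exact: cvg_cst|exact: cg].
move=> f fg.
have bound N N' : (N <= N')%N -> `|boxsumR N' f - boxsumR N f| <= T - boxsumR N g.
  by move=> NN'; apply: (le_trans (boxsum_dom fg NN')); rewrite lerD2r.
have cf : cvgn (fun N => boxsumR N f).
  apply/cauchy_cvgP; apply: cauchy_exP => e e0.
  have /cvgrPdist_lt /(_ e e0) [N0 _ HN] := cg.
  exists (boxsumR N0 f); exists N0 => // N /= NN.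
  suff : `|boxsumR N0 f - boxsumR N f| < e by [].
  rewrite distrC; apply: (le_lt_trans (bound _ _ NN)).
  by apply: le_lt_trans (ler_norm _) _; exact: HN (leqnn N0).
exists (limn (fun N => boxsumR N f)) => // N.
apply/ler_addgt0Pr => e e0.
have /cvgrPdist_le /(_ e e0) [N0 _ HN] := cf.
have h1 := HN (maxn N N0) (leq_maxr _ _); have h2 := bound N (maxn N N0) (leq_maxl _ _).
have := ler_distD (boxsumR (maxn N N0) f) (limn (fun N => boxsumR N f)) (boxsumR N f).
move: h1 h2 => /=; lra.
Qed.

End BoxSums.

Section FourierContinuity.
Context {R : realType} {d : nat}.
Variable phi : 'rV[int]_d -> R[i].
Hypothesis Sphi : in_Sd phi.

Let bdd : exists M, forall N, boxsumR N (fun x => cmod (phi x)) <= M.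
Proof.
have [M HM] := Sphi 0; exists M => N; apply: le_trans (HM N).
rewrite le_eqVlt; apply/orP; left; apply/eqP; apply: eq_bigr => v _.
rewrite /zmono big1; first by rewrite normr1 mul1r.
by move=> i _; rewrite [X in _ ^+ X](_ : _ = 0%N) ?expr0//; exact: mxE.
Qed.

Definition phterm (xi : 'rV[R]_d) x := phi x * cexp (Complex 0 (dot (zR x) xi)).

Lemma cmod_phterm xi x : cmod (phterm xi x) = cmod (phi x).
Proof. by rewrite cmodM cmod_cexp /= expR0 mulr1. Qed.

Lemma cre_boxsum N (f : 'rV[int]_d -> R[i]) : cre (boxsumC N f) = boxsumR N (@cre R \o f).
Proof. exact: cre_sum. Qed.
Lemma cim_boxsum N (f : 'rV[int]_d -> R[i]) : cim (boxsumC N f) = boxsumR N (@cim R \o f).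
Proof. exact: cim_sum. Qed.

Lemma zsum_tail (M : R) : 0 <= M -> exists2 del : nat -> R, del @ \oo --> 0 &
  forall f : 'rV[int]_d -> R[i], (forall x, cmod (f x) <= M * cmod (phi x)) ->
    forall N, cmod (zsum f - boxsumC N f) <= del N.
Proof.
move=> M0.
have g0 (x : 'rV[int]_d) : 0 <= M * cmod (phi x) by rewrite mulr_ge0// cmod_ge0.
have bM : exists B, forall N, boxsumR N (fun x => M * cmod (phi x)) <= B.
  have [B HB] := bdd; exists (M * B) => N.
  by rewrite /boxsumR -mulr_sumr ler_wpM2l//; exact: HB.
have [del del0 H] := boxsum_tail g0 bM.
exists (fun N => 2 * del N); first by rewrite -(mulr0 2); apply: cvgM => //; exact: cvg_cst.
move=> f fphi N.
have [l1 c1 h1] := H (@cre R \o f) (fun x => le_trans (cre_le_cmod _) (fphi x)).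
have [l2 c2 h2] := H (@cim R \o f) (fun x => le_trans (cim_le_cmod _) (fphi x)).
have e1 : cre (zsum f) = l1.
  apply/cvg_lim => //; under eq_fun do rewrite cre_boxsum; exact: c1.
have e2 : cim (zsum f) = l2.
  apply/cvg_lim => //; under eq_fun do rewrite cim_boxsum; exact: c2.
apply: le_trans (cmod_le _) _.
rewrite creD cimD creN cimN e1 e2 cre_boxsum (cim_boxsum N f).
by have := h1 N; have := h2 N; lra.
Qed.

Lemma continuous_dot (y : 'rV[R]_d) : continuous (fun xi => dot y xi).
Proof.
move=> xi; apply: (@cvg_big _ _ _ _ _ _ _ (nbhs xi)) => [|i _]; first by apply: add_continuous.
apply: (@continuous_comp _ _ _ (fun v : 'rV[R]_d => v 0 i) (fun t => y 0 i * t)).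
  exact: coord_continuous.
exact: mulrl_continuous.
Qed.

Lemma continuous_cexp_dot y (a : R[i]) :
  continuous (fun xi : 'rV[R]_d => cre (a * cexp (Complex 0 (dot y xi)))) /\
  continuous (fun xi : 'rV[R]_d => cim (a * cexp (Complex 0 (dot y xi)))).
Proof.
have cc : continuous (fun xi => cos (dot y xi)).
  move=> xi; apply: (@continuous_comp _ _ _ (fun xi => dot y xi) (@cos R)).
    exact: continuous_dot.
  exact: continuous_cos.
have cs : continuous (fun xi => sin (dot y xi)).
  move=> xi; apply: (@continuous_comp _ _ _ (fun xi => dot y xi) (@sin R)).
    exact: continuous_dot.
  exact: continuous_sin.
split => xi.
  under eq_fun do rewrite creM /cexp /= expR0 !mul1r.
  exact: cvgB (cvgM (cvg_cst _) (cc xi)) (cvgM (cvg_cst _) (cs xi)).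
under eq_fun do rewrite cimM /cexp /= expR0 !mul1r.
exact: cvgD (cvgM (cvg_cst _) (cs xi)) (cvgM (cvg_cst _) (cc xi)).
Qed.

Lemma uniform_limit_continuous (f : 'rV[R]_d -> R) (S : nat -> 'rV[R]_d -> R) (del : nat -> R) :
  del @ \oo --> 0 -> (forall N xi, `|f xi - S N xi| <= del N) ->
  (forall N, continuous (S N)) -> continuous f.
Proof.
move=> d0 H cS xi; apply/(@cvgrPdist_le _ _ _ (nbhs xi)) => e e0.
have e3 : 0 < e / 3 by rewrite divr_gt0.
have /cvgrPdist_le /(_ _ e3) [N _ HN] := d0.
have dN : del N <= e / 3.
  by have := HN N (leqnn N); rewrite /= sub0r normrN; exact: le_trans (ler_norm _).
have /(@cvgrPdist_le _ _ _ (nbhs xi)) /(_ _ e3) := cS N xi; apply: filterS => x hx.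
have h1 := le_trans (H N xi) dN; have h2 := le_trans (H N x) dN.
have -> : f xi - f x = (f xi - S N xi) + (S N xi - S N x) - (f x - S N x) by ring.
apply: le_trans (ler_normB _ _) _; have := ler_normD (f xi - S N xi) (S N xi - S N x); lra.
Qed.

Lemma continuous_fhat :
  continuous (fun xi => cre (fhat phi xi)) /\ continuous (fun xi => cim (fhat phi xi)).
Proof.
have [del del0 H] := zsum_tail ler01.
have Hx N xi : cmod (fhat phi xi - boxsumC N (phterm xi)) <= del N.
  by apply: H => x; rewrite cmod_phterm mul1r.
split.
  apply: (@uniform_limit_continuous _ (fun N xi => cre (boxsumC N (phterm xi))) del) => // [N xi|N].
    by apply: le_trans (Hx N xi); rewrite -creN -creD; exact: cre_le_cmod.
  move=> xi; under eq_fun do rewrite cre_boxsum.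
  apply: (@cvg_big _ _ _ _ _ _ _ (nbhs xi)) => [|v _]; first by apply: add_continuous.
  exact: (continuous_cexp_dot _ _).1.
apply: (@uniform_limit_continuous _ (fun N xi => cim (boxsumC N (phterm xi))) del) => // [N xi|N].
  by apply: le_trans (Hx N xi); rewrite -cimN -cimD; exact: cim_le_cmod.
move=> xi; under eq_fun do rewrite cim_boxsum.
apply: (@cvg_big _ _ _ _ _ _ _ (nbhs xi)) => [|v _]; first by apply: add_continuous.
exact: (continuous_cexp_dot _ _).2.
Qed.

End FourierContinuity.

(** * Orthogonality of characters on a period cube *)

Section BoxOrthogonality.
Context {R : realType}.

(** The norm of a row vector is the sup norm, so this is the closed period cube centred at (e, ...,
    e). *)
Definition box d (e : R) (v : 'rV[R]_d) : bool := `|v - const_mx e| <= pi.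

Lemma boxP d e (v : 'rV[R]_d) : reflect (forall i, `|v 0 i - e| <= pi) (box e v).
Proof.
apply: (iffP idP) => [H i|H].
  by have := coord_le_norm (v - const_mx e) i; rewrite !mxE => /le_trans; exact.
by apply: norm_rV_le => [|i]; rewrite ?pi_ge0// !mxE.
Qed.

Lemma box_cons n e t (y : 'rV[R]_n) : box e (vcons t y) = (`|t - e| <= pi) && box e y.
Proof.
apply/boxP/andP => [H|[ht /boxP hy] i].
  split; first by have := H ord0; rewrite vcons0.
  by apply/boxP => i; have := H (lift ord0 i); rewrite vconsS.
by case: (unliftP ord0 i) => [j ->|->]; rewrite ?vconsS ?vcons0.
Qed.

Lemma box_bounded d e (v : 'rV[R]_d) : box e v -> `|v| <= pi + `|e|.
Proof.
move=> H; rewrite -[v](subrK (const_mx e)); apply: le_trans (ler_normD _ _) _.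
by apply: lerD => //; apply: norm_rV_le => // i; rewrite mxE.
Qed.

Lemma measurable_box d e : measurable_fun setT (@box d e).
Proof.
apply: measurable_fun_ler => //; apply: continuous_measurable_rV => v.
apply: (@continuous_comp _ _ _ (fun v : 'rV[R]_d => v - const_mx e) (fun w : 'rV[R]_d => `|w|)).
  by apply: continuousB; [move=> A|exact: cst_continuous].
exact: norm_continuous.
Qed.

Lemma Rintegral_deriv (F f : R -> R) a b : a < b -> continuous f ->
  (forall x, is_derive x (1 : R) F (f x)) ->
  \int[@lebesgue_measure R]_(x in `[a, b]) f x = F b - F a.
Proof.
move=> ab cf dF.
have cF x : {for x, continuous F}.
  by apply: differentiable_continuous; apply/derivable1_diffP; exact: (@ex_derive _ _ _ _ _ _ _ (dF x)).
rewrite /Rintegral (@continuous_FTC2 _ f F)//.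
- exact: continuous_subspaceT.
- split; first by move=> x _; exact: (@ex_derive _ _ _ _ _ _ _ (dF x)).
    exact: cvg_at_right_filter (cF a).
  exact: cvg_at_left_filter (cF b).
- by move=> x _; rewrite derive1E; exact: (@derive_val _ _ _ _ _ _ _ (dF x)).
Qed.

Lemma sin_periodz (t : R) (k : int) : sin (t + k%:~R * (2 * pi)) = sin t.
Proof.
have per (n : nat) (a : R) : sin (a + n%:R * (2 * pi)) = sin a.
  by rewrite !mulr_natl (periodicn (@sinD2pi R)).
case: k => n; first exact: per.
by rewrite NegzE mulrNz mulNr -(per n.+1 (t - _)) subrK.
Qed.

Lemma cos_periodz (t : R) (k : int) : cos (t + k%:~R * (2 * pi)) = cos t.
Proof.
have per (n : nat) (a : R) : cos (a + n%:R * (2 * pi)) = cos a.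
  by rewrite !mulr_natl (periodicn (@cosD2pi R)).
case: k => n; first exact: per.
by rewrite NegzE mulrNz mulNr -(per n.+1 (t - _)) subrK.
Qed.

Lemma continuous_cos_affine (k c : R) : continuous (fun t : R => cos (k * t + c)).
Proof.
move=> t; apply: (@continuous_comp _ _ _ (fun t : R => k * t + c) (@cos R)).
  exact: (cvgD (@mulrl_continuous _ k t) (cvg_cst c)).
exact: continuous_cos.
Qed.

Lemma Rintegral_cos_period (k : int) A e c :
  \int[@lebesgue_measure R]_t (if `|t - e| <= pi then A * cos (k%:~R * t + c) else 0) =
  if k == 0 then 2 * pi * (A * cos c) else 0.
Proof.
have ab : e - pi < e + pi by have := pi_gt0 R; lra.
rewrite (_ : (fun t => _) = (fun t => A * cos (k%:~R * t + c)) \_ `[e - pi, e + pi]); last first.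
  apply/funext => t; rewrite patchE; congr (if _ then _ else _).
  by apply/idP/idP; rewrite ?inE /= in_itv /= ler_distl.
have cc (a : R) : continuous (fun t : R => A * cos (a * t + c)).
  by move=> t; exact: (cvgM (cvg_cst A) (@continuous_cos_affine a c t)).
rewrite -Rintegral_mkcond; case: eqP => [->|/eqP k0].
  have dF (x : R) : is_derive x (1 : R) (fun t => (A * cos c) * t) (A * cos (0%:~R * x + c)).
    by apply: is_derive_eq (derM (der_cst x _) (is_derive_id x 1)) _; rewrite !mul0r !add0r mulr1.
  by rewrite (Rintegral_deriv ab (cc _) dF); ring.
have kn : (k%:~R : R) != 0 by rewrite intr_eq0.
have dF (x : R) : is_derive x (1 : R) (fun t => (A * k%:~R^-1) * sin (k%:~R * t + c))
    (A * cos (k%:~R * x + c)).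
  have h : is_derive x (1 : R) (fun t : R => k%:~R * t + c) k%:~R.
    by apply: is_derive_eq (derD (derM (der_cst x _) (is_derive_id x 1)) (der_cst x c)) _; ring.
  have h2 := @der_comp R (@sin R) (fun t => k%:~R * t + c) x _ _ (is_derive_sin _) h.
  by apply: is_derive_eq (derM (der_cst x _) h2) _; field.
rewrite (Rintegral_deriv ab (cc _) dF).
have -> : k%:~R * (e + pi) + c = k%:~R * (e - pi) + c + k%:~R * (2 * pi) by ring.
by rewrite sin_periodz subrr.
Qed.

Lemma iint0 n : iint (fun _ : 'rV[R]_n => 0) = 0 :> R.
Proof. by elim: n => //= n ->; rewrite /Rintegral integral0. Qed.

Lemma dot_cons n (x : 'rV[R]_n.+1) t y :
  dot x (vcons t y) = x 0 ord0 * t + dot (\row_j x 0 (lift ord0 j)) y.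
Proof.
rewrite /dot big_ord_recl vcons0; congr (_ + _).
by apply: eq_bigr => j _; rewrite vconsS mxE.
Qed.

(** The free phase [c] carries the induction: a coordinate already fixed enters the inner integral
    as a phase. *)
Lemma iint_box_cos d e (x : 'rV[int]_d) c :
  iint (cut (box e) (fun v => cos (dot (zR x) v + c))) =
  if x == 0 then (2 * pi) ^+ d * cos c else 0.
Proof.
elim: d x c => [|n IH] x c /=.
  rewrite (_ : x == 0) ?expr0 ?mul1r /cut; last by apply/eqP/rowP => -[].
  have -> : box e (0 : 'rV[R]_0) by apply/boxP => -[].
  by rewrite /dot big_ord0 add0r.
pose k := x 0 ord0; pose y := \row_j x 0 (lift ord0 j).
have x0 : (x == 0) = (k == 0) && (y == 0).
  apply/eqP/andP => [h|[/eqP k0 /eqP y0]].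
    by rewrite /k /y h; split; [rewrite mxE|apply/eqP/rowP => j; rewrite !mxE].
  apply/rowP => i; rewrite mxE; case: (unliftP ord0 i) => [j ->|->//].
  by have /rowP/(_ j) := y0; rewrite !mxE.
pose A := if y == 0 then (2 * pi) ^+ n else 0 : R.
transitivity (\int[@lebesgue_measure R]_t
    (if `|t - e| <= pi then A * cos (k%:~R * t + c) else 0)).
  congr Rintegral; apply/funext => t.
  have [te|te] := boolP (`|t - e| <= pi); last first.
    by rewrite -(iint0 n); congr iint; apply/funext => v; rewrite /cut box_cons (negPf te).
  rewrite -[RHS](_ : (if y == 0 then (2 * pi) ^+ n * cos (k%:~R * t + c) else 0) = _); last first.
    by rewrite /A; case: ifP; rewrite ?mul0r.
  rewrite -IH; congr iint; apply/funext => v; rewrite /cut box_cons te /=.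
  case: ifP => // _; rewrite dot_cons [zR x 0 ord0]mxE.
  have -> : \row_j (zR x : 'rV[R]_n.+1) 0 (lift ord0 j) = zR y by apply/rowP => j; rewrite !mxE.
  by congr cos; rewrite -/k; ring.
rewrite x0 Rintegral_cos_period /A; case: (k == 0); case: (y == 0) => /=; rewrite ?mul0r ?mulr0//.
by rewrite exprS; ring.
Qed.

End BoxOrthogonality.

Section Inversion.
Context {R : realType} {d : nat}.
Implicit Types (f g : 'rV[R]_d -> R[i]).

Definition ccont f := continuous (fun xi => cre (f xi)) /\ continuous (fun xi => cim (f xi)).

Lemma ccont_cst a : ccont (fun _ => a).
Proof. by split; exact: cst_continuous. Qed.

Lemma ccontD f g : ccont f -> ccont g -> ccont (fun xi => f xi + g xi).
Proof.
move=> [f1 f2] [g1 g2]; split => xi.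
  by under eq_fun do rewrite creD; exact: cvgD (f1 xi) (g1 xi).
by under eq_fun do rewrite cimD; exact: cvgD (f2 xi) (g2 xi).
Qed.

Lemma ccontM f g : ccont f -> ccont g -> ccont (fun xi => f xi * g xi).
Proof.
move=> [f1 f2] [g1 g2]; split => xi.
  under eq_fun do rewrite creM.
  exact: cvgB (cvgM (f1 xi) (g1 xi)) (cvgM (f2 xi) (g2 xi)).
under eq_fun do rewrite cimM.
exact: cvgD (cvgM (f1 xi) (g2 xi)) (cvgM (f2 xi) (g1 xi)).
Qed.

Lemma ccont_sum (I : Type) (r : seq I) (F : I -> 'rV[R]_d -> R[i]) :
  (forall i, ccont (F i)) -> ccont (fun xi => \sum_(i <- r) F i xi).
Proof.
move=> H; elim: r => [|i r IH].
  by under eq_fun do rewrite big_nil; exact: ccont_cst.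
by under eq_fun do rewrite big_cons; exact: ccontD.
Qed.

Lemma ccontX f n : ccont f -> ccont (fun xi => f xi ^+ n).
Proof.
move=> cf; elim: n => [|n IH]; first exact: ccont_cst.
by under eq_fun do rewrite exprS; exact: ccontM.
Qed.

Lemma ccont_cexp_dot (y : 'rV[R]_d) : ccont (fun xi => cexp (Complex 0 (dot y xi))).
Proof.
have [h1 h2] := continuous_cexp_dot y 1.
by split => xi; [move: (h1 xi)|move: (h2 xi)]; under eq_fun do rewrite mul1r.
Qed.

Lemma dotNl (y v : 'rV[R]_d) : dot (- y) v = - dot y v.
Proof. by rewrite /dot -sumrN; apply: eq_bigr => i _; rewrite mxE mulNr. Qed.

Lemma dotDl (y z v : 'rV[R]_d) : dot (y + z) v = dot y v + dot z v.
Proof. by rewrite /dot -big_split; apply: eq_bigr => i _; rewrite mxE mulrDl. Qed.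

Lemma dotDr (y v w : 'rV[R]_d) : dot y (v + w) = dot y v + dot y w.
Proof. by rewrite /dot -big_split; apply: eq_bigr => i _; rewrite mxE mulrDr. Qed.

Lemma zRB (x y : 'rV[int]_d) : zR (x - y) = zR x - zR y :> 'rV[R]_d.
Proof. by apply/rowP => i; rewrite !mxE intrB. Qed.

Lemma ccont_measurable f : ccont f ->
  measurable_fun setT (fun xi => cre (f xi)) /\ measurable_fun setT (fun xi => cim (f xi)).
Proof. by move=> [f1 f2]; split; exact: continuous_measurable_rV. Qed.

Variable e : R.
Local Notation B := (@box R d e).

Lemma box_decay : exists2 C, 0 <= C & forall v, cut B (fun=> 1) v <= C * decay v.
Proof.
have s0 : 0 <= 1 + (pi + `|e|) by have := pi_ge0 R; have := normr_ge0 e; lra.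
exists ((1 + (pi + `|e|)) ^+ d.*2); first exact: exprn_ge0.
move=> v; rewrite /cut; case: ifP => [/box_bounded h|_]; last first.
  by rewrite mulr_ge0 ?(ltW (decay_gt0 v))// exprn_ge0.
rewrite /decay ler_pdivlMr ?mul1r; last by rewrite exprn_gt0// ltr_pwDl.
by apply: lerXn2r; rewrite ?nnegrE ?lerD2l// addr_ge0.
Qed.

Lemma vintegrable_box1 : vintegrable (cut B (fun=> 1)).
Proof.
have [C C0 HC] := box_decay.
apply: (vintegrable_le _ (vintegrableZ C (@integrable_decay R d))).
  by apply: measurable_cut; [exact: measurable_box|exact: measurable_cst].
move=> v; rewrite ger0_norm; first exact: HC.
by rewrite /cut; case: ifP.
Qed.

Definition boxvol := vint (cut B (fun=> 1)).

Lemma boxvol_ge0 : 0 <= boxvol.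
Proof. by apply: vint_ge0 => v; rewrite /cut; case: ifP. Qed.

Lemma vintegrable_box (f : 'rV[R]_d -> R) (b : 'rV[R]_d -> bool) (M : R) :
  measurable_fun setT (cut b f) -> (forall xi, b xi -> B xi) ->
  0 <= M -> (forall xi, b xi -> `|f xi| <= M) ->
  vintegrable (cut b f) /\ `|vint (cut b f)| <= M * boxvol.
Proof.
move=> mf bB M0 fM; have gi := vintegrableZ M vintegrable_box1.
have H v : `|cut b f v| <= M * cut B (fun=> 1) v.
  rewrite /cut; case: ifP => bv; first by rewrite (bB _ bv) mulr1; exact: fM.
  rewrite normr0; case: ifP => _; rewrite ?mulr0// mulr1; exact: M0.
split; first exact: (vintegrable_le mf gi H).
by apply: le_trans (vint_norm_le mf gi H) _; rewrite vintZ//; exact: vintegrable_box1.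
Qed.

Definition Cint (b : 'rV[R]_d -> bool) f : R[i] :=
  Complex (vint (cut b (fun xi => cre (f xi)))) (vint (cut b (fun xi => cim (f xi)))).

Definition Cintegrable (b : 'rV[R]_d -> bool) f :=
  vintegrable (cut b (fun xi => cre (f xi))) /\ vintegrable (cut b (fun xi => cim (f xi))).

Lemma CintD b f g : Cintegrable b f -> Cintegrable b g ->
  Cintegrable b (fun xi => f xi + g xi) /\
  Cint b (fun xi => f xi + g xi) = Cint b f + Cint b g.
Proof.
move=> [f1 f2] [g1 g2]; rewrite /Cintegrable /Cint.
have e1 : cut b (fun xi => cre (f xi + g xi)) = fun xi =>
    cut b (fun xi => cre (f xi)) xi + cut b (fun xi => cre (g xi)) xi.
  by apply/funext => xi; rewrite /cut; case: ifP => _; rewrite ?creD ?addr0.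
have e2 : cut b (fun xi => cim (f xi + g xi)) = fun xi =>
    cut b (fun xi => cim (f xi)) xi + cut b (fun xi => cim (g xi)) xi.
  by apply/funext => xi; rewrite /cut; case: ifP => _; rewrite ?cimD ?addr0.
rewrite e1 e2; split; first by split; exact: vintegrableD.
by apply: complex_eq; rewrite ?creD ?cimD /=; exact: vintD.
Qed.

Lemma CintZ b a f : Cintegrable b f ->
  Cintegrable b (fun xi => a * f xi) /\ Cint b (fun xi => a * f xi) = a * Cint b f.
Proof.
move=> [f1 f2]; rewrite /Cintegrable /Cint.
have e1 : cut b (fun xi => cre (a * f xi)) = fun xi =>
    cre a * cut b (fun xi => cre (f xi)) xi - cim a * cut b (fun xi => cim (f xi)) xi.
  by apply/funext => xi; rewrite /cut; case: ifP => _; rewrite ?creM ?mulr0 ?subr0 ?addr0.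
have e2 : cut b (fun xi => cim (a * f xi)) = fun xi =>
    cre a * cut b (fun xi => cim (f xi)) xi + cim a * cut b (fun xi => cre (f xi)) xi.
  by apply/funext => xi; rewrite /cut; case: ifP => _; rewrite ?cimM ?mulr0 ?subr0 ?addr0.
rewrite e1 e2; have z1 := vintegrableZ _ f1; have z2 := vintegrableZ _ f2.
split; first by split; [exact: vintegrableB|exact: vintegrableD].
apply: complex_eq; rewrite ?creM ?cimM /=.
  by rewrite vintB// !vintZ.
by rewrite vintD// !vintZ.
Qed.

Lemma Cint_sum b (I : Type) (r : seq I) (a : I -> R[i]) (F : I -> 'rV[R]_d -> R[i]) :
  (forall i, Cintegrable b (F i)) ->
  Cintegrable b (fun xi => \sum_(i <- r) a i * F i xi) /\
  Cint b (fun xi => \sum_(i <- r) a i * F i xi) = \sum_(i <- r) a i * Cint b (F i).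
Proof.
move=> H; elim: r => [|i r [IH1 IH2]].
  have z : cut b (fun _ : 'rV[R]_d => 0 : R) = fun=> 0.
    by apply/funext => v; rewrite /cut; case: ifP.
  have e0 : (fun xi => \sum_(i <- [::]) a i * F i xi) = fun=> 0.
    by apply/funext => xi; rewrite big_nil.
  rewrite e0 big_nil /Cintegrable /Cint /= z.
  have v0 : vint (fun _ : 'rV[R]_d => 0) = 0 by rewrite /vint /Rintegral integral0.
  by rewrite v0; split; first by split; exact: integrable0.
have e1 : (fun xi => \sum_(j <- i :: r) a j * F j xi) =
    fun xi => a i * F i xi + \sum_(j <- r) a j * F j xi.
  by apply/funext => xi; rewrite big_cons.
rewrite e1 big_cons; have [h1 h2] := CintZ (a i) (H i); have [h3 h4] := CintD h1 IH1.
by split => //; rewrite h4 h2 IH2.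
Qed.

Lemma Cint_box (b : 'rV[R]_d -> bool) f M : measurable_fun setT b -> ccont f ->
  (forall xi, b xi -> B xi) -> 0 <= M -> (forall xi, b xi -> cmod (f xi) <= M) ->
  Cintegrable b f /\ cmod (Cint b f) <= 2 * M * boxvol.
Proof.
move=> mb cf bB M0 fM; have [m1 m2] := ccont_measurable cf.
have [i1 h1] := vintegrable_box (measurable_cut mb m1) bB M0
  (fun xi bx => le_trans (cre_le_cmod _) (fM _ bx)).
have [i2 h2] := vintegrable_box (measurable_cut mb m2) bB M0
  (fun xi bx => le_trans (cim_le_cmod _) (fM _ bx)).
split => //; apply: le_trans (cmod_le _) _; rewrite /Cint /=; lra.
Qed.

Variable phi : 'rV[int]_d -> R[i].
Hypothesis Sphi : in_Sd phi.
Hypothesis phi1 : forall xi, cmod (fhat phi xi) <= 1.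

Definition spectral n (x : 'rV[int]_d) (xi : 'rV[R]_d) : R[i] :=
  fhat phi xi ^+ n * cexp (Complex 0 (- dot (zR x) xi)).

Lemma ccont_spectral n x : ccont (spectral n x).
Proof.
apply: ccontM; first exact: ccontX (continuous_fhat Sphi).
by have := ccont_cexp_dot (- zR x); under eq_fun do rewrite dotNl.
Qed.

Lemma cmod_spectral n x xi : cmod (spectral n x xi) = cmod (fhat phi xi) ^+ n.
Proof. by rewrite cmodM cmod_cexp /= expR0 mulr1 cmodX. Qed.

Lemma spectral_le1 n x xi : cmod (spectral n x xi) <= 1.
Proof. by rewrite cmod_spectral exprn_ile1 ?cmod_ge0. Qed.

Lemma Cint_spectral n x : Cintegrable B (spectral n x) /\ cmod (Cint B (spectral n x)) <= 2 * boxvol.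
Proof.
have [h1 h2] := Cint_box (@measurable_box R d e) (ccont_spectral n x) (fun xi => id) ler01
  (fun xi _ => spectral_le1 n x xi).
by split => //; rewrite mulr1 in h2.
Qed.

Lemma Cint_spectral0 x : Cint B (spectral 0 x) = cR ((2 * pi) ^+ d) * cpow phi 0 x.
Proof.
have [C C0 HC] := box_decay.
have key c : vint (cut B (fun v => cos (dot (zR (- x)) v + c))) =
    if x == 0 then (2 * pi) ^+ d * cos c else 0.
  have mm : measurable_fun setT (cut B (fun v : 'rV[R]_d => cos (dot (zR (- x)) v + c))).
    apply: measurable_cut; first exact: measurable_box.
    apply: measurableT_comp (continuous_measurable_fun (@continuous_cos R)) _.
    by apply: measurable_funD; [exact: measurable_dot|exact: measurable_cst].
  have hh v : `|cut B (fun v : 'rV[R]_d => cos (dot (zR (- x)) v + c)) v| <= C * decay v.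
    by apply: le_trans (HC v); rewrite /cut; case: ifP; rewrite ?normr0// norm_cos_le1.
  by rewrite /vint -(iint_leb mm hh) iint_box_cos oppr_eq0.
have eN (v : 'rV[R]_d) : - dot (zR x) v = dot (zR (- x)) v.
  by rewrite -dotNl; congr dot; apply/rowP => i; rewrite !mxE intrN.
have k1 := key 0; have k2 := key (- (pi / 2)).
have e1 : cut B (fun xi => cre (spectral 0 x xi)) = cut B (fun v => cos (dot (zR (- x)) v + 0)).
  congr cut; apply/funext => v.
  by rewrite /spectral expr0 mul1r /cexp /= expR0 mul1r addr0 eN.
have e2 : cut B (fun xi => cim (spectral 0 x xi)) =
    cut B (fun v => cos (dot (zR (- x)) v - (pi / 2))).
  congr cut; apply/funext => v.
  by rewrite /spectral expr0 mul1r /cexp /= expR0 mul1r eN cosB cos_pihalf sin_pihalf mulr0 add0r mulr1.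
apply: complex_eq; rewrite ?creM ?cimM /Cint /= ?e1 ?e2 ?k1 ?k2 ?cosN ?cos_pihalf ?cos0;
  by case: (x == 0) => /=; ring.
Qed.

(** Induction on n: phi(y) times the integrand for x - y is the integrand for x times one term of
    the Fourier series of [phi], and uniform convergence of that series allows summation under the
    integral. *)
Theorem spectral_inversion n x : cR ((2 * pi) ^+ d) * cpow phi n x = Cint B (spectral n x).
Proof.
elim: n x => [|n IH] x; first by rewrite Cint_spectral0.
set c := (2 * pi) ^+ d; have c0 : 0 < c by rewrite exprn_gt0// mulr_gt0// pi_gt0.
have cc : cmod (cR c) = c by rewrite /cmod /cR /= expr0n /= addr0 sqrtr_sqr gtr0_norm.
(* The induction hypothesis bounds [cpow phi n] by [M], so the convolution sum is dominated by M
   |phi| and [zsum_tail] applies. *)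
pose M := 2 * boxvol / c.
have M0 : 0 <= M by rewrite divr_ge0 ?(ltW c0)// mulr_ge0// boxvol_ge0.
pose F y := cpow phi n (x - y) * phi y.
have FM y : cmod (F y) <= M * cmod (phi y).
  rewrite cmodM ler_wpM2r ?cmod_ge0// /M ler_pdivlMr// mulrC -{1}cc -cmodM IH.
  exact: (Cint_spectral n _).2.
have [del d0 Hd] := zsum_tail Sphi M0; have [del' d0' Hd'] := zsum_tail Sphi (@ler01 R).
have HG N xi : cmod (fhat phi xi - boxsumC N (phterm phi xi)) <= del' N.
  by apply: Hd' => y; rewrite cmod_phterm mul1r.
have sumE N xi : \sum_v phi (boxpt (N := N) v) * spectral n (x - boxpt v) xi =
    spectral n x xi * boxsumC N (phterm phi xi).
  rewrite /boxsumC mulr_sumr.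
  apply: eq_bigr => v _; rewrite /spectral /phterm.
  have -> : cexp (Complex 0 (- dot (zR (x - boxpt v)) xi)) =
      cexp (Complex 0 (- dot (zR x) xi)) * cexp (Complex 0 (dot (zR (boxpt v)) xi)).
    rewrite -cexpD; congr cexp; apply: complex_eq; rewrite ?creD ?cimD /= ?addr0//.
    by rewrite zRB dotDl dotNl opprD opprK.
  ring.
have H N := Cint_sum (index_enum _) (fun v => phi (boxpt (N := N) v))
    (fun v => (Cint_spectral n (x - boxpt v)).1).
have gi N : Cintegrable B (fun xi => spectral n x xi * boxsumC N (phterm phi xi)).
  by under eq_fun do rewrite -sumE; exact: (H N).1.
have eq1 N : cR c * boxsumC N F =
    Cint B (fun xi => spectral n x xi * boxsumC N (phterm phi xi)).
  under eq_fun do rewrite -sumE; rewrite (H N).2.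
  by rewrite /boxsumC mulr_sumr; apply: eq_bigr => v _; rewrite -IH /F mulrA mulrC.
have cG N : ccont (fun xi => boxsumC N (phterm phi xi)).
  by apply: ccont_sum => v; apply: ccontM; [exact: ccont_cst|exact: ccont_cexp_dot].
have cS := ccont_spectral n x; have cf : ccont (fhat phi) := continuous_fhat Sphi.
have eq2 N : cmod (Cint B (spectral n.+1 x) - cR c * boxsumC N F) <= 2 * del' N * boxvol.
  pose h xi := fhat phi xi * spectral n x xi + (-1) * (spectral n x xi * boxsumC N (phterm phi xi)).
  have dN0 : 0 <= del' N by exact: le_trans (cmod_ge0 _) (HG N 0).
  have ch : ccont h.
    by apply: ccontD; apply: ccontM => //; [exact: ccont_cst|exact: ccontM].
  have hM xi : B xi -> cmod (h xi) <= del' N.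
    move=> _; rewrite /h mulN1r [X in X - _]mulrC -mulrBr cmodM -[leRHS]mul1r.
    by apply: ler_pM; rewrite ?cmod_ge0 ?spectral_le1.
  have [ih hh] := Cint_box (@measurable_box R d e) ch (fun xi => id) dN0 hM.
  have [ai ae] := CintD ih (gi N).
  have -> : Cint B (spectral n.+1 x) - cR c * boxsumC N F = Cint B h.
    rewrite eq1; apply/eqP; rewrite subr_eq -ae; apply/eqP; congr Cint; apply/funext => xi.
    by rewrite /h mulN1r subrK /spectral exprS mulrA.
  exact: hh.
have bound N : cmod (cR c * zsum F - Cint B (spectral n.+1 x)) <=
    c * del N + 2 * boxvol * del' N.
  have -> : cR c * zsum F - Cint B (spectral n.+1 x) = cR c * (zsum F - boxsumC N F)
      - (Cint B (spectral n.+1 x) - cR c * boxsumC N F) by ring.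
  apply: le_trans (cmodD _ _) _; rewrite cmodN cmodM cc; apply: lerD.
    by rewrite ler_wpM2l ?(ltW c0)//; exact: Hd.
  by apply: le_trans (eq2 N) _; rewrite mulrAC.
apply/eqP; rewrite -subr_eq0; apply/eqP; apply: cmod_eq0; apply/eqP.
rewrite eq_le cmod_ge0 andbT.
have lim0 : (fun N => c * del N + 2 * boxvol * del' N) @ \oo --> 0.
  have := cvgD (cvgM (cvg_cst c) d0) (cvgM (cvg_cst (2 * boxvol)) d0').
  rewrite !mulr0 addr0 => h; exact: h.
apply: (ler_cvg_to (cvg_cst _) lim0); exact: nearW.
Qed.

End Inversion.

(** * From the Fourier integrand to the local integrals *)

Section LocalFactor.
Context {R : realType} {d : nat}.
Variables (phi : 'rV[int]_d -> R[i]) (xi0 al : 'rV[R]_d).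
Hypotheses (Sphi : in_Sd phi) (phi1 : forall xi, cmod (fhat phi xi) <= 1).
Hypothesis h1 : cmod (fhat phi xi0) = 1.
(** [P] delimits the neighbourhood and [Rr] is the damping polynomial: the same function at a
    positive point, whereas P = |Q| at an imaginary one. *)
Variables (P Q Rr Qt Rt : 'rV[R]_d -> R) (E : 'M[R]_d) (del : R).
Hypothesis gP : gauge P E.
Hypothesis expansionP : forall eta, P eta < del ->
  fhat phi (eta + xi0) / fhat phi xi0 =
  cexp (Complex (- (Rr eta + Rt eta)) (dot al eta - (Q eta + Qt eta))).

Lemma creMn (z : R[i]) n : cre (z *+ n) = n%:R * cre z.
Proof. by elim: n => [|n IH]; rewrite ?mulr0n ?mul0r// mulrS creD IH; ring. Qed.
Lemma cimMn (z : R[i]) n : cim (z *+ n) = n%:R * cim z.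
Proof. by elim: n => [|n IH]; rewrite ?mulr0n ?mul0r// mulrS cimD IH; ring. Qed.

Lemma dotZl (a : R) (u v : 'rV[R]_d) : dot (a *: u) v = a * dot u v.
Proof. by rewrite /dot mulr_sumr; apply: eq_bigr => i _; rewrite mxE mulrA. Qed.

Let f0 : fhat phi xi0 != 0.
Proof. by apply/eqP => h; move: h1; rewrite h cmod0 => /esym/eqP; rewrite oner_eq0. Qed.

Definition base_factor n (x : 'rV[int]_d) : R[i] :=
  fhat phi xi0 ^+ n * cexp (Complex 0 (- dot (zR x) xi0)).

Lemma cmod_base_factor n x : cmod (base_factor n x) = 1.
Proof. by rewrite cmodM cmodX h1 expr1n mul1r cmod_cexp expR0. Qed.

Lemma spectral_local n x eta : P eta < del -> spectral phi n x (eta + xi0) = base_factor n x *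
  cexp (Complex (- (n%:R * (Rr eta + Rt eta)))
    (- (n%:R * (Q eta + Qt eta) + dot (zR x - n%:R *: al) eta))).
Proof.
move=> /expansionP H; set z := Complex _ _ in H.
have -> : spectral phi n x (eta + xi0) = fhat phi xi0 ^+ n *
    (cexp (z *+ n) * cexp (Complex 0 (- dot (zR x) (eta + xi0)))).
  rewrite mulrA -cexpX -exprMn -H /spectral; congr (_ ^+ _ * _).
  by rewrite mulrC divfK.
rewrite /base_factor -mulrA -!cexpD; congr (_ * cexp _).
apply: complex_eq; rewrite !(creD, cimD, creMn, cimMn) /= ?dotDr ?dotDl ?dotNl ?dotZl; ring.
Qed.

Lemma ccont_translate (f : 'rV[R]_d -> R[i]) : ccont f -> ccont (fun eta => f (eta + xi0)).
Proof.
have ct : continuous (fun eta : 'rV[R]_d => eta + xi0).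
  by move=> eta; apply: continuousD => [A|]//; exact: cst_continuous.
move=> [c1 c2]; split => eta.
  exact: (@continuous_comp _ _ _ (fun eta : 'rV[R]_d => eta + xi0) (fun v => cre (f v)) eta (ct eta) (c1 _)).
exact: (@continuous_comp _ _ _ (fun eta : 'rV[R]_d => eta + xi0) (fun v => cim (f v)) eta (ct eta) (c2 _)).
Qed.

(** On the neighbourhood the integrand is the real part of a continuous function [h]: a power of
    fhat(eta + xi0) / fhat(xi0) times characters that trade the drift n al for the displacement
    y. *)
Lemma measurable_loc n y c :
  measurable_fun setT (cut (fun xi => P xi < del) (loc Rr Q Rt Qt n y c)).
Proof.
pose h eta := (fhat phi (eta + xi0) * (fhat phi xi0)^-1) ^+ n *
  (cexp (Complex 0 (dot (- (n%:R *: al + y)) eta)) * cexp (Complex 0 (- c))).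
have ch : ccont h.
  apply: ccontM; last by apply: ccontM; [exact: ccont_cexp_dot|exact: ccont_cst].
  apply: ccontX; apply: ccontM; last exact: ccont_cst.
  by apply: ccont_translate; exact: (continuous_fhat Sphi).
have -> : cut (fun xi => P xi < del) (loc Rr Q Rt Qt n y c) =
    cut (fun xi => P xi < del) (fun eta => cre (h eta)).
  apply/funext => eta; rewrite /cut; case: ifP => // /expansionP H.
  rewrite /h H cexpX -!cexpD /cexp /= !(creD, cimD, creMn, cimMn) /= /loc -[in LHS]cosN.
  by congr (expR _ * cos _); rewrite ?(dotDl, dotNl, dotZl); ring.
by apply: measurable_cut; [exact: measurable_gauge_lt gP del|exact: (ccont_measurable ch).1].
Qed.

Local Notation b := (fun xi : 'rV[R]_d => P (xi - xi0) < del).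
Local Notation T n y c := (vint (cut (fun xi => P xi < del) (loc Rr Q Rt Qt n y c))).

(** After translation to the point, the imaginary part of exp(-i theta) is -sin theta = cos(theta +
    pi / 2): hence the phase shift carried by [loc]. *)
Lemma Cint_local n x : Cint b (spectral phi n x) = base_factor n x *
  Complex (T n (zR x - n%:R *: al) 0) (T n (zR x - n%:R *: al) (pi / 2)).
Proof.
have key (f : 'rV[R]_d -> R) : measurable_fun setT f -> (forall v, `|f v| <= 1) ->
    vint (cut b f) = vint (cut (fun xi => P xi < del) (fun eta => f (eta + xi0))).
  move=> mf fb; have mT : measurable_fun setT (fun v : 'rV[R]_d => v + xi0).
    apply: measurable_fun_rVP => i; under eq_fun do rewrite mxE.
    by apply: measurable_funD => //; exact: measurable_coor.
  have mc : measurable_fun setT (cut (fun xi => P xi < del) (fun eta => f (eta + xi0))).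
    by apply: measurable_cut; [exact: measurable_gauge_lt gP del|exact: measurableT_comp].
  have bc v : `|cut (fun xi => P xi < del) (fun eta => f (eta + xi0)) v| <=
      (if P v < del then 1 else 0) by rewrite /cut; case: ifP; rewrite ?normr0.
  have [_ <-] := vint_translate (- xi0) (vintegrable_ball gP mc bc).
  by apply: eq_vint => v; rewrite /cut subrK.
have [m1 m2] := ccont_measurable (ccont_spectral Sphi n x).
have s1 xi := spectral_le1 phi1 n x xi.
pose w := fun eta => cexp (Complex (- (n%:R * (Rr eta + Rt eta)))
    (- (n%:R * (Q eta + Qt eta) + dot (zR x - n%:R *: al) eta))).
have wre : cut (fun xi => P xi < del) (fun eta => cre (w eta)) =
    cut (fun xi => P xi < del) (loc Rr Q Rt Qt n (zR x - n%:R *: al) 0).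
  by congr cut; apply/funext => eta; rewrite /w /cexp /= cosN /loc addr0.
have wim : cut (fun xi => P xi < del) (fun eta => cim (w eta)) =
    cut (fun xi => P xi < del) (loc Rr Q Rt Qt n (zR x - n%:R *: al) (pi / 2)).
  congr cut; apply/funext => eta; rewrite /w /cexp /= sinN /loc cosD cos_pihalf sin_pihalf.
  by rewrite mulr0 sub0r mulr1.
have iw : Cintegrable (fun xi => P xi < del) w.
  have bw c (v : 'rV[R]_d) : `|cut (fun xi => P xi < del) (loc Rr Q Rt Qt n (zR x - n%:R *: al) c) v| <=
      (if P v < del then 1 else 0).
    rewrite /cut; case: ifP => [Pv|]; last by rewrite normr0.
    have := s1 (v + xi0); rewrite (spectral_local n x Pv) cmodM cmod_base_factor mul1r cmod_cexp /=.
    move=> h; rewrite /loc normrM ger0_norm ?expR_ge0//.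
    by apply: le_trans h; rewrite ler_piMr ?expR_ge0// norm_cos_le1.
  split; rewrite ?wre ?wim; exact: (vintegrable_ball gP (measurable_loc _ _ _) (bw _)).
transitivity (Cint (fun xi => P xi < del) (fun eta => base_factor n x * w eta)).
  rewrite /Cint (key _ m1 (fun v => le_trans (cre_le_cmod _) (s1 v))).
  rewrite (key _ m2 (fun v => le_trans (cim_le_cmod _) (s1 v))).
  by congr Complex; apply: eq_vint => eta; rewrite /cut; case: ifP => // /spectral_local ->.
by rewrite (CintZ _ iw).2 /Cint wre wim.
Qed.

Lemma Cint_local_le n x C :
  (forall c, `|T n (zR x - n%:R *: al) c| <= C) -> cmod (Cint b (spectral phi n x)) <= 2 * C.
Proof.
move=> H; rewrite Cint_local cmodM cmod_base_factor mul1r.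
by apply: le_trans (cmod_le _) _; have := H 0; have := H (pi / 2) => /=; lra.
Qed.

Lemma Cint_local_sub n x L0 L1 C :
  `|T n (zR x - n%:R *: al) 0 - L0| <= C -> `|T n (zR x - n%:R *: al) (pi / 2) - L1| <= C ->
  cmod (Cint b (spectral phi n x) - base_factor n x * Complex L0 L1) <= 2 * C.
Proof.
move=> H0 H1; rewrite Cint_local -mulrBr cmodM cmod_base_factor mul1r.
by apply: le_trans (cmod_le _) _; rewrite creD cimD creN cimN /=; lra.
Qed.

Lemma measurable_shifted_ball : measurable_fun setT b.
Proof.
apply: measurable_fun_ltr => //; apply: continuous_measurable_rV => v.
apply: (@continuous_comp _ _ _ (fun v : 'rV[R]_d => v - xi0) P).
  by apply: continuousB => [A|]//; exact: cst_continuous.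
exact: (gauge_cont gP).
Qed.

Lemma shifted_ball_nbhs : 0 < del -> exists2 r, 0 < r & forall xi, `|xi - xi0| < r -> b xi.
Proof.
move=> del0; have P0 : P 0 = 0 by apply/(gauge_eq0 gP).
have /cvgrPdist_lt /(_ _ del0) /nbhs_ballP[r /= r0 H] := gauge_cont gP (x := 0).
exists r => // xi /ball0P /H /=; rewrite P0 sub0r normrN.
exact: le_lt_trans (ler_norm _).
Qed.

(** Off the centre |fhat| = exp(-(Rr + Rt)) < 1. *)
Lemma fhat_isolated xi : (forall eta, P eta < del -> eta != 0 -> 0 < Rr eta + Rt eta) ->
  b xi -> cmod (fhat phi xi) = 1 -> xi = xi0.
Proof.
move=> Hpos bxi h; apply/eqP; rewrite -subr_eq0; apply/negPn/negP => n0.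
have H := expansionP bxi; have := Hpos _ bxi n0.
have : cmod (fhat phi (xi - xi0 + xi0) / fhat phi xi0) = 1.
  by rewrite subrK cmodM cmodV h h1 invr1 mulr1.
rewrite H cmod_cexp /= -expR0 => /expR_inj; lra.
Qed.

End LocalFactor.

Section LocalModels.
Context {R : realType} {d : nat}.

Lemma poly_nolin_continuous (Q : 'rV[R]_d -> R) : poly_nolin Q -> continuous Q.
Proof.
move=> [s [_ H]]; have -> : Q = fun xi => \sum_(p <- s) p.1 * mono xi p.2 by exact/funext.
elim: {H} s => [|p s IH].
  by under eq_fun do rewrite big_nil; exact: cst_continuous.
have cm : continuous (fun xi : 'rV[R]_d => mono xi p.2).
  move=> xi; apply: (@cvg_big _ _ _ _ _ _ _ (nbhs xi)) => [|i _].
    by apply: mul_continuous.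
  apply: (@continuous_comp _ _ _ (fun v : 'rV[R]_d => v 0 i) (fun t => t ^+ p.2 0 i)).
    exact: coord_continuous.
  exact: exprn_continuous.
move=> xi; under eq_fun do rewrite big_cons; exact: cvgD (cvgM (cvg_cst _) (cm xi)) (IH xi).
Qed.

Lemma cR_cancel (c : R) (W : R[i]) : c != 0 -> cR c * (cR c^-1 * W) = W.
Proof.
by move=> c0; apply: complex_eq; rewrite !(creM, cimM) /=; field.
Qed.

Lemma twopi_neq0 : (2 * pi) ^+ d != 0 :> R.
Proof. by rewrite expf_neq0// mulf_neq0// gt_eqF// pi_gt0. Qed.

Lemma Hpos_vint (P Q : 'rV[R]_d -> R) E n y : gauge P E -> measurable_fun setT Q ->
  (0 < n)%N -> cR ((2 * pi) ^+ d) * Hpos P Q n%:R y =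
  Complex (vint (hom P Q n y 0)) (vint (hom P Q n y (pi / 2))).
Proof.
move=> gP mQ n0; rewrite /Hpos cR_cancel ?twopi_neq0//.
have nR : 0 < n%:R :> R by rewrite ltr0n.
have [C _ HC] := exp_gauge_decay gP nR.
have key c : iint (hom P Q n y c) = vint (hom P Q n y c).
  by apply: (iint_leb (measurable_hom gP mQ n y c)) => v; exact: le_trans (hom_le _ _ _ _ _ _) (HC v).
rewrite -!key /ciint; congr Complex; congr iint; apply/funext => xi; rewrite /cexp /= /hom.
  by rewrite -cosN; congr (_ * cos _); ring.
by rewrite cosD cos_pihalf sin_pihalf -opprD sinN; ring.
Qed.

(** The [lim] in [Himag] is total, so its value is read off from limits supplied as hypotheses. The
    truncated integrand is at most exp(tau - |Q|), which makes the iterated integrals genuine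
    ones. *)
Lemma Himag_lim (Q : 'rV[R]_d -> R) E n y L0 L1 : gauge (fun xi => `|Q xi|) E ->
  continuous Q ->
  vint (cut (fun xi => `|Q xi| < tau) (ihom Q n y 0)) @[tau --> +oo] --> L0 ->
  vint (cut (fun xi => `|Q xi| < tau) (ihom Q n y (pi / 2))) @[tau --> +oo] --> L1 ->
  cR ((2 * pi) ^+ d) * Himag Q n%:R y = Complex L0 L1.
Proof.
move=> gQ cQ l0 l1; rewrite /Himag cR_cancel ?twopi_neq0//.
have [C C0 HC] := exp_gauge_decay gQ (@ltr01 R).
have key c tau : iint (cut (fun xi => `|Q xi| < tau) (ihom Q n y c)) =
    vint (cut (fun xi => `|Q xi| < tau) (ihom Q n y c)).
  apply: (@iint_leb _ _ _ (expR tau * C)) => [|v].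
    by apply: measurable_cut; [exact: measurable_gauge_lt gQ tau|exact: measurable_ihom].
  rewrite /cut; case: ifP => [h|_]; last first.
    by rewrite normr0 mulr_ge0 ?(ltW (decay_gt0 v))// mulr_ge0 ?expR_ge0// ltW.
  apply: le_trans (norm_cos_le1 _) _; rewrite -mulrA.
  apply: le_trans (ler_wpM2l (expR_ge0 tau) (HC v)); rewrite -expRD mul1r -expR0 ler_expR.
  by rewrite subr_ge0 ltW.
congr Complex; apply/cvg_lim => //.
  rewrite [X in X @ _](_ : _ = fun tau => vint (cut (fun xi => `|Q xi| < tau) (ihom Q n y 0)))//.
  apply/funext => tau; rewrite -key; congr iint; apply/funext => xi; rewrite /cut; case: ifP => // _.
  by rewrite /cexp /= expR0 mul1r -cosN /ihom; congr cos; ring.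
rewrite [X in X @ _](_ : _ = fun tau => vint (cut (fun xi => `|Q xi| < tau) (ihom Q n y (pi / 2))))//.
apply/funext => tau; rewrite -key; congr iint; apply/funext => xi; rewrite /cut; case: ifP => // _.
by rewrite /cexp /= expR0 mul1r /ihom cosD cos_pihalf sin_pihalf -opprD sinN; ring.
Qed.

Variable phi : 'rV[int]_d -> R[i].
Hypotheses (Sphi : in_Sd phi) (phi1 : forall xi, cmod (fhat phi xi) <= 1).

Definition point_term (D : tdata R d) xi n x := base_factor phi xi n x *
  (if td_pos D then Hpos (td_R D) (td_Q D) n%:R (zR x - n%:R *: td_alpha D)
   else Himag (td_Q D) n%:R (zR x - n%:R *: td_alpha D)).

(* Imaginary points only allow bounded displacements from the drift. *)
Definition admissible (D : tdata R d) (r : R) n (x : 'rV[int]_d) : Prop :=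
  td_pos D \/ `|zR x - n%:R *: td_alpha D| <= r.

(** All that the global argument needs from a point, whatever its type: [lm_approx] serves the
    points of minimal order, [lm_bound] the others. *)
Record local_model (D : tdata R d) (xi0 : 'rV[R]_d) (b : 'rV[R]_d -> bool) : Prop := LocalModel {
  lm_meas : measurable_fun setT b;
  lm_nbhs : exists2 r, 0 < r & forall xi, `|xi - xi0| < r -> b xi;
  lm_isolated : forall xi, b xi -> cmod (fhat phi xi) = 1 -> xi = xi0;
  lm_bound : forall r, exists C N, 0 <= C /\ forall n x, (N <= n)%N -> admissible D r n x ->
    cmod (Cint b (spectral phi n x)) <= C * n%:R `^ (- mu_pt D);
  lm_approx : forall r eps, 0 < eps -> exists N, forall n x, (N <= n)%N -> admissible D r n x ->
    cmod (Cint b (spectral phi n x) - cR ((2 * pi) ^+ d) * point_term D xi0 n x) <=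
    eps * n%:R `^ (- mu_pt D) }.

Variables (xi0 : 'rV[R]_d) (D : tdata R d).
Hypothesis h1 : cmod (fhat phi xi0) = 1.

Lemma local_model_pos rad : td_pos D -> pos_type phi xi0 D -> 0 < rad ->
  exists2 b, local_model D xi0 b & forall xi, b xi -> `|xi - xi0| < rad.
Proof.
move=> tp [[nQ [nR [Qt0 [Rt0 [_ [_ [rx [rx0 Hx]]]]]]]] [pR [hR [hQ [sQ sR]]]]] rad0.
have [cR [R0 [Req [_ Rc]]]] := pR.
have gP : gauge (td_R D) (td_E D) := Gauge cR R0 Req hR Rc sQ.1.
have mQ := continuous_measurable_rV (poly_nolin_continuous nQ).
have [d1 d10 H1] := pos_radius_ex gP Rt0 sR.
have m0 : 0 < Num.min rx rad by rewrite lt_min rx0.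
have [d2 d20 H2] := gauge_small gP m0.
pose del := Num.min d1 d2; have del0 : 0 < del by rewrite lt_min d10.
have HP : pos_radius (td_R D) (td_Rt D) del.
  by move=> xi; rewrite lt_min => /andP[h _]; exact: H1.
have Hd eta : td_R D eta < del -> `|eta| < rx /\ `|eta| < rad.
  by rewrite lt_min => /andP[_ /H2]; rewrite lt_min => /andP[].
have Hexp eta : td_R D eta < del -> fhat phi (eta + xi0) / fhat phi xi0 =
    cexp (Complex (- (td_R D eta + td_Rt D eta))
                  (dot (td_alpha D) eta - (td_Q D eta + td_Qt D eta))).
  by move=> /Hd[h _]; apply: Hx; apply/ball0P.
exists (fun xi => td_R D (xi - xi0) < del); last by move=> xi /Hd[].
have ml := measurable_loc Sphi gP Hexp.
split.
- exact: measurable_shifted_ball gP.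
- exact: shifted_ball_nbhs gP del0.
- move=> xi; apply: (fhat_isolated h1 Hexp) => eta h n0.
  have := HP _ h; have := gauge_gt0 gP n0; rewrite ler_norml => ? /andP[]; lra.
- move=> r; have [C C0 HC] := local_pos_bound gP HP ml.
  exists (2 * C), 1%N; split; first by rewrite mulr_ge0.
  move=> n x n0 _; rewrite -mulrA.
  by apply: (Cint_local_le Sphi phi1 h1 gP Hexp) => c; exact: HC.
- move=> r eps e0; have e20 : 0 < eps / 2 by rewrite divr_gt0.
  have [N HN] := local_pos gP mQ Rt0 Qt0 sR sQ del0 HP ml e20.
  exists (maxn 1 N) => n x; rewrite geq_max => /andP[n0 Nn] _.
  rewrite /point_term tp mulrCA (Hpos_vint _ gP mQ n0).
  have -> : eps * n%:R `^ (- mu_pt D) = 2 * (eps / 2 * n%:R `^ (- mu_pt D)) by field.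
  by apply: (Cint_local_sub Sphi phi1 h1 gP Hexp); exact: HN.
Qed.

Lemma local_model_imag rad : ~~ td_pos D -> imag_type phi xi0 D -> mu_pt D < 1 -> 0 < rad ->
  exists2 b, local_model D xi0 b & forall xi, b xi -> `|xi - xi0| < rad.
Proof.
move=> tp [[nQ [nR [Qt0 [Rt0 [_ [_ [rx [rx0 Hx]]]]]]]] [pQ [pR [hQ [k1 [hR [sQ sR]]]]]]] mu1 rad0.
have [cQ [Q0 [Qeq [_ Qc]]]] := pQ; have [cR [R0 [Req [_ Rc]]]] := pR.
have gP : gauge (fun xi => `|td_Q D xi|) (td_E D) := Gauge cQ Q0 Qeq hQ Qc sQ.1.
have gR : gauge (td_R D) ((td_k D)^-1 *: td_E D) := Gauge cR R0 Req hR Rc sR.1.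
have cQ' := poly_nolin_continuous nQ.
have [d1 d10 H1] := imag_radius_ex gP k1 gR Rt0 sQ sR.
have m0 : 0 < Num.min rx rad by rewrite lt_min rx0.
have [d2 d20 H2] := gauge_small gP m0.
(* Halved so that del < d1: the ray estimate needs derivatives up to and including |Q| = del. *)
pose del := Num.min (d1 / 2) d2; have del0 : 0 < del by rewrite lt_min d20 divr_gt0.
have deld : del < d1 by rewrite gt_min; apply/orP; left; lra.
have Hd eta : `|td_Q D eta| < del -> `|eta| < rx /\ `|eta| < rad.
  by rewrite lt_min => /andP[_ /H2]; rewrite lt_min => /andP[].
have Hexp eta : `|td_Q D eta| < del -> fhat phi (eta + xi0) / fhat phi xi0 =
    cexp (Complex (- (td_R D eta + td_Rt D eta))
                  (dot (td_alpha D) eta - (td_Q D eta + td_Qt D eta))).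
  by move=> /Hd[h _]; apply: Hx; apply/ball0P.
exists (fun xi => `|td_Q D (xi - xi0)| < del); last by move=> xi /Hd[].
have ml := measurable_loc Sphi gP Hexp.
split.
- exact: measurable_shifted_ball gP.
- exact: shifted_ball_nbhs gP del0.
- move=> xi; apply: (fhat_isolated h1 Hexp) => eta h n0.
  have := H1.1 _ (lt_trans h deld); have := gauge_gt0 gR n0; rewrite ler_norml => ? /andP[]; lra.
- move=> r; have [C [N [C0 HC]]] := local_imag_bound gP cQ' k1 gR mu1 del0 deld H1 ml r.
  exists (2 * C), N; split; first by rewrite mulr_ge0.
  move=> n x n0 [tp'|hx]; first by rewrite tp' in tp.
  by rewrite -mulrA; apply: (Cint_local_le Sphi phi1 h1 gP Hexp) => c; exact: HC.
- move=> r eps e0; have e20 : 0 < eps / 2 by rewrite divr_gt0.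
  have [N HN] := local_imag gP cQ' k1 gR Qt0 sQ mu1 del0 deld H1 ml r e20.
  exists N => n x Nn [tp'|hx]; first by rewrite tp' in tp.
  have [L0 l0 b0] := HN n _ 0 Nn hx; have [L1 l1 b1] := HN n _ (pi / 2) Nn hx.
  rewrite /point_term (negPf tp) mulrCA (Himag_lim gP cQ' l0 l1).
  have -> : eps * n%:R `^ (- mu_pt D) = 2 * (eps / 2 * n%:R `^ (- mu_pt D)) by field.
  exact: (Cint_local_sub Sphi phi1 h1 gP Hexp).
Qed.

End LocalModels.

(** * Global asymptotics *)

Section Frequencies.
Context {R : realType} {d : nat}.

Lemma near_seq (U : Type) (F : set_system U) (I : eqType) (s : seq I) (A : I -> U -> Prop) :
  Filter F -> (forall i, i \in s -> \forall u \near F, A i u) ->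
  \forall u \near F, forall i, i \in s -> A i u.
Proof.
move=> FF; elim: s => [|i s IH] H; first by apply: filterE => u j.
have h1 := H i (mem_head _ _).
have h2 := IH (fun j js => H j (mem_behead (s := i :: s) js)).
apply: filterS2 h1 h2 => u a b j; rewrite inE => /predU1P[->|]//; exact: b.
Qed.

Lemma powR_negligible (mu nu C eps : R) : mu < nu -> 0 <= C -> 0 < eps ->
  \forall n \near \oo, C * n%:R `^ (- nu) <= eps * n%:R `^ (- mu).
Proof.
move=> mn C0 e0; pose a := nu - mu; have a0 : 0 < a by rewrite subr_gt0.
pose x := (C / eps) `^ a^-1.
have Ce0 : 0 <= C / eps by rewrite divr_ge0// ltW.
exists (Num.trunc x).+1 => // n /= hn.
have n0 : 0 < n%:R :> R by rewrite ltr0n (leq_trans _ hn).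
have xn : x <= n%:R.
  by apply: ltW; apply: lt_le_trans (truncnS_gt x) _; rewrite ler_nat.
have -> : - nu = - mu + - a by rewrite /a; ring.
rewrite powRD; last by apply/implyP => _; rewrite gt_eqF.
rewrite mulrCA mulrC ler_pM2r ?powR_gt0// powRN ler_pdivrMr ?powR_gt0// mulrC -ler_pdivrMr//.
have -> : C / eps = x `^ a by rewrite /x -powRrM mulVf ?gt_eqF// powRr1.
by rewrite ge0_ler_powR// ?nnegrE ?powR_ge0 ?(ltW a0)// ltW.
Qed.

Lemma geometric_negligible (mu rho C eps : R) : 0 <= rho -> rho < 1 -> 0 <= C -> 0 < eps ->
  \forall n \near \oo, C * rho ^+ n <= eps * n%:R `^ (- mu).
Proof.
(* Kept positive so that q^n = exp(n ln q), even when rho = 0. *)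
move=> r0 r1 C0 e0; pose q := Num.max rho 2^-1.
have q0 : 0 < q by rewrite lt_max invr_gt0 ltr0n orbT.
have q1 : q < 1 by rewrite gt_max r1 /= invf_lt1// ltr1n.
have c0 : 0 < - ln q by rewrite oppr_gt0 ln_lt0// q0.
pose m := (Num.trunc mu).+1; have mm : mu < m%:R by exact: truncnS_gt.
have [K K0 HK] := exp_ge_pow m c0.
have H := powR_negligible mm (mulr_ge0 C0 (ltW K0)) e0.
near=> n; have n0 : (0 < n)%N by near: n; exact: nbhs_infty_gt.
have h : C * K * n%:R `^ (- m%:R) <= eps * n%:R `^ (- mu) by near: n.
apply: le_trans h; rewrite -mulrA ler_wpM2l//.
have -> : n%:R `^ (- m%:R) = (n%:R ^+ m)^-1 :> R by rewrite powRN powR_mulrn.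
have nR : 0 < n%:R :> R by rewrite ltr0n.
rewrite ler_pdivlMr ?exprn_gt0//.
have e1 : q ^+ n = (expR (- ln q * n%:R))^-1.
  by rewrite -expRN mulNr opprK expRM_natr lnK// posrE.
have h1 : rho ^+ n <= q ^+ n by apply: lerXn2r; rewrite ?nnegrE ?(ltW q0)// le_max lexx.
have h2 : n%:R ^+ m <= (1 + n%:R) ^+ m :> R.
  by apply: lerXn2r; rewrite ?nnegrE ?addr_ge0// lerDr.
apply: le_trans (ler_pM _ _ h1 (le_trans h2 (HK _ (ltW nR)))) _; rewrite ?exprn_ge0//.
by rewrite e1 mulrCA mulVf ?mulr1// gt_eqF// expR_gt0.
Unshelve. all: by end_near. Qed.

Variable phi : 'rV[int]_d -> R[i].
Hypotheses (Sphi : in_Sd phi) (phi1 : forall xi, cmod (fhat phi xi) <= 1).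

Lemma fhat_periodic xi (k : 'rV[int]_d) : fhat phi (xi + (2 * pi) *: zR k) = fhat phi xi.
Proof.
congr zsum; apply/funext => x; congr (_ * _); rewrite dotDr.
have -> : dot (zR x) ((2 * pi) *: zR k) = (\sum_i x 0 i * k 0 i)%:~R * (2 * pi) :> R.
  rewrite /dot rmorph_sum mulr_suml; apply: eq_bigr => i _; rewrite !mxE rmorphM /=; ring.
by apply: complex_eq; rewrite /cexp /= ?cos_periodz ?sin_periodz.
Qed.

Lemma reduce_frequency (xi : 'rV[R]_d) :
  exists k : 'rV[int]_d, forall i, - pi < (xi + (2 * pi) *: zR k) 0 i <= pi.
Proof.
(* A ceiling, to match an interval that is open at -pi and closed at pi. *)
have p0 := pi_gt0 R; pose c i := Num.ceil ((xi 0 i - pi) / (2 * pi)).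
exists (\row_i (- c i)) => i; rewrite !mxE mulrNz.
have := ceil_itv ((xi 0 i - pi) / (2 * pi)); rewrite -/(c i) intrB.
rewrite ltr_pdivlMr ?mulr_gt0// ler_pdivrMr ?mulr_gt0// => /andP[h1 h2].
by apply/andP; split; lra.
Qed.

Lemma continuous_cmod_fhat : continuous (fun xi => cmod (fhat phi xi)).
Proof.
have [c1 c2] := continuous_fhat Sphi.
have cX : continuous (fun xi => cre (fhat phi xi) ^+ 2 + cim (fhat phi xi) ^+ 2).
  by move=> xi; exact: (cvgD (cvgM (c1 xi) (c1 xi)) (cvgM (c2 xi) (c2 xi))).
move=> xi; apply: (@continuous_comp _ _ _ _ (@Num.sqrt R) xi (cX xi)).
exact: sqrt_continuous.
Qed.

Lemma box_compact (e : R) : compact [set xi : 'rV[R]_d | box e xi].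
Proof.
have := @rV_compact R d (fun _ => `[e - pi, e + pi]%classic) (fun _ => @segment_compact R _ _).
congr compact; apply/seteqP; split => xi /= H.
  by apply/boxP => i; have := H i; rewrite /= in_itv /= ler_distl.
by move=> i; have /boxP/(_ i) := H; rewrite /= in_itv /= ler_distl.
Qed.

Lemma box_cover (e : R) (U : 'rV[R]_d -> set 'rV[R]_d) : (forall z, box e z -> nbhs z (U z)) ->
  exists s : seq 'rV[R]_d, (forall z, z \in s -> box e z) /\
    forall xi, box e xi -> exists2 z, z \in s & U z xi.
Proof.
move=> nU; have := @box_compact e; rewrite compact_cover.
move=> /(_ _ [set xi | box e xi] (fun z => interior (U z))) [].
- by move=> z _; exact: open_interior.
- by move=> z bz; exists z => //; exact: nU.
move=> D' DB H; exists (finmap.enum_fset D'); split=> [z zD|xi bxi]; first by have := DB z zD; rewrite inE.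
by have [z zD Uz] := H xi bxi; exists z => //; exact: interior_subset Uz.
Qed.

Hypothesis isoP : forall z, Omega phi z ->
  \forall xi \near z, cmod (fhat phi xi) = 1 -> xi = z.

(** Periodicity carries isolation from the half-open cell to the whole space, so that compactness
    can be used on closed cubes; where |fhat| differs from 1 continuity suffices. *)
Lemma unit_isolated z : \forall xi \near z, cmod (fhat phi xi) = 1 -> xi = z.
Proof.
have [h1|h1] := eqVneq (cmod (fhat phi z)) 1; last first.
  have /cvgrPdist_lt /(_ `|cmod (fhat phi z) - 1|) := continuous_cmod_fhat (x := z).
  rewrite normr_gt0 subr_eq0 => /(_ h1); apply: filterS => xi /[swap] ->.
  by rewrite ltxx.
have [k Hk] := reduce_frequency z.
have Oz : Omega phi (z + (2 * pi) *: zR k) by split => //; rewrite fhat_periodic.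
have /nbhs_ballP[r /= r0 Hr] := isoP Oz.
apply/nbhs_ballP; exists r => // xi bxi hx.
apply: (addIr ((2 * pi) *: zR k)); apply: Hr; last by rewrite fhat_periodic.
by move: bxi; rewrite -!ball_normE /= opprD addrACA subrr addr0.
Qed.

(** Finitely many isolating neighbourhoods cover the closed cube, and each contains no point of
    Omega but possibly its centre. *)
Lemma Omega_finite : exists2 S : seq 'rV[R]_d, uniq S & forall xi, xi \in S <-> Omega phi xi.
Proof.
have [s [_ Hs]] := box_cover (fun z (_ : box 0 z) => unit_isolated z).
exists (undup [seq z <- s | `[<Omega phi z>]]); first exact: undup_uniq.
move=> xi; rewrite mem_undup mem_filter; split; first by move=> /andP[/asboolP].
move=> O; apply/andP; split; first exact/asboolP.
have [|z zs /(_ O.2) ->//] := Hs xi.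
by apply/boxP => i; have := O.1 i; rewrite subr0 ler_norml => /andP[/ltW -> ->].
Qed.

Variable S : seq 'rV[R]_d.
Hypothesis SP : forall xi, xi \in S <-> Omega phi xi.

(* A slightly translated period box has all of [Omega] in its interior. *)
Lemma good_box : exists e, exists2 m, 0 < m &
  (forall z, z \in S -> forall xi, `|xi - z| < m -> box e xi) /\
  (forall xi, box e xi -> cmod (fhat phi xi) = 1 -> xi \in S).
Proof.
have p0 := pi_gt0 R.
(* Room 2 m on the left lets the cube centred at (m, ..., m) leave a margin m on both sides; on the
   right z_i <= pi is enough. *)
have : \forall m \near 0^'+, forall z, z \in S -> forall i, - pi + 2 * m < z 0 i :> R.
  apply: near_seq => z /SP[zP _].
  suff : \forall m \near 0^'+, forall i, i \in enum 'I_d -> - pi + 2 * m < z 0 i.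
    by apply: filterS => m H i; apply: H; rewrite mem_enum.
  apply: near_seq => i _; have /andP[zi _] := zP i.
  have g0 : 0 < (z 0 i + pi) / 2 by rewrite divr_gt0//; lra.
  by apply: filterS (nbhs_right_lt g0) => m; rewrite ltr_pdivlMr// => h; lra.
move=> H; have [m [m0 Hm]] := @filter_ex _ _ _ _ (filterI (nbhs_right_gt 0) H).
exists m, m => //; split=> [z zS xi hx|xi bxi h1].
  apply/boxP => i; have := coord_le_norm (xi - z) i; rewrite !mxE => /le_lt_trans /(_ hx).
  have := Hm z zS i; have /SP[/(_ i) /andP[_ zp] _] := zS.
  rewrite ltr_norml ler_norml => h /andP[a b]; apply/andP; split; lra.
have [k Hk] := reduce_frequency xi.
have zS : xi + (2 * pi) *: zR k \in S by apply/SP; split => //; rewrite fhat_periodic.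
(* The translate into the cell lies in [S], and the two sets of bounds give |2 pi k_i| < 2 pi. *)
suff k0 : k = 0 by move: zS; rewrite k0 (_ : zR 0 = 0) ?scaler0 ?addr0//; apply/rowP => i; rewrite !mxE.
apply/rowP => i; rewrite mxE; have := Hm _ zS i; have := Hk i.
rewrite !mxE => /andP[_ a1] a2; have /boxP/(_ i) := bxi; rewrite ler_norml => /andP[a3 a4].
have b1 : (k 0 i)%:~R < 1 :> R by nra.
have b2 : (- k 0 i)%:~R < 1 :> R by rewrite mulrNz; nra.
apply/eqP; rewrite eq_le -oppr_le0 -!ltzD1 !add0r; apply/andP.
by split; rewrite -(@ltrz1 R).
Qed.

(** A bound below 1 holds locally: vacuously near a point of [S], whose neighbourhood is removed,
    and by continuity elsewhere. A finite subcover makes it uniform. *)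
Lemma rest_small (e : R) (b : 'rV[R]_d -> 'rV[R]_d -> bool) :
  (forall xi, box e xi -> cmod (fhat phi xi) = 1 -> xi \in S) ->
  (forall z, z \in S -> \forall xi \near z, b z xi) ->
  exists rho, [/\ 0 <= rho, rho < 1 & forall xi, box e xi -> all (fun z => ~~ b z xi) S ->
    cmod (fhat phi xi) <= rho].
Proof.
move=> boxS bS.
have loc_rho z : exists rho, box e z -> rho < 1 /\
    (\forall xi \near z, box e xi -> all (fun z => ~~ b z xi) S -> cmod (fhat phi xi) <= rho).
  have [bz|bz] := boolP (box e z); last by exists 0.
  have [zS|zS] := boolP (z \in S).
    exists 0; split => //; apply: filterS (bS _ zS) => xi bxi _ /allP /(_ _ zS).
    by rewrite bxi.
  have lt1 : cmod (fhat phi z) < 1.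
    by rewrite lt_neqAle phi1 andbT; apply: contra zS => /eqP; exact: boxS.
  exists ((cmod (fhat phi z) + 1) / 2); split; first by lra.
  have g0 : 0 < (1 - cmod (fhat phi z)) / 2 by lra.
  have /cvgrPdist_lt /(_ _ g0) := continuous_cmod_fhat (x := z); apply: filterS => xi.
  by rewrite ltr_norml => /andP[a c] _ _; lra.
have [rho Hrho] := choice loc_rho.
have [s [sB Hs]] := box_cover (fun z bz => (Hrho z bz).2).
have : \forall q \near 1^'-, forall z, z \in s -> rho z < q.
  by apply: near_seq => z zs; apply: nbhs_left_gt; exact: (Hrho z (sB _ zs)).1.
move=> H; have [q [[q1 q0] Hq]] :=
  @filter_ex _ _ _ _ (filterI (filterI (nbhs_left_lt 1) (nbhs_left_gt (@ltr01 R))) H).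
exists q; split => //; first exact: ltW.
by move=> xi bxi al; have [z zs Uz] := Hs xi bxi; apply: le_trans (Uz bxi al) _; exact: ltW (Hq _ zs).
Qed.

End Frequencies.

Section GlobalAsymptotics.
Context {R : realType} {d : nat}.

Lemma cmod_sum (I : eqType) (s : seq I) (F : I -> R[i]) (c : R) :
  (forall i, i \in s -> cmod (F i) <= c) -> cmod (\sum_(i <- s) F i) <= (size s)%:R * c.
Proof.
elim: s => [|i s IH] H; first by rewrite big_nil cmod0 mul0r.
rewrite big_cons /= -natr1 mulrDl mul1r; apply: le_trans (cmodD _ _) _.
rewrite addrC; apply: lerD; last by apply: H; rewrite mem_head.
by apply: IH => j js; apply: H; rewrite inE js orbT.
Qed.

Lemma Cint_split (e : R) (f : 'rV[R]_d -> R[i]) (S : seq 'rV[R]_d)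
    (b : 'rV[R]_d -> 'rV[R]_d -> bool) (b0 : 'rV[R]_d -> bool) :
  ccont f -> (forall xi, cmod (f xi) <= 1) -> measurable_fun setT b0 ->
  (forall xi, b0 xi -> box e xi) ->
  (forall z, z \in S -> measurable_fun setT (b z)) ->
  (forall z, z \in S -> forall xi, b z xi -> b0 xi) -> uniq S ->
  (forall z z', z \in S -> z' \in S -> z != z' -> forall xi, b z xi -> ~~ b z' xi) ->
  measurable_fun setT (fun xi => b0 xi && all (fun z => ~~ b z xi) S) /\
  Cint b0 f = \sum_(z <- S) Cint (b z) f +
    Cint (fun xi => b0 xi && all (fun z => ~~ b z xi) S) f.
Proof.
move=> cf f1; elim: S b0 => [|z S IH] b0 m0 b0B mb bb0 uS dis.
  have -> : (fun xi => b0 xi && all (fun z => ~~ b z xi) [::]) = b0.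
    by apply/funext => xi; rewrite andbT.
  by rewrite big_nil add0r.
have zS : z \in z :: S by exact: mem_head.
have SS z' : z' \in S -> z' \in z :: S by move=> h; rewrite inE h orbT.
pose b1 xi := b0 xi && ~~ b z xi.
have m1 : measurable_fun setT b1.
  by apply: measurable_and => //; apply: measurable_neg; exact: mb.
have -> : (fun xi => b0 xi && all (fun z => ~~ b z xi) (z :: S)) =
    (fun xi => b1 xi && all (fun z => ~~ b z xi) S).
  by apply/funext => xi; rewrite /b1 /= andbA.
move: uS => /= /andP[zS' uS].
have [] := IH b1 m1 _ _ _ uS.
- by move=> xi /andP[/b0B].
- by move=> z' /SS; exact: mb.
- move=> z' z'S xi bz'; rewrite /b1 (bb0 _ (SS _ z'S) _ bz') /=.
  by apply: dis bz' => //; [exact: SS|apply: contraNneq zS' => <-].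
- by move=> u v uS' vS'; apply: dis; exact: SS.
move=> mr IHe; split => //; rewrite big_cons -addrA -IHe.
have [[i1 i2] _] := Cint_box (mb _ zS) cf (fun xi h => b0B _ (bb0 _ zS _ h)) ler01 (fun xi _ => f1 xi).
have [[j1 j2] _] := Cint_box m1 cf (fun xi (h : b1 xi) => b0B _ (andP h).1) ler01 (fun xi _ => f1 xi).
have cutE (g : 'rV[R]_d -> R) : cut b0 g = fun v => cut (b z) g v + cut b1 g v.
  apply/funext => v; rewrite /cut /b1; have := bb0 _ zS v.
  by case: (b z v) => [->|_] //=; rewrite ?andbF ?andbT ?addr0 ?add0r.
by apply: complex_eq; rewrite ?creD ?cimD /Cint /= cutE; exact: vintD.
Qed.

Variables (phi : 'rV[int]_d -> R[i]) (D : 'rV[R]_d -> tdata R d).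
Hypotheses (Sphi : in_Sd phi) (phi1 : forall xi, cmod (fhat phi xi) <= 1).
Hypothesis types : forall xi, Omega phi xi ->
  if td_pos (D xi) then pos_type phi xi (D xi) else imag_type phi xi (D xi).
Hypothesis imag_lt1 : forall xi, Omega phi xi -> ~~ td_pos (D xi) -> mu_pt (D xi) < 1.

Lemma local_model_ex xi rad : Omega phi xi -> 0 < rad ->
  exists2 b, local_model phi (D xi) xi b & forall v, b v -> `|v - xi| < rad.
Proof.
move=> O rad0; have := types O; case: ifP => [tp|/negbT tp] ty.
  exact: (local_model_pos Sphi phi1 O.2 tp ty rad0).
exact: (local_model_imag Sphi phi1 O.2 tp ty (imag_lt1 O tp) rad0).
Qed.

(** The threshold is uniform over the [x] admissible at every point of [S]; this one estimate, with
    its sum regrouped by type, yields all three cases. *)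
Lemma global_asymptotics : exists2 S : seq 'rV[R]_d,
  uniq S /\ (forall xi, xi \in S <-> Omega phi xi) &
  forall mu, (forall xi, Omega phi xi -> mu <= mu_pt (D xi)) -> forall r eps, 0 < eps ->
  exists N, forall n x, (N <= n)%N -> (forall z, z \in S -> admissible (D z) r n x) ->
    cmod (cpow phi n x - \sum_(z <- S | mu_pt (D z) == mu) point_term phi (D z) z n x) <=
    eps * n%:R `^ (- mu).
Proof.
have iso z : Omega phi z -> \forall xi \near z, cmod (fhat phi xi) = 1 -> xi = z.
  move=> Oz; have [b lm _] := local_model_ex Oz (@ltr01 R).
  have [r r0 Hr] := lm_nbhs lm; apply/nbhs_ballP; exists r => // xi.
  by rewrite -ball_normE /= distrC => h; exact: (lm_isolated lm) (Hr _ h).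
have [S uS SP] := Omega_finite Sphi iso; exists S => // mu mu_min r eps eps0.
have [e [m m0 [inB outB]]] := good_box SP.
(* At most half the distance between any two points of [S], so that neighbourhoods of that radius
   are disjoint. *)
have : \forall h \near 0^'+, forall z, z \in S -> forall z', z' \in S ->
    z != z' -> h + h <= `|z - z'| :> R.
  apply: near_seq => z _; apply: near_seq => z' _; have [->|zz'] := eqVneq z z'.
    by apply: filterE.
  have g0 : 0 < `|z - z'| / 2 by rewrite divr_gt0// normr_gt0 subr_eq0.
  by apply: filterS (nbhs_right_lt g0) => h hz _; lra.
move=> H; have [h [h0 Hsep]] := @filter_ex _ _ _ _ (filterI (nbhs_right_gt 0) H).
have rad0 : 0 < Num.min m h by rewrite lt_min m0.
have exb z : exists b, z \in S ->
    local_model phi (D z) z b /\ forall v, b v -> `|v - z| < Num.min m h.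
  have [/SP O|zS] := boolP (z \in S); last by exists (fun=> false).
  by have [b lm hb] := local_model_ex O rad0; exists b.
have [b Hb] := choice exb.
have bB z : z \in S -> forall xi, b z xi -> box e xi.
  move=> zS xi /(Hb z zS).2; rewrite lt_min => /andP[+ _]; exact: inB.
have dis z z' : z \in S -> z' \in S -> z != z' -> forall xi, b z xi -> ~~ b z' xi.
  move=> zS z'S zz' xi /(Hb z zS).2; rewrite lt_min => /andP[_ h1].
  apply/negP => /(Hb z' z'S).2; rewrite lt_min => /andP[_ h2].
  have := Hsep _ zS _ z'S zz'; rewrite leNgt => /negP; apply.
  have -> : z - z' = (xi - z') - (xi - z) by rewrite opprB [RHS]addrC addrA subrK.
  by apply: le_lt_trans (ler_normB _ _) _; rewrite addrC; exact: ltrD.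
have bn z : z \in S -> \forall xi \near z, b z xi.
  move=> zS; have [q q0 Hq] := lm_nbhs (Hb z zS).1; apply/nbhs_ballP; exists q => // xi.
  by rewrite -ball_normE /= distrC; exact: Hq.
have [rho [rho0 rho1 Hrho]] := rest_small Sphi phi1 outB bn.
have rest_le n x xi : box e xi -> all (fun z => ~~ b z xi) S ->
    cmod (spectral phi n x xi) <= rho ^+ n.
  move=> bx al; rewrite cmod_spectral.
  by apply: lerXn2r; rewrite ?nnegrE ?cmod_ge0 ?Hrho.
pose c : R := (2 * pi) ^+ d; have c0 : 0 < c by rewrite exprn_gt0// mulr_gt0// pi_gt0.
(* One share of the error for each point of [S] and one for the remainder. *)
pose ep : R := eps * c / (size S).+1%:R.
have ep0 : 0 < ep by rewrite divr_gt0// mulr_gt0.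
(* Points of larger order get main term 0: their whole contribution is o(n^-mu). *)
pose tm z n x : R[i] := if mu_pt (D z) == mu then cR c * point_term phi (D z) z n x else 0.
have near_pt : \forall n \near \oo, forall z, z \in S -> forall x, admissible (D z) r n x ->
    cmod (Cint (b z) (spectral phi n x) - tm z n x) <= ep * n%:R `^ (- mu).
  apply: near_seq => z zS; have lm := (Hb z zS).1; rewrite /tm.
  have [muz|muz] := eqVneq (mu_pt (D z)) mu.
    have [N HN] := lm_approx lm r ep0; exists N => // n /= Nn x ad.
    by rewrite -muz; exact: HN.
  have lt : mu < mu_pt (D z) by rewrite lt_neqAle eq_sym muz mu_min//; exact/SP.
  have [C [N [C0 HC]]] := lm_bound lm r.
  have [N' _ HN'] := powR_negligible lt C0 ep0.
  exists (maxn N N') => // n /=; rewrite geq_max => /andP[h1 h2] x ad.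
  by rewrite subr0; apply: le_trans (HC _ _ h1 ad) _; exact: HN'.
have V0 : 0 <= 2 * boxvol e (d := d) by rewrite mulr_ge0// boxvol_ge0.
have near_rest := geometric_negligible mu rho0 rho1 V0 ep0.
have [N _ HN] := filterI near_pt near_rest.
exists N => n x Nn ad; have [Hpt Hr] := HN n Nn.
have cS := ccont_spectral Sphi n x; have s1 := spectral_le1 phi1 n x.
have [mr E] := Cint_split cS s1 (@measurable_box R d e) (fun xi => id)
  (fun z zS => lm_meas (Hb z zS).1) bB uS dis.
have [_ hr] := Cint_box (M := rho ^+ n) mr cS (fun xi h => (andP h).1) (exprn_ge0 n rho0)
  (fun xi h => rest_le n x xi (andP h).1 (andP h).2).
have eqn : cR c * (cpow phi n x - \sum_(z <- S | mu_pt (D z) == mu) point_term phi (D z) z n x) =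
    \sum_(z <- S) (Cint (b z) (spectral phi n x) - tm z n x) +
    Cint (fun xi => box e xi && all (fun z => ~~ b z xi) S) (spectral phi n x).
  rewrite mulrBr (spectral_inversion e Sphi phi1) E sumrB addrAC; congr (_ - _ + _).
  by rewrite mulr_sumr big_mkcond; apply: eq_bigr => z _; rewrite /tm; case: ifP.
have cc : cmod (cR c) = c by rewrite /cmod /cR /= expr0n /= addr0 sqrtr_sqr gtr0_norm.
rewrite -(ler_pM2l c0) -{1}cc -cmodM eqn; apply: le_trans (cmodD _ _) _.
have h1 := cmod_sum (fun z zS => Hpt z zS x (ad z zS)).
have h2 : cmod (Cint (fun xi => box e xi && all (fun z => ~~ b z xi) S) (spectral phi n x)) <=
    ep * n%:R `^ (- mu) by apply: le_trans hr _; rewrite mulrAC; exact: Hr.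
apply: le_trans (lerD h1 h2) _.
rewrite -[X in _ + X]mul1r -mulrDl natr1 mulrA /ep.
have sn : (size S).+1%:R != 0 :> R by rewrite pnatr_eq0.
by rewrite le_eqVlt; apply/orP; left; apply/eqP; field.
Qed.

(** Take for g n the largest j <= n whose threshold N j is at most n. *)
Lemma diagonal_speed (N : nat -> nat) : exists g : nat -> nat,
  (forall n, (g n <= g n.+1)%N) /\
  (forall j, exists M, forall n, (M <= n)%N -> (j <= g n)%N /\ (N (g n) <= n)%N).
Proof.
pose g n := (\max_(j < n.+1 | (N j <= n)%N) j)%N.
have gP n j : (j <= n)%N -> (N j <= n)%N -> (j <= g n)%N.
  move=> jn Nj; have jn' : (j < n.+1)%N by [].
  exact: (@leq_bigmax_cond _ (fun j : 'I_n.+1 => (N j <= n)%N) (fun j => j : nat) (Ordinal jn')).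
exists g; split=> [n|j].
  apply/bigmax_leqP => i Ni; apply: gP; first by rewrite ltnW// ltnS ltnW.
  exact: leq_trans Ni (leqnSn n).
(* n >= N 0 makes the set of candidates nonempty, so the maximum is attained; otherwise it would be
   the default 0. *)
exists (maxn (maxn j (N j)) (N 0)) => n; rewrite !geq_max => /andP[/andP[h1 h2] h3].
split; first exact: gP.
have : (0 < #|[pred i : 'I_n.+1 | (N i <= n)%N]|)%N by apply/card_gt0P; exists ord0.
by move=> /(eq_bigmax_cond (fun i : 'I_n.+1 => i : nat)) [i Ni]; rewrite /g => ->.
Qed.

Lemma norm_ball_compact (c : R) : 0 <= c -> compact [set v : 'rV[R]_d | `|v| <= c].
Proof.
move=> c0; have := @rV_compact R d (fun _ => `[- c, c]%classic) (fun _ => @segment_compact R _ _).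
congr compact; apply/seteqP; split => v /= H.
  by apply: norm_rV_le => // i; have := H i; rewrite /= in_itv /= ler_norml.
by move=> i; rewrite /= in_itv /= -ler_norml; exact: le_trans (coord_le_norm v i) H.
Qed.

(** [N j] is the threshold for radius r0 + j and error 1 / (j + 1). Balls of radius r0 + g n grow
    slowly enough for n to be eventually past the threshold of g n, while g n -> infinity gives both
    exhaustion and vanishing error. *)
Lemma unif_approx_exhaustion (F G : nat -> 'rV[int]_d -> R[i]) (mu : R) (alpha : 'rV[R]_d) :
  (forall r eps, 0 < eps -> exists N, forall n x, (N <= n)%N ->
     `|zR x - n%:R *: alpha| <= r -> cmod (F n x - G n x) <= eps * n%:R `^ (- mu)) ->
  forall K : set 'rV[R]_d, compact K -> exists Kn, exhaustion K Kn /\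
    unif_approx F G (fun n x => Kn n (zR x - n%:R *: alpha)) mu.
Proof.
move=> H K cK; have [M [_ HM]] := compact_bounded cK.
pose r0 := `|M| + 1; have r00 : 0 <= r0 by rewrite addr_ge0.
have Kr v : K v -> `|v| <= r0 by apply: HM; rewrite ltr_pwDr// ler_norm.
have e0 j : 0 < j.+1%:R^-1 :> R by rewrite invr_gt0.
have [N HN] := choice (fun j => H (r0 + j%:R) _ (e0 j)).
have [g [gm gP]] := diagonal_speed N.
exists (fun n => [set v | `|v| <= r0 + (g n)%:R]); split; first split.
- move=> n; split; first by apply: norm_ball_compact; rewrite addr_ge0.
  split=> [v /Kr h|v /= h]; first by apply: le_trans h _; rewrite lerDl.
  by apply: le_trans h _; rewrite lerD2l ler_nat.
- apply/seteqP; split => // v _; have [n0 Hn] := gP (Num.trunc `|v|).+1.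
  exists n0 => //=; have [h _] := Hn n0 (leqnn _).
  apply: le_trans (ltW (truncnS_gt `|v|)) _; rewrite -[leLHS]add0r lerD// ler_nat//.
- move=> eps eps0; pose j := (Num.trunc eps^-1).
  have [n0 Hn] := gP j; exists n0 => n nn x /= hx; have [h1 h2] := Hn n nn.
  apply: le_trans (HN _ n x h2 hx) _; rewrite ler_wpM2r ?powR_ge0//.
  rewrite invf_ple ?posrE//; apply: le_trans (ltW (truncnS_gt eps^-1)) _.
  by rewrite ler_nat ltnS.
Qed.

End GlobalAsymptotics.

Unset Implicit Arguments.

Theorem mainTheorem13 (R : realType) (d : nat) (phi : 'rV[int]_d -> R[i])
    (D : 'rV[R]_d -> tdata R d) (mu : R) (alpha : 'rV[R]_d) :
  (* phi in S_d and sup |hat phi| = 1 *)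
  in_Sd phi ->
  (forall xi, cmod (fhat phi xi) <= 1) ->
  (forall eps, 0 < eps -> exists xi, 1 - eps < cmod (fhat phi xi)) ->
  (* every point of Omega(phi) is of positive or imaginary homogeneous type,
     with the data D xi *)
  (forall xi, Omega phi xi ->
     if td_pos (D xi) then pos_type phi xi (D xi) else imag_type phi xi (D xi)) ->
  (* mu = mu_phi = min_{xi in Omega(phi)} mu_xi *)
  (exists2 xi, Omega phi xi & mu_pt (D xi) = mu) ->
  (forall xi, Omega phi xi -> mu <= mu_pt (D xi)) ->
  (* hypotheses (i), (ii), (iii) when Omega_i(phi) is nonempty *)
  (forall xi, Omega phi xi -> ~~ td_pos (D xi) -> mu_pt (D xi) < 1) ->
  ((exists xi, Omega phi xi /\ ~~ td_pos (D xi)) ->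
     exists xi, [/\ Omega phi xi, ~~ td_pos (D xi) & mu_pt (D xi) = mu]) ->
  (forall xi, Omega phi xi -> ~~ td_pos (D xi) -> td_alpha (D xi) = alpha) ->
  (* Case 1 *)
  ((forall xi, Omega phi xi -> td_pos (D xi)) ->
     exists s : seq 'rV[R]_d,
       [/\ uniq s,
           (forall xi, xi \in s <-> Omega phi xi /\ mu_pt (D xi) = mu) &
           unif_approx (cpow phi)
             (fun n x => \sum_(xi <- s) term_pos phi D xi n x)
             (fun _ => setT) mu])
  /\
  (* Case 2a *)
  ((exists xi, Omega phi xi /\ ~~ td_pos (D xi)) ->
   ((forall xi, Omega phi xi -> ~~ td_pos (D xi)) \/
    (forall xi, Omega phi xi -> td_pos (D xi) -> mu < mu_pt (D xi))) ->
     exists s : seq 'rV[R]_d,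
       [/\ uniq s,
           (forall xi, xi \in s <->
              [/\ Omega phi xi, ~~ td_pos (D xi) & mu_pt (D xi) = mu]) &
           forall K : set 'rV[R]_d, compact K ->
             exists Kn : nat -> set 'rV[R]_d,
               exhaustion K Kn /\
               unif_approx (cpow phi)
                 (fun n x => \sum_(xi <- s) term_imag phi D alpha xi n x)
                 (fun n x => Kn n (zR x - n%:R *: alpha)) mu])
  /\
  (* Case 2b *)
  ((exists xi, [/\ Omega phi xi, ~~ td_pos (D xi) & mu_pt (D xi) = mu]) ->
   (exists xi, [/\ Omega phi xi, td_pos (D xi) & mu_pt (D xi) = mu]) ->
     exists si sp : seq 'rV[R]_d,
       [/\ uniq si, uniq sp,
           (forall xi, xi \in si <->
              [/\ Omega phi xi, ~~ td_pos (D xi) & mu_pt (D xi) = mu]),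
           (forall xi, xi \in sp <->
              [/\ Omega phi xi, td_pos (D xi) & mu_pt (D xi) = mu]) &
           forall K : set 'rV[R]_d, compact K ->
             exists Kn : nat -> set 'rV[R]_d,
               exhaustion K Kn /\
               unif_approx (cpow phi)
                 (fun n x => \sum_(xi <- si) term_imag phi D alpha xi n x +
                             \sum_(xi <- sp) term_pos phi D xi n x)
                 (fun n x => Kn n (zR x - n%:R *: alpha)) mu]).
Proof.
move=> Sphi phi1 _ types _ mu_min imag_lt1 _ drift.
have [S [uS SP] HS] := global_asymptotics Sphi phi1 types imag_lt1.
have {HS} HS := HS mu mu_min.
have sumS (p : pred 'rV[R]_d) (t : nat -> 'rV[int]_d -> 'rV[R]_d -> R[i]) n x :
    (forall z, Omega phi z -> (mu_pt (D z) == mu) = p z) ->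
    (forall z, Omega phi z -> p z -> point_term phi (D z) z n x = t n x z) ->
    \sum_(z <- S | mu_pt (D z) == mu) point_term phi (D z) z n x = \sum_(z <- [seq z <- S | p z]) t n x z.
  move=> Hp Ht; rewrite big_filter big_seq_cond [RHS]big_seq_cond.
  apply: eq_big => [z|z /andP[/SP O pz]].
    by have [/SP O|//] := boolP (z \in S); rewrite /= Hp.
  by apply: Ht => //; rewrite -Hp.
have pterm z n x : td_pos (D z) -> point_term phi (D z) z n x = term_pos phi D z n x.
  by rewrite /point_term => ->.
have iterm z n x : Omega phi z -> ~~ td_pos (D z) ->
    point_term phi (D z) z n x = term_imag phi D alpha z n x.
  by move=> O tp; rewrite /point_term (negPf tp) (drift _ O tp).
have adm r n x : `|zR x - n%:R *: alpha| <= r -> forall z, z \in S -> admissible (D z) r n x.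
  move=> hr z /SP O; have [tp|tp] := boolP (td_pos (D z)); first by left.
  by right; rewrite (drift _ O tp).
split; [|split].
- move=> allp; exists [seq z <- S | mu_pt (D z) == mu]; split.
  + exact: filter_uniq.
  + by move=> z; rewrite mem_filter; split=> [/andP[/eqP ? /SP]|[/SP -> ->]] //; rewrite eqxx.
  (* Any radius would do: with positive points only, every [x] is admissible. *)
  + move=> eps e0; have [N HN] := HS 0 eps e0; exists N => n Nn x _.
    rewrite -(sumS _ (fun n x z => term_pos phi D z n x)) //.
      by apply: HN => // z /SP /allp; left.
    by move=> z /allp tp _; exact: pterm.
- move=> _ noP; exists [seq z <- S | ~~ td_pos (D z) && (mu_pt (D z) == mu)]; split.
  + exact: filter_uniq.
  + move=> z; rewrite mem_filter; split=> [/andP[/andP[-> /eqP ?] /SP]|[/SP -> -> ->]] //.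
    by rewrite eqxx.
  + apply: unif_approx_exhaustion => r eps e0; have [N HN] := HS r eps e0.
    exists N => n x Nn hx.
    rewrite -(sumS _ (fun n x z => term_imag phi D alpha z n x)).
    * by apply: HN => //; exact: adm.
    * move=> z O; have [tp|//] := boolP (td_pos (D z)); case: noP => [/(_ z O)|/(_ z O tp) /gt_eqF //].
      by rewrite tp.
    * by move=> z O /andP[tp _]; exact: iterm.
- move=> _ _; exists [seq z <- S | ~~ td_pos (D z) && (mu_pt (D z) == mu)],
    [seq z <- S | td_pos (D z) && (mu_pt (D z) == mu)]; split.
  + exact: filter_uniq.
  + exact: filter_uniq.
  + move=> z; rewrite mem_filter; split=> [/andP[/andP[-> /eqP ?] /SP]|[/SP -> -> ->]] //.
    by rewrite eqxx.
  + move=> z; rewrite mem_filter; split=> [/andP[/andP[-> /eqP ?] /SP]|[/SP -> -> ->]] //.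
    by rewrite eqxx.
  + apply: unif_approx_exhaustion => r eps e0; have [N HN] := HS r eps e0.
    exists N => n x Nn hx; have := HN n x Nn (adm _ _ _ hx).
    congr (cmod (_ - _) <= _); rewrite (bigID (fun z => ~~ td_pos (D z))) /= !big_filter.
    by congr (_ + _); rewrite big_seq_cond [RHS]big_seq_cond; apply: eq_big => [z|z];
      rewrite ?negbK (andbC (mu_pt _ == mu)) // => /andP[/SP O /andP[tp _]];
      [exact: iterm|exact: pterm].
Qed.
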